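(* Let $\tau\colon H\twoheadrightarrow G$ and $\tau'\colon H'\twoheadrightarrow G'$ be fundamental epimorphisms of profinite groups, and let $\pi\colon G\twoheadrightarrow G'$ be an epimorphism. There is an epimorphism $\theta\colon H\twoheadrightarrow H'$ such that $\tau'\circ\theta=\pi\circ\tau$ and the resulting commutative square is semi-cartesian (i.e. $\theta(\operatorname{Ker}\tau)=\operatorname{Ker}\tau'$) if and only if (a) $\operatorname{mult}_{\zeta'}(\tau')\le\operatorname{mult}_\zeta(\tau)$ for every $\zeta'\in\Lambda_{\mathrm{na}}(G')$ and $\zeta:=\operatorname{Inf}_\pi(\zeta')\in\Lambda_{\mathrm{na}}(G)$; (b) $\operatorname{Inf}_{\pi,A'}(\operatorname{supp}_{A'}(\tau'))\subseteq\operatorname{supp}_A(\tau)$ for every $A'\in\Lambda_{\mathrm{ab}}(G')$ and $A:=\operatorname{Inf}_\pi(A')\in\Lambda_{\mathrm{ab}}(G)$; and (c) $\nu_{\pi,A'}+\operatorname{mult}_{A'}(\tau')\le\operatorname{mult}_A(\tau)$ for every $A'\in\Lambda_{\mathrm{ab}}(G')$ and $A:=\operatorname{Inf}_\pi(A')\in\Lambda_{\mathrm{ab}}(G)$, where $\nu_{\pi,A'}$ is the nullity (dimension of the kernel) of the restriction $\operatorname{supp}_{A'}(\tau')\to\operatorname{supp}_A(\tau)$ of $\operatorname{Inf}_{\pi,A'}$ to $\operatorname{supp}_{A'}(\tau')$.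
   Context: All groups are profinite, homomorphisms are continuous, subgroups are closed; $\twoheadrightarrow$ denotes an epimorphism. Epimorphisms $\eta\colon H\twoheadrightarrow G$, $\rho\colon E\twoheadrightarrow G$ are isomorphic, $\eta\cong_G\rho$, if there is an isomorphism $\psi\colon H\to E$ with $\eta=\rho\circ\psi$. An epimorphism is indecomposable if it is not an isomorphism and is not a composition of two epimorphisms neither of which is an isomorphism. For $M\triangleleft H$, $\mathcal{N}_M(H)$ is the set of maximal elements among the normal subgroups of $H$ strictly contained in $M$. The fundament kernel of $\tau\colon H\twoheadrightarrow G$ is $\mathcal{M}(\tau)=\bigcap_{N\in\mathcal{N}_{\operatorname{Ker}\tau}(H)}N$ (equal to $\operatorname{Ker}\tau$ if the latter is $1$); $\tau$ is fundamental if $\mathcal{M}(\tau)=1$. $\Lambda_{\mathrm{ab}}(G)$ is the set of isomorphism classes of finite simple $G$-modules; $\Lambda_{\mathrm{na}}(G)$ is a set of representatives of the isomorphism classes of indecomposable epimorphisms onto $G$ with non-abelian kernel. An abelian kernel of an epimorphism onto $G$ is a $G$-module via conjugation. Inflation along $\pi\colon G\twoheadrightarrow G'$: for $\zeta'\colon E'\twoheadrightarrow G'$, $\operatorname{Inf}_\pi(\zeta')$ is the projection $G\times_{G'}E'\twoheadrightarrow G$ (up to isomorphism, so it is identified with its representative in $\Lambda_{\mathrm{na}}(G)$); for a $G'$-module $A'$, $\operatorname{Inf}_\pi(A')$ is $A'$ with $G$ acting via $\pi$; $\operatorname{Inf}_{\pi,A'}\colon H^2(G',A')\to H^2(G,\operatorname{Inf}_\pi(A'))$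 is the inflation map (continuous cohomology). It is linear over $\operatorname{End}_{G'}(A')=\operatorname{End}_G(\operatorname{Inf}_\pi(A'))$. Multiplicities and supports of an epimorphism $\tau\colon H\twoheadrightarrow G$: for $\zeta\in\Lambda_{\mathrm{na}}(G)$, $\operatorname{mult}_\zeta(\tau)=|\{N\triangleleft H : N\le\operatorname{Ker}\tau,\ (H/N\twoheadrightarrow G)\cong_G\zeta\}|$. For $A\in\Lambda_{\mathrm{ab}}(G)$ with finite field $F_A=\operatorname{End}_G(A)$, let $\mathcal{C}_A=\{N\triangleleft H : N\le\operatorname{Ker}\tau,\ \operatorname{Ker}\tau/N\cong_G A\}$ (in particular $\operatorname{Ker}\tau/N$ is abelian), $N_A=\bigcap_{N\in\mathcal{C}_A}N$ ($=\operatorname{Ker}\tau$ if $\mathcal{C}_A=\emptyset$), $H_A=H/N_A$, $B_A=\operatorname{Ker}(H_A\twoheadrightarrow G)=\operatorname{Ker}\tau/N_A$ (a profinite $G$-module), $f_A\in H^2(G,B_A)$ the class of $1\to B_A\to H_A\to G\to1$, $B_A^*=\operatorname{Hom}_G(B_A,A)$ (continuous; an $F_A$-vector space), and $S_A\colon B_A^*\to H^2(G,A)$, $\phi\mapsto\phi_*(f_A)$. Then $\operatorname{mult}_A(\tau)=\dim_{F_A}\operatorname{Ker}S_A$ and $\operatorname{supp}_A(\tau)=\operatorname{Im}S_A$. *)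

(* Defs.v *)
From HB Require Import structures.
From mathcomp Require Import all_boot all_algebra.
From mathcomp Require Import all_classical topology tvs.
Set Implicit Arguments.
Unset Strict Implicit.
Unset Printing Implicit Defensive.
Import GRing.Theory.
Local Open Scope classical_set_scope.
Local Open Scope quotient_scope.
Local Open Scope group_scope.

HB.mixin Record isTopologicalGroup G of Group G & Topological G := {
  mulg_continuous : continuous (fun p : G * G => p.1 * p.2);
  invg_continuous : continuous (fun x : G => x^-1) }.

#[short(type="topGroupType")]
HB.structure Definition TopologicalGroup :=
  { G of Group G & Topological G & isTopologicalGroup G }.

HB.mixin Record isProfinite G of TopologicalGroup G := {
  profinite_compact : compact [set: G];
  profinite_hausdorff : hausdorff_space G;
  profinite_disconnected : totally_disconnected [set: G] }.

#[short(type="profiniteType")]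
HB.structure Definition ProfiniteGroup :=
  { G of TopologicalGroup G & isProfinite G }.

Record epi (H G : topGroupType) := Epi {
  epi_fun :> H -> G;
  epiM : {morph epi_fun : x y / x * y};
  epi_cont : continuous epi_fun;
  epi_surj : forall g, exists h, epi_fun h = g }.

Section EpiTheory.
Variables (H G : topGroupType) (f : epi H G).

Lemma epi1 : f 1 = 1.
Proof. by apply: (mulgI (f 1)); rewrite -epiM !mulg1. Qed.

Lemma epiV x : f x^-1 = (f x)^-1.
Proof. by apply: (mulgI (f x)); rewrite -epiM !mulgV epi1. Qed.

Definition ker : set H := [set x | f x = 1].

Definition is_isom :=
  exists g : G -> H, [/\ continuous g, cancel f g & cancel g f].

Definition abelian_ker := forall x y, ker x -> ker y -> x * y = y * x.

Definition lift_of (g : G) : H := projT1 (cid (epi_surj f g)).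

Lemma lift_ofK : cancel lift_of f.
Proof. by move=> g; rewrite /lift_of; case: cid. Qed.

End EpiTheory.

Definition epi_iso (H E G : topGroupType) (eta : epi H G) (rho : epi E G) :=
  exists psi : epi H E, is_isom psi /\ eta =1 rho \o psi.

Definition indecomposable (H G : profiniteType) (zeta : epi H G) :=
  ~ is_isom zeta /\
  forall (E : profiniteType) (eta1 : epi H E) (eta2 : epi E G),
    zeta =1 eta2 \o eta1 -> is_isom eta1 \/ is_isom eta2.

Record normalSub (H : topGroupType) := NormalSub {
  nset :> set H;
  n1 : nset 1;
  nV : forall x, nset x -> nset x^-1;
  nM : forall x y, nset x -> nset y -> nset (x * y);
  nJ : forall x y, nset x -> nset (x ^ y);
  n_closed : closed nset }.

Section Fundament.
Variable H : topGroupType.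

(* The set N_M(H) of maximal elements. *)
Definition maxnormal (M : set H) : set (normalSub H) :=
  [set N | N `<` M /\
    forall N' : normalSub H, N' `<` M -> N `<=` N' -> N' `<=` N].

Definition fundament_ker (G : topGroupType) (tau : epi H G) : set H :=
  if pselect (ker tau = [set 1]) then ker tau
  else \bigcap_(N in maxnormal (ker tau)) (N : set H).

Definition fundamental (G : topGroupType) (tau : epi H G) :=
  fundament_ker tau = [set 1].

End Fundament.

(* Quotients and fibre products are only equipped with the structure of
   topological groups: that they are profinite when their ingredients are is
   not needed to define multiplicities. *)
Section QuotientGroup.
Variables (H : topGroupType) (N : normalSub H).

Definition coset_rel (x y : H) : bool := `[< nset N (x^-1 * y) >].

Lemma coset_rel_equiv : equiv_class_of coset_rel.
Proof.
split=> [x|x y|y x z].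
- by apply/asboolP; rewrite mulVg; exact: n1.
- apply/asboolP/asboolP => /nV; by rewrite invgM invgK.
- move=> /asboolP xy /asboolP yz; apply/asboolP.
  have := nM xy yz; by rewrite mulgA mulgK.
Qed.

Canonical coset_rel_equivRel := EquivRelPack coset_rel_equiv.
Canonical coset_rel_encModRel := defaultEncModRel coset_rel.

Definition quot : Type := quotient_topology {eq_quot coset_rel}.

HB.instance Definition _ := Topological.on quot.
HB.instance Definition _ := Quotient.on quot.

Definition cproj (x : H) : quot := \pi_quot x.

Lemma cprojE x y : cproj x = cproj y <-> nset N (x^-1 * y).
Proof.
split=> [|xy]; first by move/eqquotP/asboolP.
by apply/eqquotP/asboolP.
Qed.

Lemma cprojK (q : quot) : cproj (repr q) = q. Proof. exact: reprK. Qed.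

Lemma repr_cproj x : exists2 n, nset N n & repr (cproj x) = x * n.
Proof.
exists (x^-1 * repr (cproj x)); last by rewrite mulVKg.
by apply/cprojE; rewrite cprojK.
Qed.

Definition quot_mul (p q : quot) : quot := cproj (repr p * repr q).
Definition quot_inv (p : quot) : quot := cproj (repr p)^-1.

Lemma cprojM x y : quot_mul (cproj x) (cproj y) = cproj (x * y).
Proof.
have [n Nn xE] := repr_cproj x; have [m Nm yE] := repr_cproj y.
rewrite /quot_mul xE yE; apply/cprojE.
rewrite !invgM -!mulgA mulKg.
apply: nM; first exact: nV.
by rewrite -/(conjg _ _); apply: nJ; apply: nV.
Qed.

Lemma cprojV x : quot_inv (cproj x) = cproj x^-1.
Proof.
have [n Nn xE] := repr_cproj x; rewrite /quot_inv xE; apply/cprojE.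
by have := nJ x^-1 Nn; rewrite /conjg !invgK mulgA.
Qed.

Fact quot_mulA : associative quot_mul.
Proof.
move=> p q r; rewrite -(cprojK p) -(cprojK q) -(cprojK r).
by rewrite !cprojM mulgA.
Qed.
Fact quot_mul1 : left_id (cproj 1) quot_mul.
Proof. by move=> p; rewrite -(cprojK p) cprojM mul1g. Qed.
Fact quot_mulr1 : right_id (cproj 1) quot_mul.
Proof. by move=> p; rewrite -(cprojK p) cprojM mulg1. Qed.
Fact quot_mulV : left_inverse (cproj 1) quot_inv quot_mul.
Proof. by move=> p; rewrite -(cprojK p) cprojV cprojM mulVg. Qed.
Fact quot_mulrV : right_inverse (cproj 1) quot_inv quot_mul.
Proof. by move=> p; rewrite -(cprojK p) cprojV cprojM mulgV. Qed.

HB.instance Definition _ :=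
  isGroup.Build quot quot_mulA quot_mul1 quot_mulr1 quot_mulV quot_mulrV.

Lemma cproj_continuous : continuous cproj.
Proof. exact: pi_continuous. Qed.

Lemma mulgr_continuous (a : H) : continuous (fun x => x * a).
Proof.
move=> x; apply: (@continuous_comp _ _ _ (fun x => (x, a)) (fun p => p.1 * p.2)).
  by apply: cvg_pair => /=; [exact: cvg_id|exact: cvg_cst].
exact: mulg_continuous.
Qed.

Lemma cproj_open (U : set H) : open U -> open (cproj @` U).
Proof.
move=> oU; change (open (cproj @^-1` (cproj @` U))).
have -> : cproj @^-1` (cproj @` U) =
    \bigcup_(n in (N : set H)) ((fun x => x * n) @^-1` U).
  apply/seteqP; split => x /=.
    move=> [u Uu /cprojE/nV]; rewrite invgM invgK => xu.
    by exists (x^-1 * u) => //=; rewrite mulVKg.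
  move=> [n Nn /= Uxn]; exists (x * n) => //; apply/cprojE.
  by rewrite invgM mulgVK; apply: nV.
by apply: bigcup_open => n _; apply: open_comp => // x _; exact: mulgr_continuous.
Qed.

Lemma cproj_nbhs (x : H) (U : set H) : nbhs x U -> nbhs (cproj x) (cproj @` U).
Proof.
rewrite nbhsE => -[V [oV Vx] VU]; rewrite nbhsE; exists (cproj @` V).
  by split; [exact: cproj_open|exists x].
exact: image_subset.
Qed.

Fact quot_mulg_continuous : continuous (fun p : quot * quot => p.1 * p.2).
Proof.
move=> [p q] U /=; rewrite -(cprojK p) -(cprojK q) => nU.
set x := repr p; set y := repr q.
have : nbhs (x * y) (cproj @^-1` U).
  by apply: cproj_continuous; rewrite -cprojM.
move=> /(@mulg_continuous H (x, y)) [[V W] /= [Vx Wy] VW].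
exists (cproj @` V, cproj @` W).
  by split; exact: cproj_nbhs.
move=> [_ _] /= [[v Vv <-] [w Ww <-]].
have := VW (v, w) (conj Vv Ww); by rewrite /= -cprojM.
Qed.

Fact quot_invg_continuous : continuous (fun p : quot => p^-1).
Proof.
apply/quotient_continuous => x.
have -> : (fun p : quot => p^-1) \o \pi_quot = cproj \o (fun x => x^-1).
  by apply/funext => z /=; exact: cprojV.
apply: continuous_comp; first exact: invg_continuous.
exact: cproj_continuous.
Qed.

HB.instance Definition _ :=
  isTopologicalGroup.Build quot quot_mulg_continuous quot_invg_continuous.

Variables (G : topGroupType) (tau : epi H G) (leN : N `<=` ker tau).

Definition quot_fun (q : quot) : G := tau (repr q).

Lemma quot_funE x : quot_fun (cproj x) = tau x.
Proof.
rewrite /quot_fun; have [n /leN kn ->] := repr_cproj x.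
by rewrite epiM kn mulg1.
Qed.

Fact quot_funM : {morph quot_fun : p q / p * q}.
Proof.
by move=> p q; rewrite [LHS](quot_funE (repr p * repr q)) epiM.
Qed.

Fact quot_fun_cont : continuous quot_fun.
Proof.
apply/quotient_continuous.
have -> : quot_fun \o \pi_quot = tau by apply/funext => x; exact: quot_funE.
exact: epi_cont.
Qed.

Fact quot_fun_surj g : exists q, quot_fun q = g.
Proof.
by have [h <-] := epi_surj tau g; exists (cproj h); exact: quot_funE.
Qed.

(* The epimorphism H/N ->> G induced by tau. *)
Definition quot_epi : epi quot G := Epi quot_funM quot_fun_cont quot_fun_surj.

End QuotientGroup.

Lemma continuous_to_sub (X T : topologicalType) (A : set T)
    (f : X -> set_type A) :
  continuous (fun x => val (f x)) -> continuous f.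
Proof. by move=> /continuousP fC; apply/continuousP => _ [B oB <-]; exact: fC. Qed.

Lemma continuous_mulg (X : topologicalType) (G : topGroupType) (f g : X -> G) :
  continuous f -> continuous g -> continuous (fun x => f x * g x).
Proof.
move=> fC gC x; apply: (@continuous_comp _ _ _ (fun x => (f x, g x))
  (fun p : G * G => p.1 * p.2)); last exact: mulg_continuous.
by apply: cvg_pair; [exact: fC|exact: gC].
Qed.

Lemma continuous_invg (X : topologicalType) (G : topGroupType) (f : X -> G) :
  continuous f -> continuous (fun x => (f x)^-1).
Proof.
by move=> fC x; apply: continuous_comp; [exact: fC|exact: invg_continuous].
Qed.

Lemma continuous_pair (X Y Z : topologicalType) (f : X -> Y) (g : X -> Z) :
  continuous f -> continuous g -> continuous (fun x => (f x, g x)).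
Proof. by move=> fC gC x; apply: cvg_pair; [exact: fC|exact: gC]. Qed.

Lemma continuous_fun_comp (X Y Z : topologicalType) (f : X -> Y) (g : Y -> Z) :
  continuous f -> continuous g -> continuous (fun x => g (f x)).
Proof. by move=> fC gC x; apply: continuous_comp; [exact: fC|exact: gC]. Qed.

Lemma fst_continuous (X Y : topologicalType) : continuous (@fst X Y).
Proof. by move=> x; exact: cvg_fst. Qed.

Lemma snd_continuous (X Y : topologicalType) : continuous (@snd X Y).
Proof. by move=> x; exact: cvg_snd. Qed.

Section FiberProduct.
Variables (G G' E' : topGroupType) (pi : epi G G') (zeta : epi E' G').

Definition fprod_set : set (G * E') := [set p | pi p.1 = zeta p.2].
Definition fprod : Type := set_type fprod_set.

HB.instance Definition _ := SubChoice.on fprod.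
HB.instance Definition _ := Topological.on fprod.

Fact fprod_closed : group_closed (fun p : G * E' => p \in fprod_set).
Proof.
split=> [|p q]; rewrite !inE /fprod_set /= ?epi1 // => pE qE.
by rewrite !epiM !epiV pE qE.
Qed.

HB.instance Definition _ :=
  SubChoice_isSubGroup.Build _ _ fprod fprod_closed.

Lemma fprod_val_continuous : continuous (val : fprod -> G * E').
Proof. exact: initial_continuous. Qed.

Fact fprod_mulg_continuous : continuous (fun p : fprod * fprod => p.1 * p.2).
Proof.
have vC := fprod_val_continuous; apply: continuous_to_sub.
have c1 := continuous_fun_comp (@fst_continuous fprod fprod) vC.
have c2 := continuous_fun_comp (@snd_continuous fprod fprod) vC.
apply: continuous_pair; apply: continuous_mulg.
- exact: continuous_fun_comp c1 (@fst_continuous _ _).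
- exact: continuous_fun_comp c2 (@fst_continuous _ _).
- exact: continuous_fun_comp c1 (@snd_continuous _ _).
- exact: continuous_fun_comp c2 (@snd_continuous _ _).
Qed.

Fact fprod_invg_continuous : continuous (fun x : fprod => x^-1).
Proof.
have vC := fprod_val_continuous; apply: continuous_to_sub.
apply: continuous_pair; apply: continuous_invg; apply: continuous_fun_comp vC _.
  exact: fst_continuous.
exact: snd_continuous.
Qed.

HB.instance Definition _ :=
  isTopologicalGroup.Build fprod fprod_mulg_continuous fprod_invg_continuous.

Definition inf_fun (p : fprod) : G := (val p).1.

Fact inf_funM : {morph inf_fun : p q / p * q}. Proof. by []. Qed.

Fact inf_fun_cont : continuous inf_fun.
Proof.
move=> p; apply: (@continuous_comp _ _ _ (val : fprod -> G * E') fst).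
  exact: fprod_val_continuous.
exact: cvg_fst.
Qed.

Fact inf_fun_surj g : exists p, inf_fun p = g.
Proof.
have [e eE] := epi_surj zeta (pi g).
have ge : (g, e) \in fprod_set by rewrite inE.
by exists (exist _ (g, e) ge).
Qed.

Definition inf_epi : epi fprod G := Epi inf_funM inf_fun_cont inf_fun_surj.

End FiberProduct.

Local Open Scope ring_scope.

(* Joint continuity of the action is not part of the structure: for kernel
   modules of epimorphisms of profinite groups it is automatic, and finite
   simple modules require it explicitly. *)
Record gmodule (G : topGroupType) := GModule {
  gm_sort :> topologicalZmodType;
  gact : G -> gm_sort -> gm_sort;
  gact1 : forall x, gact 1%g x = x;
  gactM : forall g h x, gact (g * h)%g x = gact g (gact h x);
  gactD : forall g, {morph gact g : x y / x + y} }.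

Section GModTheory.
Variables (G : topGroupType) (M : gmodule G) (g : G).

Lemma gact0 : gact g (0 : M) = 0.
Proof. by apply: (addrI (gact g 0)); rewrite -gactD !addr0. Qed.

Lemma gactN : {morph @gact G M g : x / - x}.
Proof. by move=> x; apply: (addrI (gact g x)); rewrite -gactD !subrr gact0. Qed.

Lemma gactB : {morph @gact G M g : x y / x - y}.
Proof. by move=> x y; rewrite gactD gactN. Qed.

End GModTheory.

(* The elements of Lambda_ab(G), up to isomorphism: finite, discrete and simple
   modules with continuous action. *)
Definition finite_simple (G : topGroupType) (A : gmodule G) :=
  [/\ finite_set [set: A],
      forall U : set A, open U,
      continuous (fun p : G * A => gact p.1 p.2),
      exists x : A, x <> 0 &
      forall S : set A, S 0 -> (forall x y, S x -> S y -> S (x - y)) ->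
        (forall g x, S x -> S (gact g x)) -> S = [set 0] \/ S = setT].

Section KernelModule.
Variables (H G : topGroupType) (tau : epi H G).

Definition kertype (ab : abelian_ker tau) : Type := set_type (ker tau).

Variable ab : abelian_ker tau.
Local Notation K := (kertype ab).

HB.instance Definition _ := SubChoice.on K.
HB.instance Definition _ := Topological.on K.

Lemma kerP (x : K) : ker tau (val x). Proof. exact: set_valP. Qed.

Fact ker_add_proof (x y : K) : (val x * val y)%g \in ker tau.
Proof. by rewrite inE /ker /= epiM (kerP x) (kerP y) mulg1. Qed.
Fact ker_opp_proof (x : K) : (val x)^-1%g \in ker tau.
Proof. by rewrite inE /ker /= epiV (kerP x) invg1. Qed.
Fact ker_zero_proof : 1%g \in ker tau.
Proof. by rewrite inE /ker /= epi1. Qed.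

Definition ker_add (x y : K) : K :=
  exist (fun h => h \in ker tau) _ (ker_add_proof x y).
Definition ker_opp (x : K) : K :=
  exist (fun h => h \in ker tau) _ (ker_opp_proof x).
Definition ker_zero : K := exist (fun h => h \in ker tau) _ ker_zero_proof.

Fact ker_addA : associative ker_add.
Proof. by move=> x y z; apply: val_inj => /=; rewrite mulgA. Qed.
Fact ker_addC : commutative ker_add.
Proof. by move=> x y; apply: val_inj => /=; exact: ab (kerP x) (kerP y). Qed.
Fact ker_add0 : left_id ker_zero ker_add.
Proof. by move=> x; apply: val_inj => /=; rewrite mul1g. Qed.
Fact ker_addN : left_inverse ker_zero ker_opp ker_add.
Proof. by move=> x; apply: val_inj => /=; rewrite mulVg. Qed.

HB.instance Definition _ :=
  GRing.isZmodule.Build K ker_addA ker_addC ker_add0 ker_addN.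

Lemma ker_val_continuous : continuous (val : K -> H).
Proof. exact: initial_continuous. Qed.

Fact ker_add_continuous : continuous (fun p : K * K => p.1 + p.2).
Proof.
have vC := ker_val_continuous; apply: continuous_to_sub.
apply: continuous_mulg.
  exact: continuous_fun_comp (@fst_continuous K K) vC.
exact: continuous_fun_comp (@snd_continuous K K) vC.
Qed.
Fact ker_opp_continuous : continuous (-%R : K -> K).
Proof.
by apply: continuous_to_sub; apply: continuous_invg; exact: ker_val_continuous.
Qed.

HB.instance Definition _ :=
  PreTopologicalNmodule_isTopologicalNmodule.Build K ker_add_continuous.
HB.instance Definition _ :=
  TopologicalNmodule_isTopologicalZmodule.Build K ker_opp_continuous.

Fact ker_act_proof (g : G) (x : K) : (val x ^ (lift_of tau g)^-1)%g \in ker tau.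
Proof.
by rewrite inE /ker /= /conjg !epiM (kerP x) mul1g -epiM mulVg epi1.
Qed.

Definition ker_act (g : G) (x : K) : K :=
  exist (fun h => h \in ker tau) _ (ker_act_proof g x).

(* The action does not depend on the lift of g. *)
Lemma ker_actE (h : H) (x : K) : val (ker_act (tau h) x) = (h * val x * h^-1)%g.
Proof.
rewrite /= /conjg invgK; set u := lift_of tau (tau h).
have kuh : ker tau (u^-1 * h)%g.
  by rewrite /ker /= epiM epiV lift_ofK mulVg.
rewrite -[in RHS](mulVKg u h) invgM; move: (u^-1 * h)%g kuh => w kw.
by rewrite !mulgA -[(u * w * _)%g]mulgA -(ab (kerP x) kw) !mulgA mulgK.
Qed.

Fact ker_act1 x : ker_act 1%g x = x.
Proof.
by apply: val_inj; rewrite -(epi1 tau) ker_actE mul1g invg1 mulg1.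
Qed.
Fact ker_actM g h x : ker_act (g * h)%g x = ker_act g (ker_act h x).
Proof.
apply: val_inj; rewrite -(lift_ofK tau g) -(lift_ofK tau h) -epiM !ker_actE.
by rewrite invgM !mulgA.
Qed.
Fact ker_actD g : {morph ker_act g : x y / x + y}.
Proof. by move=> x y; apply: val_inj; rewrite /= conjMg. Qed.

Definition kermod : gmodule G := GModule ker_act1 ker_actM ker_actD.

End KernelModule.

Section Hom.
Variables (G : topGroupType) (M N : gmodule G).

Definition is_hom (f : M -> N) :=
  [/\ {morph f : x y / x + y},
      forall g x, f (gact g x) = gact g (f x) & continuous f].

Definition hom_pred : {pred M -> N} := [pred f | `[< is_hom f >]].

Record ghom := Hom { hom_fun :> M -> N; hom_in : hom_fun \in hom_pred }.

HB.instance Definition _ := [isSub for hom_fun].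
HB.instance Definition _ := [Choice of ghom by <:].

Lemma homP (f : ghom) : is_hom f. Proof. by case: f => f /= /asboolP. Qed.

Lemma hom0 (f : ghom) : f 0 = 0.
Proof.
by have [fD _ _] := homP f; apply: (addrI (f 0)); rewrite -fD !addr0.
Qed.

Lemma homN (f : ghom) x : f (- x) = - f x.
Proof.
by have [fD _ _] := homP f; apply: (addrI (f x)); rewrite -fD !subrr hom0.
Qed.

Fact hom_closed : zmod_closed hom_pred.
Proof.
split=> [|f f']; rewrite !inE.
  split=> [x y|g x|].
  - by rewrite addr0.
  - by rewrite gact0.
  - exact: cst_continuous.
move=> [fD fG fC] [f'D f'G f'C]; split=> [x y|g x|].
- by rewrite /= !fctE fD f'D opprD addrACA.
- by rewrite !fctE fG f'G gactB.
- move=> x; apply: (@continuous_comp _ _ _ (fun x => (f x, f' x))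
    (fun p : N * N => p.1 - p.2)); last exact: sub_continuous.
  by apply: cvg_pair; [exact: fC|exact: f'C].
Qed.

HB.instance Definition _ := GRing.isZmodClosed.Build (M -> N) hom_pred hom_closed.
HB.instance Definition _ := [SubChoice_isSubZmodule of ghom by <:].

End Hom.

Definition gmod_iso (G : topGroupType) (M N : gmodule G) :=
  exists (f : ghom M N) (g : ghom N M), cancel f g /\ cancel g f.

Section HomComp.
Variables (G : topGroupType).

Fact hom_comp_in (L M N : gmodule G) (f : ghom M N) (f' : ghom L M) :
  f \o f' \in @hom_pred _ L N.
Proof.
rewrite inE; have [fD fG fC] := homP f; have [f'D f'G f'C] := homP f'.
split=> [x y|g x|x] /=; [by rewrite f'D fD|by rewrite f'G fG|].
by apply: continuous_comp; [exact: f'C|exact: fC].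
Qed.

Definition hom_comp L M N (f : ghom M N) (f' : ghom L M) : ghom L N :=
  Hom (hom_comp_in f f').

Fact hom_id_in (M : gmodule G) : idfun \in @hom_pred _ M M.
Proof. by rewrite inE; split=> // x; exact: cvg_id. Qed.

Definition hom_id M : ghom M M := Hom (hom_id_in M).

End HomComp.

Definition EndG (G : topGroupType) (A : gmodule G) : Type := ghom A A.

Section EndRing.
Variables (G : topGroupType) (A : gmodule G).

HB.instance Definition _ := GRing.Zmodule.on (EndG A).

Definition EndG_one : EndG A := hom_id A.
Definition EndG_mul (f g : EndG A) : EndG A := hom_comp f g.

Fact EndG_mulA : associative EndG_mul.
Proof. by move=> f g h; exact: val_inj. Qed.
Fact EndG_mul1 : left_id EndG_one EndG_mul.
Proof. by move=> f; exact: val_inj. Qed.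
Fact EndG_mulr1 : right_id EndG_one EndG_mul.
Proof. by move=> f; exact: val_inj. Qed.
Fact EndG_mulDl : left_distributive EndG_mul +%R.
Proof. by move=> f g h; exact: val_inj. Qed.
Fact EndG_mulDr : right_distributive EndG_mul +%R.
Proof.
move=> f g h; apply/val_inj/funext => x /=.
by have [fD _ _] := homP f; exact: fD.
Qed.

HB.instance Definition _ := GRing.Zmodule_isPzRing.Build (EndG A)
  EndG_mulA EndG_mul1 EndG_mulr1 EndG_mulDl EndG_mulDr.

Variable B : gmodule G.

Definition hom_scale (a : EndG A) (f : ghom B A) : ghom B A := hom_comp a f.

Fact hom_scaleA a b f : hom_scale a (hom_scale b f) = hom_scale (a * b) f.
Proof. exact: val_inj. Qed.
Fact hom_scale1 : left_id 1 hom_scale.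
Proof. by move=> f; exact: val_inj. Qed.
Fact hom_scaleDr : right_distributive hom_scale +%R.
Proof.
move=> a f g; apply/val_inj/funext => x /=.
by have [aD _ _] := homP a; exact: aD.
Qed.
Fact hom_scaleDl f : {morph hom_scale^~ f : a b / a + b}.
Proof. by move=> a b; exact: val_inj. Qed.

HB.instance Definition _ := GRing.Zmodule_isLmodule.Build (EndG A) (ghom B A)
  hom_scaleA hom_scale1 hom_scaleDr hom_scaleDl.

End EndRing.

Lemma continuous_subr (X : topologicalType) (M : topologicalZmodType)
    (f g : X -> M) :
  continuous f -> continuous g -> continuous (f - g).
Proof.
move=> fC gC; have -> : f - g = (fun p : M * M => p.1 - p.2) \o (fun x => (f x, g x)).
  by [].
exact: continuous_fun_comp (continuous_pair fC gC) (@sub_continuous M).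
Qed.

Section Cohomology.
Variables (G : topGroupType) (M : gmodule G).

(* Continuous inhomogeneous cochains. *)
Definition d1 (c : G -> M) (p : G * G) : M :=
  gact p.1 (c p.2) - c (p.1 * p.2)%g + c p.1.

Definition d2 (f : G * G -> M) (g1 g2 g3 : G) : M :=
  gact g1 (f (g2, g3)) - f ((g1 * g2)%g, g3) + f (g1, (g2 * g3)%g) - f (g1, g2).

Definition z2_pred : {pred G * G -> M} :=
  [pred f | `[< continuous f /\ forall g1 g2 g3, d2 f g1 g2 g3 = 0 >]].

Record Z2 := MkZ2 { z2_fun :> G * G -> M; z2_in : z2_fun \in z2_pred }.

HB.instance Definition _ := [isSub for z2_fun].
HB.instance Definition _ := [Choice of Z2 by <:].

Lemma Z2P (f : Z2) : continuous f /\ forall g1 g2 g3, d2 f g1 g2 g3 = 0.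
Proof. by case: f => f /= /asboolP. Qed.

Lemma d2B (f f' : G * G -> M) g1 g2 g3 :
  d2 (f - f') g1 g2 g3 = d2 f g1 g2 g3 - d2 f' g1 g2 g3.
Proof.
rewrite /d2 !fctE gactB !opprD !opprK [RHS]addrACA; congr (_ + _).
rewrite [RHS]addrACA; congr (_ + _).
by rewrite [RHS]addrACA.
Qed.

Fact z2_closed : zmod_closed z2_pred.
Proof.
split=> [|f f']; rewrite !inE.
  split; first exact: cst_continuous.
  by move=> g1 g2 g3; rewrite /d2 gact0 !subr0 addr0.
move=> [fC fZ] [f'C f'Z]; split; first exact: continuous_subr.
by move=> g1 g2 g3; rewrite d2B fZ f'Z subr0.
Qed.

HB.instance Definition _ :=
  GRing.isZmodClosed.Build (G * G -> M) z2_pred z2_closed.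
HB.instance Definition _ := [SubChoice_isSubZmodule of Z2 by <:].

Definition b2_pred : {pred Z2} :=
  [pred f : Z2 | `[< exists c : G -> M, continuous c /\ (f : _ -> _) = d1 c >]].

Fact b2_closed : zmod_closed b2_pred.
Proof.
split=> [|f f']; rewrite !inE.
  exists 0; split; first exact: cst_continuous.
  by apply/funext => p; rewrite /d1 gact0 subr0 addr0.
move=> [c [cC fE]] [c' [c'C f'E]]; exists (c - c'); split.
  exact: continuous_subr.
have -> : ((f - f' : Z2) : G * G -> M) = (f : _ -> _) - (f' : _ -> _) by [].
rewrite fE f'E; apply/funext => p; rewrite /d1 !fctE gactB !opprD !opprK.
rewrite [LHS]addrACA; congr (_ + _); by rewrite [LHS]addrACA.
Qed.

HB.instance Definition _ := GRing.isZmodClosed.Build Z2 b2_pred b2_closed.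

Definition H2 : Type := Quotient.quot b2_pred.

HB.instance Definition _ := GRing.Zmodule.on H2.
HB.instance Definition _ := Quotient.on H2.

Definition class2 (f : Z2) : H2 := \pi_H2 f.

Lemma class2E f f' : class2 f = class2 f' <-> f - f' \in b2_pred.
Proof.
split=> [/eqP ffE|ffE].
  by rewrite Quotient.idealrBE.
by apply/eqP; rewrite -Quotient.idealrBE.
Qed.

Lemma class2D : {morph class2 : f f' / f + f'}.
Proof.
by move=> f f'; rewrite /class2 /H2 piE.
Qed.

Lemma class2K x : class2 (repr x) = x. Proof. exact: reprK. Qed.

End Cohomology.

Section CohomologyMaps.
Variable G : topGroupType.

Fact z2_map_in (M N : gmodule G) (phi : ghom M N) (f : Z2 M) :
  phi \o f \in @z2_pred _ N.
Proof.
rewrite inE; have [fC fZ] := Z2P f; have [pD pG pC] := homP phi.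
split; first exact: continuous_fun_comp fC pC.
move=> g1 g2 g3.
rewrite /d2 /= -pG -!homN -!pD; have := fZ g1 g2 g3; rewrite /d2 => ->.
exact: hom0.
Qed.

Definition Z2map (M N : gmodule G) (phi : ghom M N) (f : Z2 M) : Z2 N :=
  MkZ2 (z2_map_in phi f).

(* The map phi_* : H^2(G, M) -> H^2(G, N). *)
Definition H2map (M N : gmodule G) (phi : ghom M N) (x : H2 M) : H2 N :=
  class2 (Z2map phi (repr x)).

Lemma H2mapE (M N : gmodule G) (phi : ghom M N) (f : Z2 M) :
  H2map phi (class2 f) = class2 (Z2map phi f).
Proof.
apply/class2E; rewrite inE; have [pD pG pC] := homP phi.
have /class2E : class2 (repr (class2 f)) = class2 f := class2K _.
rewrite inE => -[c [cC fE]]; exists (phi \o c); split.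
  exact: continuous_fun_comp cC pC.
apply/funext => p; move/(congr1 (fun u => u p)): fE.
rewrite /d1 /= -pG -!homN -!pD => <-.
by rewrite /= !fctE pD homN.
Qed.

Variable A : gmodule G.

Definition H2_scale (a : EndG A) (x : H2 A) : H2 A := H2map a x.

Fact H2_scaleA a b x : H2_scale a (H2_scale b x) = H2_scale (a * b) x.
Proof.
rewrite /H2_scale -(class2K x) !H2mapE; congr class2.
exact: val_inj.
Qed.
Fact H2_scale1 : left_id 1 H2_scale.
Proof.
move=> x; rewrite /H2_scale -(class2K x) !H2mapE; congr class2.
exact: val_inj.
Qed.
Fact H2_scaleDr : right_distributive H2_scale +%R.
Proof.
move=> a x y; rewrite /H2_scale -(class2K x) -(class2K y) -class2D !H2mapE -class2D.
congr class2; apply/val_inj/funext => p /=.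
by have [aD _ _] := homP a; exact: aD.
Qed.
Fact H2_scaleDl x : {morph H2_scale^~ x : a b / a + b}.
Proof.
move=> a b; rewrite /H2_scale -(class2K x) !H2mapE -class2D; congr class2.
exact: val_inj.
Qed.

HB.instance Definition _ := GRing.Zmodule_isLmodule.Build (EndG A) (H2 A)
  H2_scaleA H2_scale1 H2_scaleDr H2_scaleDl.

End CohomologyMaps.

Section Inflation.
Variables (G G' : topGroupType) (pi : epi G G') (A' : gmodule G').

Definition inf_act (g : G) (x : A') : A' := gact (pi g) x.

Fact inf_act1 x : inf_act 1%g x = x.
Proof. by rewrite /inf_act epi1 gact1. Qed.
Fact inf_actM g h x : inf_act (g * h)%g x = inf_act g (inf_act h x).
Proof. by rewrite /inf_act epiM gactM. Qed.
Fact inf_actD g : {morph inf_act g : x y / x + y}.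
Proof. exact: gactD. Qed.

Definition inf_mod : gmodule G := GModule inf_act1 inf_actM inf_actD.

Fact z2_inf_in (f : Z2 A') :
  (fun p : G * G => f (pi p.1, pi p.2)) \in @z2_pred G inf_mod.
Proof.
rewrite inE; have [fC fZ] := Z2P f; split.
  apply: continuous_fun_comp fC; apply: continuous_pair.
    exact: continuous_fun_comp (@fst_continuous G G) (@epi_cont _ _ pi).
  exact: continuous_fun_comp (@snd_continuous G G) (@epi_cont _ _ pi).
move=> g1 g2 g3; have := fZ (pi g1) (pi g2) (pi g3).
by rewrite /d2 /= !epiM.
Qed.

Definition Z2inf (f : Z2 A') : Z2 inf_mod := MkZ2 (z2_inf_in f).

Definition H2inf (x : H2 A') : H2 inf_mod := class2 (Z2inf (repr x)).

Lemma H2infE (f : Z2 A') : H2inf (class2 f) = class2 (Z2inf f).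
Proof.
apply/class2E; rewrite inE.
have /class2E : class2 (repr (class2 f)) = class2 f := class2K _.
rewrite inE => -[c [cC fE]]; exists (c \o pi); split.
  exact: continuous_fun_comp (@epi_cont _ _ pi) cC.
apply/funext => p; move/(congr1 (fun u => u (pi p.1, pi p.2))): fE.
by rewrite /d1 /= epiM.
Qed.

End Inflation.

Arguments H2inf {G G'} pi A' x.

Section ExtensionClass.
Variables (H G : topGroupType) (tau : epi H G) (ab : abelian_ker tau).

Record csection := CSection {
  csec :> G -> H;
  csec_cont : continuous csec;
  csecK : cancel csec tau }.

Variable s : csection.

Fact factor_proof (p : G * G) :
  (s p.1 * s p.2 * (s (p.1 * p.2))^-1)%g \in ker tau.
Proof. by rewrite inE /ker /= !epiM epiV !csecK mulgV. Qed.

Definition factor_fun (p : G * G) : kermod ab :=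
  exist (fun h => h \in ker tau) _ (factor_proof p).

Fact factor_in : factor_fun \in @z2_pred _ (kermod ab).
Proof.
rewrite inE; split.
  have c1 := continuous_fun_comp (@fst_continuous G G) (@csec_cont s).
  have c2 := continuous_fun_comp (@snd_continuous G G) (@csec_cont s).
  apply: continuous_to_sub; apply: continuous_mulg.
    exact: continuous_mulg.
  apply: continuous_invg; apply: continuous_fun_comp (@csec_cont s).
  exact: mulg_continuous.
move=> g1 g2 g3; rewrite /d2 [X in X - _]addrAC.
apply/eqP; rewrite subr_eq0 subr_eq; apply/eqP/val_inj.
transitivity (s g1 * (s g2 * s g3 * (s (g2 * g3))^-1) * (s g1)^-1
              * (s g1 * s (g2 * g3) * (s (g1 * (g2 * g3)))^-1))%g.
  congr (_ * _)%g; rewrite -{1}(csecK s g1).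
  exact: (@ker_actE _ _ _ ab (s g1) (factor_fun (g2, g3))).
change ((s g1 * (s g2 * s g3 * (s (g2 * g3))^-1) * (s g1)^-1
         * (s g1 * s (g2 * g3) * (s (g1 * (g2 * g3)))^-1))
        = (s g1 * s g2 * (s (g1 * g2))^-1)
          * (s (g1 * g2) * s g3 * (s (g1 * g2 * g3))^-1))%g.
by rewrite !mulgA !mulgVK.
Qed.

Definition factor_set : Z2 (kermod ab) := MkZ2 factor_in.

End ExtensionClass.

(* The class of 1 -> Ker tau -> H -> G -> 1; independent of the continuous
   section, which exists when H and G are profinite. *)
Definition ext_class (H G : topGroupType) (tau : epi H G)
    (ab : abelian_ker tau) : H2 (kermod ab) :=
  xget 0 (range (fun s : csection tau => class2 (factor_set ab s))).

Section Dimension.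
Variables (R : pzRingType) (V : lmodType R).

Definition lin_indep (X : set V) :=
  forall (s : seq V) (c : V -> R), uniq s -> [set` s] `<=` X ->
    \sum_(v <- s) c v *: v = 0 -> forall v, v \in s -> c v = 0.

Definition lin_span (X : set V) : set V :=
  [set w | exists (s : seq V) (c : V -> R),
    [set` s] `<=` X /\ w = \sum_(v <- s) c v *: v].

Definition is_lin_basis (W X : set V) := lin_indep X /\ lin_span X = W.

(* A chosen basis of the subspace W, standing for its possibly infinite
   dimension, with R a field in the uses below: EndG A for A finite simple. *)
Definition lin_basis (W : set V) : set V := xget set0 (is_lin_basis W).

End Dimension.

Definition card_add (T U : Type) (X : set T) (Y : set U) : set (T + U) :=
  (inl @` X) `|` (inr @` Y).

(* Multiplicities are possibly infinite cardinals, represented by a set of that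
   cardinality. The cardinality of mult_na tau zeta only depends on the
   isomorphism class of zeta. *)
Definition mult_na (H G : topGroupType) (tau : epi H G) (E : topGroupType)
    (zeta : epi E G) : set (normalSub H) :=
  [set N : normalSub H | exists leN : N `<=` ker tau, epi_iso (quot_epi leN) zeta].

Section AbelianMultiplicity.
Variables (H : topGroupType) (G : profiniteType) (tau : epi H G) (A : gmodule G).

Definition C_ab : set (normalSub H) :=
  [set N : normalSub H | exists (leN : N `<=` ker tau)
    (ab : abelian_ker (quot_epi leN)), gmod_iso (kermod ab) A].

(* Intersecting with Ker tau matters only when C_ab is empty. *)
Definition N_set : set H :=
  ker tau `&` \bigcap_(N in C_ab) (N : set H).

Fact N_set1 : N_set 1%g.
Proof. by split; [exact: epi1|move=> N _; exact: n1]. Qed.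
Fact N_setV x : N_set x -> N_set x^-1%g.
Proof.
move=> [kx Nx]; split; first by rewrite /ker /= epiV kx invg1.
by move=> N CN; exact: nV (Nx N CN).
Qed.
Fact N_setM x y : N_set x -> N_set y -> N_set (x * y)%g.
Proof.
move=> [kx Nx] [ky Ny]; split; first by rewrite /ker /= epiM kx ky mulg1.
by move=> N CN; exact: nM (Nx N CN) (Ny N CN).
Qed.
Fact N_setJ x y : N_set x -> N_set (x ^ y)%g.
Proof.
move=> [kx Nx]; split.
  by rewrite /ker /= /conjg !epiM kx mul1g -epiM mulVg epi1.
by move=> N CN; exact: nJ (Nx N CN).
Qed.
Fact N_set_closed : closed N_set.
Proof.
apply: closedI; last by apply: closed_bigI => N _; exact: n_closed.
have -> : ker tau = tau @^-1` [set 1%g] by [].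
apply: preimage_closed; first by move=> x _; exact: epi_cont.
exact: accessible_closed_set1 (hausdorff_accessible (@profinite_hausdorff G)) _.
Qed.

Definition N_ab : normalSub H :=
  NormalSub N_set1 N_setV N_setM N_setJ N_set_closed.

Fact N_ab_le : N_ab `<=` ker tau. Proof. by move=> x []. Qed.

(* The epimorphism H_A ->> G. *)
Definition tau_ab : epi (quot N_ab) G := quot_epi N_ab_le.

Fact tau_ab_abelian : abelian_ker tau_ab.
Proof.
move=> x y kx ky; rewrite -(cprojK x) -(cprojK y).
set h := repr x; set k := repr y.
have kh : ker tau h by []. have kk : ker tau k by [].
change (quot_mul (cproj N_ab h) (cproj N_ab k) =
        quot_mul (cproj N_ab k) (cproj N_ab h)).
rewrite !cprojM; apply/cprojE; split.
  by rewrite /ker /= !(epiM, epiV) kh kk !mulg1 invg1.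
move=> N [leN [ab _]]; apply/cprojE; rewrite -!cprojM; apply: ab.
  by rewrite /ker /= quot_funE.
by rewrite /ker /= quot_funE.
Qed.

Definition B_ab : gmodule G := kermod tau_ab_abelian.
Definition f_ab : H2 B_ab := ext_class tau_ab_abelian.

Definition S_ab (phi : ghom B_ab A) : H2 A := H2map phi f_ab.

Definition mult_ab : set (ghom B_ab A) := lin_basis [set phi | S_ab phi = 0].

Definition supp_ab : set (H2 A) := range S_ab.

End AbelianMultiplicity.

Arguments mult_ab {H G} tau A _ : rename.
Arguments supp_ab {H G} tau A _ : rename.

(* The nullity of H2inf restricted to supp_ab tau' A'. *)
Definition nullity (H' G G' : profiniteType) (pi : epi G G') (tau' : epi H' G')
    (A' : gmodule G') : set (H2 A') :=
  lin_basis [set x | supp_ab tau' A' x /\ H2inf pi A' x = 0].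

Arguments nullity {H' G G'} pi tau' A' _ : rename.

Definition semi_cartesian (H G H' G' : topGroupType) (tau : epi H G)
    (tau' : epi H' G') (pi : epi G G') (theta : epi H H') :=
  tau' \o theta =1 pi \o tau /\ theta @` ker tau = ker tau'.

(* Main.v *)
From HB Require Import structures.
Require Import Defs.
From mathcomp Require Import all_boot all_algebra.
From mathcomp Require Import all_classical topology tvs.
Import GRing.Theory.
Local Open Scope classical_set_scope.
Local Open Scope card_scope.
Local Open Scope group_scope.

(** Idea of the proof.

  Suppose theta is given. A normal subgroup N' of H' inside Ker tau' pulls
  back to one of H inside Ker tau, and the quotient of H by it is the fibre
  product of G and H'/N' (forward_na). On the abelian side, phi |-> phi o theta
  is an injective map of duals which is semilinear over the identification of
  endomorphism rings. It intertwines S with inflation, because the class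
  S phi is represented by e exactly when phi extends to a twisted cochain on
  the whole group with defect the inflation of e (S_abP), and such cochains
  can be composed with theta. Both abelian conditions follow, the last one by
  Steinitz exchange (dimension_le).

  For the converse, theta is constructed as an intersection of links. A link
  is the graph of a homomorphism from H to a quotient H'/N' over pi, with
  N' maximal in Ker tau', which maps Ker tau onto Ker tau' / N'; its kernel on
  Ker tau is a maximal N. Given a family of links for which the Chinese
  remainder theorem holds in Ker tau for the N and in Ker tau' for the N', and
  for which the N' have trivial intersection, the pairs (h, h') lying on all
  links form the graph of the required epimorphism (assemble). Compactness
  reduces the Chinese remainder theorem to finite families, where it says that
  no member contains the intersection of the others (independent_crt).

  All N' with Ker tau' / N' non-abelian are used. The inequality between
  non-abelian multiplicities provides the matching N. Distinct N' receive
  distinct N, since N determines the isomorphism class of H'/N' over G': a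
  non-abelian chief factor has trivial centre, so the kernel of H -> H'/N' is
  a centralizer modulo N (na_link_kernel). Non-abelian members are independent
  of all the others by primeness (max_prime_seq).

  For each type A' of abelian chief factors of Ker tau', homomorphisms phi
  and psi from the two kernels to A' define a link between their kernels as
  soon as S psi is the inflation of S phi (ab_link). The conditions on supports
  and on abelian multiplicities are what is needed to match a basis of the dual
  of Ker tau' with independent homomorphisms psi in this way (dimension_ge).
  Linear independence gives independence of the kernels, because a
  homomorphism killed by a finite intersection of maximal subgroups is a sum of
  homomorphisms killed by the single ones (khom_decompose), to which Schur's
  lemma applies. The N' of the resulting family have trivial intersection since
  tau' is fundamental. *)

Set Implicit Arguments.
Unset Strict Implicit.
Unset Printing Implicit Defensive.

(** * Compactness *)

Lemma compact_fip (T : topologicalType) (I : eqType) (f : I -> set T) :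
  compact [set: T] -> (forall i, closed (f i)) ->
  (forall s : seq I, exists x, forall i, i \in s -> f i x) ->
  exists x, forall i, f i x.
Proof.
move=> cT cf fs.
pose D (s : seq I) := [set x | forall i, i \in s -> f i x].
pose F := filter_from setT D.
have FF : ProperFilter F.
  apply: filter_from_proper; last by move=> s _; have [x] := fs s; exists x.
  apply: filter_from_filter; first by exists [::].
  move=> s t _ _; exists (s ++ t) => // x Dx; split=> i ii; apply: Dx;
    by rewrite mem_cat ii ?orbT.
have [x [_ xF]] := cT F FF filterT.
exists x => i; apply: (cf i) => U xU.
have Fi : F (f i) by exists [:: i] => // y; apply; rewrite inE.
by have [y [? ?]] := xF _ _ Fi xU; exists y.
Qed.

Lemma closed_image_compact (T U : topologicalType) (f : T -> U) (A : set T) :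
  compact [set: T] -> hausdorff_space U -> continuous f -> closed A ->
  closed (f @` A).
Proof.
move=> cT hU cf cA; apply: compact_closed => //.
apply: continuous_compact; first exact: continuous_subspaceT.
exact: subclosed_compact cA cT _.
Qed.

Lemma hausdorff_closed1 (T : topologicalType) (x : T) :
  hausdorff_space T -> closed [set x].
Proof. by move=> hT; apply: accessible_closed_set1; exact: hausdorff_accessible. Qed.

Lemma hausdorff_prod (T U : topologicalType) :
  hausdorff_space T -> hausdorff_space U -> hausdorff_space (T * U)%type.
Proof.
move=> hT hU [x y] [x' y'] xy; congr (_, _); [apply: hT|apply: hU] => A B nA nB.
  have nAT : nbhs (x, y) (A `*` setT) by exists (A, setT) => //; split=> //; exact: filterT.
  have nBT : nbhs (x', y') (B `*` setT) by exists (B, setT) => //; split=> //; exact: filterT.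
  by have [[a b] [[/= ? _] [/= ? _]]] := xy _ _ nAT nBT; exists a.
have nAT : nbhs (x, y) (setT `*` A) by exists (setT, A) => //; split=> //; exact: filterT.
have nBT : nbhs (x', y') (setT `*` B) by exists (setT, B) => //; split=> //; exact: filterT.
by have [[a b] [[/= _ ?] [/= _ ?]]] := xy _ _ nAT nBT; exists b.
Qed.

Lemma hausdorff_inj (T U : topologicalType) (f : T -> U) :
  hausdorff_space U -> continuous f -> injective f -> hausdorff_space T.
Proof.
move=> hU cf fi x y xy; apply/fi/hU => A B nA nB.
by have [z [? ?]] := xy _ _ (cf _ _ nA) (cf _ _ nB); exists (f z).
Qed.

Lemma compactTT (T U : topologicalType) :
  compact [set: T] -> compact [set: U] -> compact [set: T * U].
Proof. by move=> cT cU; rewrite -setXTT; exact: compact_setX. Qed.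

Lemma closed_eq (T U : topologicalType) (f g : T -> U) :
  hausdorff_space U -> continuous f -> continuous g ->
  closed [set x | f x = g x].
Proof.
move=> hU cf cg x xfg; apply: hU => A B nA nB.
have nfA : nbhs x (f @^-1` A) by exact: cf.
have ngB : nbhs x (g @^-1` B) by exact: cg.
have [y [fgy [Ay By]]] := xfg _ (filterI nfA ngB).
by exists (f y); split=> //; rewrite fgy.
Qed.

Lemma closed_preimage (T U : topologicalType) (f : T -> U) (A : set U) :
  continuous f -> closed A -> closed (f @^-1` A).
Proof. by move=> cf cA; apply: preimage_closed => // x _; exact: cf. Qed.

Lemma open_preimage (T U : topologicalType) (f : T -> U) (A : set U) :
  continuous f -> open A -> open (f @^-1` A).
Proof. by move=> /continuousP cf oA; exact: cf. Qed.

(** The preimage of a closed set is the projection of a closed part of the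
  graph. *)
Lemma closed_graph_continuous (T U : topologicalType) (f : T -> U) :
  compact [set: T] -> hausdorff_space T -> compact [set: U] ->
  closed [set p : T * U | p.2 = f p.1] -> continuous f.
Proof.
move=> cT hT cU cg; apply/continuous_closedP => F cF.
have -> : f @^-1` F = fst @` ([set p : T * U | p.2 = f p.1] `&` (snd @^-1` F)).
  apply/seteqP; split => [x Fx|x [[y z] /= [-> ?] <-]] //.
  by exists (x, f x).
apply: closed_image_compact => //; first exact: compactTT.
  exact: fst_continuous.
by apply: closedI => //; apply: closed_preimage => //; exact: snd_continuous.
Qed.

(** * Zero-dimensionality and open normal subgroups *)

(** In a compact Hausdorff space quasi-components are connected: a splitting
  of the intersection Q of the clopen sets through x extends to disjoint open
  sets, whose union already contains one of these clopen sets. *)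
Lemma tot_disc_zero_dim (T : topologicalType) :
  compact [set: T] -> hausdorff_space T -> totally_disconnected [set: T] ->
  zero_dimensional T.
Proof.
move=> cT hT tdT x y xy; apply: contrapT => noU.
pose cl := [set D : set T | clopen D /\ D x].
pose Q := \bigcap_(D in cl) D.
have Qx : Q x by move=> D [].
have Qy : Q y by move=> D [cD Dx]; apply: contrapT => nDy; apply: noU; exists D.
have cQ : closed Q by apply: closed_bigI => D [[]].
(* finitely many clopen sets through x exclude the compact complement of W *)
have shrink (W : set T) : open W -> Q `<=` W ->
    exists D, [/\ clopen D, D x & D `<=` W].
  move=> oW QW; apply: contrapT => noD.
  have [//|||z zP] := @compact_fip T {classic option (set T)} (fun o =>
      if o is Some D then (if pselect (cl D) then D else setT) else ~` W).
  - case=> [D|]; last exact: open_closedC.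
    by case: pselect => [[[]]|_] //; exact: closedT.
  - move=> s; apply: contrapT => nox; apply: noD.
    exists (\bigcap_(D in [set D | (Some D : {classic _}) \in s /\ cl D]) D).
    split; last 1 first.
    + move=> z zD; apply: contrapT => nWz; apply: nox; exists z => -[D|] // Ds.
      by case: pselect => // clD; apply: zD.
    + elim: s {nox} => [|[D|] s IHs].
      * rewrite [X in clopen X](_ : _ = setT); first exact: clopenT.
        by apply/seteqP; split=> // z _ D /= [].
      * have [clD|nclD] := pselect (cl D).
          rewrite [X in clopen X](_ : _ = D `&` (\bigcap_(D in
              [set D | (Some D : {classic _}) \in s /\ cl D]) D)).
            by apply: clopenI => //; case: clD.
          apply/seteqP; split=> [z zD|z [Dz zD] E [/=]].
            split; first by apply: zD; split=> //; rewrite inE eqxx.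
            by move=> E [/= Es cE]; apply: zD; split=> //; rewrite inE Es orbT.
          by rewrite inE => /predU1P[[->]//|Es cE]; apply: zD.
        rewrite [X in clopen X](_ : _ = \bigcap_(D in
              [set D | (Some D : {classic _}) \in s /\ cl D]) D) //.
        apply/seteqP; split=> z zD E [/= Es cE]; apply: zD; split=> //.
          by rewrite inE Es orbT.
        by move: Es cE nclD; rewrite inE => /predU1P[[->]|].
      * rewrite [X in clopen X](_ : _ = \bigcap_(D in
              [set D | (Some D : {classic _}) \in s /\ cl D]) D) //.
        apply/seteqP; split=> z zD E [/= Es cE]; apply: zD; split=> //.
          by rewrite inE Es orbT.
        by move: Es; rewrite inE => /predU1P[].
    + by move=> D [_ []].
  - apply: (zP None); apply: QW => D cD.
    by have := zP (Some D); case: pselect.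
have conQ : connected Q.
  move=> B B0 [O oO BO] [C cC BC].
  have cB : closed B by rewrite BC; exact: closedI.
  have cQB : closed (Q `&` ~` O) by apply: closedI => //; exact: open_closedC.
  have [V sV VW] : filter_from (set_nbhs B) closure (~` (Q `&` ~` O)).
    apply: (compact_normal hT cT cB _); apply/set_nbhsP.
    exists (~` (Q `&` ~` O)); split=> //; first exact: closed_openC.
    by rewrite BO => z [_ Oz] [].
  have [V0 [oV0 BV0 V0V]] := (iffLR (set_nbhsP _ _)) sV.
  have [] := shrink (V0 `|` ~` closure V).
  - by apply: openU => //; apply: closed_openC; exact: closed_closure.
  - move=> z Qz; have [Oz|nOz] := pselect (O z); first by left; apply: BV0; rewrite BO.
    by right=> zV; apply: (VW z zV).
  move=> D [[oD cD] Dx DW].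
  have DV : D `&` V0 = D `&` closure V.
    apply/seteqP; split=> z [Dz zV]; split=> //; first exact/subset_closure/V0V.
    by have [//|] := DW z Dz.
  have clDV : clopen (D `&` V0).
    split; first exact: openI.
    by rewrite DV; apply: closedI => //; exact: closed_closure.
  have [Bx|nBx] := pselect (V0 x).
    apply/seteqP; split=> [z|z Qz]; first by rewrite BO => -[].
    have [Dz Vz] : (D `&` V0) z by apply: Qz.
    rewrite BO; split=> //; apply: contrapT => nOz.
    by apply: (VW z) => //; apply: subset_closure; exact: V0V.
  have [b Bb] := B0.
  have Qb : Q b by move: Bb; rewrite BO => -[].
  have clDn : clopen (D `&` ~` V0).
    rewrite (_ : _ `&` _ = D `&` ~` (D `&` V0)); first exact/clopenI/clopenC.
    apply/seteqP; split=> z [Dz]; first by move=> nV; split=> // -[].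
    by move=> nDV; split=> // Vz; apply: nDV.
  have [_ []] : (D `&` ~` V0) b by apply: Qb.
  exact: BV0.
move/eqP: xy; apply; suff : connected_component [set: T] x y.
  by rewrite tdT.
by exists Q.
Qed.

Section TopGroup.
Variable H : topGroupType.

Lemma mulgl_continuous (a : H) : continuous (fun x => a * x).
Proof. by apply: continuous_mulg => ?; [exact: cst_continuous|exact: cvg_id]. Qed.

Lemma nbhs_mulgl (a : H) (U : set H) : nbhs 1 U -> nbhs a [set x | U (a^-1 * x)].
Proof. by move=> nU; apply: (@mulgl_continuous a^-1 a U); rewrite /= mulVg. Qed.

Lemma normalSub_eq (N M : normalSub H) : (N : set H) = M -> N = M.
Proof.
case: N M => [n a b c d e] [n' a' b' c' d' e'] /= E; subst n'.
by congr NormalSub; exact: Prop_irrelevance.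
Qed.

Lemma conjg_mulV (x y : H) : x ^ y = y^-1 * x * y^-1^-1.
Proof. by rewrite invgK /conjg mulgA. Qed.

Lemma nMV (N : normalSub H) x y : nset N x -> nset N y -> nset N (x * y^-1).
Proof. by move=> Nx Ny; apply: nM => //; exact: nV. Qed.

Lemma nJl (N : normalSub H) x y : nset N x -> nset N (y * x * y^-1).
Proof. by move=> Nx; have := nJ y^-1 Nx; rewrite /conjg invgK mulgA. Qed.

Lemma nMr (N : normalSub H) x y : nset N y -> nset N (x * y) <-> nset N x.
Proof.
by move=> Ny; split=> [/nM/(_ (nV Ny))|/nM]; [rewrite mulgK|apply].
Qed.

Definition capN (N M : normalSub H) : normalSub H.
Proof.
refine (@NormalSub H (N `&` M) _ _ _ _ _).
- by split; exact: n1.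
- by move=> x [? ?]; split; exact: nV.
- by move=> x y [? ?] [? ?]; split; exact: nM.
- by move=> x y [? ?]; split; exact: nJ.
- by apply: closedI; exact: n_closed.
Defined.

Lemma kerM (G : topGroupType) (f : epi H G) x y :
  ker f x -> ker f y -> ker f (x * y).
Proof. by rewrite /ker /= epiM => -> ->; rewrite mulg1. Qed.

Lemma kerV (G : topGroupType) (f : epi H G) x : ker f x -> ker f x^-1.
Proof. by rewrite /ker /= epiV => ->; rewrite invg1. Qed.

Lemma kerJ (G : topGroupType) (f : epi H G) x y : ker f x -> ker f (y * x * y^-1).
Proof. by rewrite /ker /= !epiM epiV => ->; rewrite mulg1 mulgV. Qed.

Lemma ker_div (G : topGroupType) (f : epi H G) x y :
  f x = f y -> ker f (x * y^-1).
Proof. by rewrite /ker /= epiM epiV => ->; rewrite mulgV. Qed.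

Lemma ker_divl (G : topGroupType) (f : epi H G) x y :
  f x = f y -> ker f (x^-1 * y).
Proof. by rewrite /ker /= epiM epiV => ->; rewrite mulVg. Qed.

Lemma kerMl (G : topGroupType) (f : epi H G) x y : ker f x -> f (x * y) = f y.
Proof. by rewrite epiM => ->; rewrite mul1g. Qed.

Lemma kerMr (G : topGroupType) (f : epi H G) x y : ker f x -> f (y * x) = f y.
Proof. by rewrite epiM => ->; rewrite mulg1. Qed.

Lemma ker_closed (G : topGroupType) (f : epi H G) :
  hausdorff_space G -> closed (ker f).
Proof.
move=> hG; exact: (closed_preimage (@epi_cont _ _ f) (hausdorff_closed1 (x := 1) hG)).
Qed.

Definition kerN (G : topGroupType) (f : epi H G) (hG : hausdorff_space G) :
  normalSub H.
Proof.
refine (@NormalSub H (ker f) (epi1 f) _ _ _ (ker_closed hG)).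
- by move=> x; exact: kerV.
- by move=> x y; exact: kerM.
- by move=> x y kx; rewrite /conjg -{2}(invgK y) mulgA; exact: kerJ.
Defined.

Definition cproj_epi (N : normalSub H) : epi H (quot N) :=
  @Epi H (quot N) (cproj N) (fun x y => esym (cprojM N x y))
    (@cproj_continuous H N) (fun q => ex_intro _ (repr q) (cprojK q)).

Lemma ker_cproj (N : normalSub H) x : ker (cproj_epi N) x <-> nset N x.
Proof.
rewrite /ker /=; change (cproj N x = cproj N 1 <-> nset N x).
split=> [/cprojE/nV|Nx]; first by rewrite invgM invgK invg1 mul1g.
by apply/cprojE; rewrite mulg1; exact: nV.
Qed.

End TopGroup.

Arguments cproj_epi {H} N.

Lemma open_sup (H : topGroupType) (V N : normalSub H) :
  open (V : set H) -> V `<=` N -> open (N : set H).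
Proof.
move=> oV VN; have -> : (N : set H) = \bigcup_(n in (N : set H)) [set x | nset V (n^-1 * x)].
  apply/seteqP; split=> [x Nx|x [n Nn /VN /(nM Nn)]]; last by rewrite mulVKg.
  by exists x => //=; rewrite mulVg; exact: n1.
by apply: bigcup_open => n _; apply: (open_preimage _ oV); exact: mulgl_continuous.
Qed.

Lemma zero_dimensional_hausdorff (T : topologicalType) :
  zero_dimensional T -> hausdorff_space T.
Proof.
move=> zT x y xy; apply: contrapT => /eqP /zT [U [[oU cU] Ux nUy]].
have [] := xy U (~` U); [by apply: open_nbhs_nbhs| |by move=> z []].
by apply: open_nbhs_nbhs; split=> //; exact: closed_openC.
Qed.

Section Profinite.
Variable H : profiniteType.

Let cH : compact [set: H] := @profinite_compact H.
Let hH : hausdorff_space H := @profinite_hausdorff H.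

Definition prodN (N M : normalSub H) : normalSub H.
Proof.
refine (@NormalSub H [set x | exists2 n, nset N n & nset M (n^-1 * x)] _ _ _ _ _).
- by exists 1; [exact: n1|rewrite mulg1; apply: nV; exact: n1].
- move=> x [n Nn Mx]; exists (x^-1 * n^-1 * x).
    by have := nJ x (nV Nn); rewrite /conjg mulgA.
  by rewrite !invgM !invgK -!mulgA mulgV mulg1 -(invgK n) -invgM; apply: nV.
- move=> x y [n Nn Mx] [m Nm My]; exists (n * m); first exact: nM.
  rewrite invgM -mulgA [n^-1 * _]mulgA -[y](mulVKg m) [_ * (m * _)]mulgA mulgA.
  exact: (nM (nJ m Mx) My).
- move=> x y [n Nn Mx]; exists (n ^ y); first exact: nJ.
  by rewrite -conjVg -conjMg; exact: nJ.
- have -> : [set x | exists2 n, nset N n & nset M (n^-1 * x)] =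
      (fun p : H * H => p.1 * p.2) @` (fst @^-1` N `&` snd @^-1` M).
    apply/seteqP; split=> [x [n Nn Mx]|x [[n m] /= [Nn Mm] <-]].
      by exists (n, n^-1 * x) => //=; rewrite mulVKg.
    by exists n; rewrite ?mulKg.
  apply: closed_image_compact => //; first exact: compactTT.
    exact: mulg_continuous.
  by apply: closedI; apply: closed_preimage; (try exact: n_closed);
    [exact: fst_continuous|exact: snd_continuous].
Defined.

Lemma prodNP (N M : normalSub H) x :
  nset (prodN N M) x <-> exists2 n, nset N n & nset M (n^-1 * x).
Proof. by []. Qed.

Lemma prodNl (N M : normalSub H) : N `<=` prodN N M.
Proof. by move=> x Nx; apply/prodNP; exists x => //; rewrite mulVg; exact: n1. Qed.

Lemma prodNr (N M : normalSub H) : M `<=` prodN N M.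
Proof. by move=> x Mx; apply/prodNP; exists 1; [exact: n1|rewrite invg1 mul1g]. Qed.

(** For C clopen, the g such that membership of x g y and of x y in C always
  agree form a normal subgroup; its complement is the projection of a closed
  subset of the compact space H ^ 3, so it is open. *)
Lemma open_normal_basis (U : set H) : nbhs 1 U ->
  exists V : normalSub H, open (V : set H) /\ V `<=` U.
Proof.
move=> nU; have zd := tot_disc_zero_dim cH hH (@profinite_disconnected H).
have [C [C1 [oC cC]] CU] := zero_dimensional_cvg hH zd cH nU.
pose V := [set g : H | forall x y, C (x * g * y) <-> C (x * y)].
pose f3 (p : H * H * H) := p.1.1 * p.2 * p.1.2.
pose f2 (p : H * H * H) := p.1.1 * p.1.2.
have cf11 : continuous (fun p : H * H * H => p.1.1).
  by apply: continuous_fun_comp; exact: fst_continuous.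
have cf12 : continuous (fun p : H * H * H => p.1.2).
  by apply: continuous_fun_comp; [exact: fst_continuous|exact: snd_continuous].
have c3 : continuous f3.
  by do 2 (apply: continuous_mulg => //); exact: snd_continuous.
have c2 : continuous f2 by apply: continuous_mulg.
have oV : open V.
  rewrite -[V]setCK; apply: closed_openC.
  have -> : ~` V = snd @` ((f3 @^-1` C `&` f2 @^-1` (~` C)) `|`
                           (f3 @^-1` (~` C) `&` f2 @^-1` C)).
    apply/seteqP; split=> [g /existsNP[x /existsNP[y nxy]]|].
      exists (x, y, g) => //=; rewrite /f3 /f2 /=.
      have [? | ?] := pselect (C (x * g * y)); [left|right];
        have [? | ?] := pselect (C (x * y)) => //; by exfalso; apply: nxy.
    move=> g [[[x y] z] /= xyz <- /(_ x y)]; move: xyz; rewrite /f3 /f2 /=.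
    by case=> -[? ?] [? ?]; intuition.
  apply: closed_image_compact => //; first by do 2 (apply: compactTT => //).
    exact: snd_continuous.
  apply: closedU; apply: closedI; apply: closed_preimage => //; exact: open_closedC.
have cV : closed V.
  have -> : V = \bigcap_(p in [set: H * H])
      [set g | C (p.1 * g * p.2) <-> C (p.1 * p.2)].
    by apply/seteqP; split=> g Vg; [move=> p _; apply: Vg|move=> x y; apply: (Vg (x, y))].
  apply: closed_bigI => -[x y] _ /=.
  have cm : continuous (fun g => x * g * y).
    apply: continuous_mulg; last exact: cst_continuous.
    exact: mulgl_continuous.
  have [Cxy|nCxy] := pselect (C (x * y)).
    rewrite [X in closed X](_ : _ = (fun g => x * g * y) @^-1` C).
      exact: closed_preimage.
    by apply/seteqP; split=> g /=; intuition.
  rewrite [X in closed X](_ : _ = (fun g => x * g * y) @^-1` (~` C)).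
    by apply: closed_preimage => //; exact: open_closedC.
  by apply/seteqP; split=> g /=; rewrite /setC /=; intuition.
have V1 : V 1 by move=> x y; rewrite mulg1.
have VV g : V g -> V g^-1.
  by move=> Vg x y; rewrite -(Vg (x * g^-1) y) mulgVK.
have VM g h : V g -> V h -> V (g * h).
  move=> Vg Vh x y; rewrite -(Vg x y) -(Vh (x * g) y).
  by rewrite !mulgA.
have VJ g h : V g -> V (g ^ h).
  move=> Vg x y; have := Vg (x * h^-1) (h * y).
  by rewrite /conjg !mulgA mulgVK.
exists (NormalSub V1 VV VM VJ cV); split=> //= g Vg.
by apply: CU; have := Vg 1 1; rewrite !mulg1 mul1g => ->.
Qed.

(** As N is closed, some coset x V with V open and normal avoids it. *)
Lemma normal_separate (N : normalSub H) x : ~ nset N x ->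
  exists2 V : normalSub H, open (V : set H) & ~ nset (prodN N V) x.
Proof.
move=> nNx; have nU : nbhs 1 [set y | (~` (N : set H)) (x * y)].
  apply: (@mulgl_continuous _ x 1 (~` (N : set H))); rewrite /= mulg1; apply: open_nbhs_nbhs.
  by split=> //; apply: closed_openC; exact: n_closed.
have [V [oV VU]] := open_normal_basis nU; exists V => // -[n Nn Vx].
have := VU _ (nV Vx); rewrite /setC /= invgM invgK mulgA; apply.
by rewrite mulgV mul1g.
Qed.

Lemma quot_compact (N : normalSub H) : compact [set: quot N].
Proof.
have -> : [set: quot N] = cproj N @` setT.
  by apply/seteqP; split=> // q _; exists (repr q) => //; exact: cprojK.
apply: continuous_compact => //; apply: continuous_subspaceT.
exact: cproj_continuous.
Qed.

Lemma quot_zero_dim (N : normalSub H) : zero_dimensional (quot N).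
Proof.
move=> p q pq.
have npq : ~ nset N ((repr p)^-1 * repr q).
  by move=> /cprojE; rewrite !cprojK => /eqP; apply/negP.
have [V oV nV] := normal_separate npq.
pose M := prodN N V; pose C := [set q' : quot N | nset M ((repr p)^-1 * repr q')].
have CE : cproj N @^-1` C = [set x | nset M ((repr p)^-1 * x)].
  apply/seteqP; split=> x; rewrite /C /=; have [n Nn ->] := repr_cproj N x;
    by rewrite mulgA => ?; apply/(nMr (N := M) _ (prodNl V Nn)).
have oM : open (M : set H) by apply: (open_sup oV); exact: prodNr.
exists C; split; last by [].
  split; first change (open (cproj N @^-1` C)).
    by rewrite CE; apply: (open_preimage _ oM); exact: mulgl_continuous.
  rewrite -[C]setCK; apply: open_closedC; change (open (~` (cproj N @^-1` C))).
  rewrite CE; apply: closed_openC.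
  exact: (closed_preimage (@mulgl_continuous _ (repr p)^-1) (@n_closed _ M)).
  by rewrite /C /=; have := n1 M; rewrite -(mulVg (repr p)).
Qed.

HB.instance Definition _ (N : normalSub H) := isProfinite.Build (quot N)
  (quot_compact (N := N))
  (zero_dimensional_hausdorff (quot_zero_dim (N := N)))
  (zero_dimension_totally_disconnected (quot_zero_dim (N := N))).

(** As N is closed there is an open normal V such that N V does not contain
  Ker f; by maximality N then contains the intersection of Ker f and N V. In
  particular Ker f / N is finite. *)
Lemma maxnormal_open (N : normalSub H) (G : topGroupType) (f : epi H G) :
  hausdorff_space G -> maxnormal (ker f) N ->
  exists2 U : normalSub H, open (U : set H) & U `&` ker f `<=` N.
Proof.
move=> hG [[NK nKN] Nmax].
have [x Kx nNx] : exists2 x, ker f x & ~ nset N x.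
  by apply: contrapT => nex; apply: nKN => x Kx; apply: contrapT => ?; apply: nex; exists x.
have [V oV nV] := normal_separate nNx; exists V => //.
have := Nmax (capN (prodN N V) (kerN f hG)) _ _ => maxM.
apply: subset_trans (maxM _ _).
- by move=> y [Vy Ky]; split=> //; exact: prodNr.
- by split; [move=> y []|move=> /(_ x Kx) []].
- by move=> y Ny; split; [exact: prodNl|exact: NK].
Qed.

End Profinite.

(** * Factoring epimorphisms *)

(** The factor is continuous since the preimage of a closed set under it is the
  image under a of a closed set, which is compact. *)
Lemma epi_factor (H : topGroupType) (E1 E2 : topGroupType) (a : epi H E1) (b : epi H E2) :
  compact [set: H] -> hausdorff_space E1 -> ker a `<=` ker b ->
  exists c : epi E1 E2, forall x, c (a x) = b x.
Proof.
move=> cH hE ab; pose c (e : E1) := b (lift_of a e).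
have cE x : c (a x) = b x.
  have : ker b ((lift_of a (a x)) * x^-1) by apply/ab/ker_div; rewrite lift_ofK.
  by move=> k; rewrite -[RHS](kerMl x k) mulgVK.
have cM : {morph c : x y / x * y}.
  by move=> x y; rewrite -(lift_ofK a x) -(lift_ofK a y) -epiM !cE epiM.
have cC : continuous c.
  apply/continuous_closedP => F cF.
  have -> : c @^-1` F = a @` (b @^-1` F).
    apply/seteqP; split => [x Fx|x [y Fy <-]]; last by rewrite /= cE.
    by exists (lift_of a x); rewrite ?lift_ofK.
  apply: closed_image_compact => //; first exact: epi_cont.
  by apply: (closed_preimage (@epi_cont _ _ b)).
have cS g : exists e, c e = g by have [h <-] := epi_surj b g; exists (a h).
by exists (Epi cM cC cS).
Qed.

Definition id_epi (H : topGroupType) : epi H H :=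
  @Epi H H idfun (fun _ _ => erefl) (fun x => @cvg_id _ (nbhs x)) (fun g => ex_intro _ g erefl).

Definition comp_epi (H E G : topGroupType) (b : epi E G) (a : epi H E) : epi H G.
Proof.
refine (@Epi H G (b \o a) _ _ _).
- by move=> x y; rewrite /= !epiM.
- by apply: continuous_fun_comp; exact: epi_cont.
- move=> g; have [e <-] := epi_surj b g; have [h <-] := epi_surj a e; by exists h.
Defined.

Lemma ker_inj (H G : topGroupType) (f : epi H G) :
  ker f `<=` [set 1] <-> injective f.
Proof.
split=> [kf x y /ker_div/kf/(canRL (mulgVK _))|fi x]; first by rewrite mul1g.
by rewrite /ker /= -(epi1 f) => /fi.
Qed.

Lemma isom_inj (H G : topGroupType) (f : epi H G) : is_isom f -> injective f.
Proof. by move=> [g [_ fK _]]; exact: can_inj fK. Qed.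

Lemma inj_isom (H G : topGroupType) (f : epi H G) :
  compact [set: H] -> hausdorff_space G -> injective f -> is_isom f.
Proof.
move=> cH hG /ker_inj fi.
have [c cf] : exists c : epi G H, forall x, c (f x) = id_epi H x.
  by apply: epi_factor => // x /fi ->; exact: epi1.
exists c; split; [exact: epi_cont|exact: cf|].
by move=> g; have [h <-] := epi_surj f g; rewrite cf.
Qed.

Section EpiIso.
Variables (H1 H2 H3 G : topGroupType).
Variables (f1 : epi H1 G) (f2 : epi H2 G) (f3 : epi H3 G).

Lemma epi_iso_refl : epi_iso f1 f1.
Proof. by exists (id_epi H1); split=> //; exists idfun; split=> //; move=> x; exact: cvg_id. Qed.

Lemma epi_iso_sym : epi_iso f1 f2 -> epi_iso f2 f1.
Proof.
move=> [psi [[g [gC psiK gK]] fE]].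
have gM : {morph g : x y / x * y}.
  by move=> x y; apply: (can_inj psiK); rewrite epiM !gK.
have gS x : exists y, g y = x by exists (psi x).
exists (Epi gM gC gS); split; last by move=> x; rewrite /= fE /= gK.
by exists psi; split=> //; exact: epi_cont.
Qed.

Lemma epi_iso_trans : epi_iso f1 f2 -> epi_iso f2 f3 -> epi_iso f1 f3.
Proof.
move=> [p [[g [gC pK gK]] pE]] [q [[h [hC qK hK]] qE]].
exists (comp_epi q p); split; last by move=> x; rewrite pE /= qE.
exists (g \o h); split; first exact: continuous_fun_comp.
  by move=> x; rewrite /= qK pK.
by move=> x; rewrite /= gK hK.
Qed.

End EpiIso.

(** * Continuous sections *)

Section ContinuousSection.
Variables (H G : profiniteType) (tau : epi H G).

Let cH : compact [set: H] := @profinite_compact H.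
Let hH : hausdorff_space H := @profinite_hausdorff H.
Let hG : hausdorff_space G := @profinite_hausdorff G.

(** A continuous section of H/N ->> G, given by the union X in H of its
  values: a closed set meeting each fibre of tau in exactly one coset of N. *)
Definition partial_section (N X : set H) :=
  [/\ closed X, forall g, exists2 x, X x & tau x = g &
      forall x y, X x -> (X y /\ tau y = tau x) <-> N (x^-1 * y)].

Record partial := Partial {
  psN : normalSub H; psX : set H;
  psP : partial_section psN psX }.

Definition partial_le (p q : partial) : bool :=
  `[< psN q `<=` psN p /\ psX q `<=` psX p >].

Let partial0 : partial.
Proof.
refine (@Partial (kerN tau hG) setT _); split=> [|g|x y _]; first exact: closedT.
  by have [x] := epi_surj tau g; exists x.
rewrite /= /ker /= epiM epiV; split=> [[_ ->]|/(canRL (mulVKg _))].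
  by rewrite mulVg.
by rewrite mulg1.
Qed.

(** Bounds of chains are intersections: by compactness these still meet every
  fibre. *)
Lemma partial_chain (A : set partial) : total_on A partial_le ->
  exists t, forall s, A s -> partial_le s t.
Proof.
move=> tA; have [[p0 Ap0]|A0] := pselect (exists p, A p); last first.
  by exists partial0 => s As; case: A0; exists s.
pose NA := \bigcap_(p in A) (psN p : set H).
have [N NE] : exists N : normalSub H, (N : set H) = NA.
  have cNA : closed NA by apply: closed_bigI => p _; exact: n_closed.
  unshelve eexists (@NormalSub H NA _ _ _ _ cNA) => //.
  - by move=> p _; exact: n1.
  - by move=> x Nx p Ap; apply: nV; exact: Nx.
  - by move=> x y Nx Ny p Ap; apply: nM; [exact: Nx|exact: Ny].
  - by move=> x y Nx p Ap; apply: nJ; exact: Nx.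
pose X := \bigcap_(p in A) psX p.
have XP : partial_section N X.
  split.
  - by apply: closed_bigI => p _; case: (psP p).
  - move=> g.
    have [||x xP] := @compact_fip H {classic option partial} (fun o =>
      if o is Some p then (if pselect (A p) then psX p else setT)
      else tau @^-1` [set g]) cH.
    + case=> [p|]; last first.
        exact: (closed_preimage (@epi_cont _ _ tau) (hausdorff_closed1 (x := g) hG)).
      by case: pselect => ?; [case: (psP p)|exact: closedT].
    + move=> s; have [m Am mmin] : exists2 m, A m & forall p, (Some p : {classic _}) \in s ->
          A p -> partial_le p m.
        elim: s => [|[q|] s [m Am mP]]; first by exists p0.
          have [Aq|nAq] := pselect (A q).
            have [/asboolP [qm1 qm2]|/asboolP [qm1 qm2]] := tA _ _ Aq Am.
              exists m => // p; rewrite inE => /predU1P[[->] _|]; last exact: mP.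
              by apply/asboolP; split.
            exists q => // p; rewrite inE => /predU1P[[->] _|sp Ap].
              by apply/asboolP; split.
            have /asboolP [pm1 pm2] := mP _ sp Ap; apply/asboolP.
            by split; [exact: subset_trans pm1|exact: subset_trans pm2].
          exists m => // p; rewrite inE => /predU1P[[->] //|]; exact: mP.
        by exists m => // p; rewrite inE => /predU1P[//|]; exact: mP.
      have [_ /(_ g) [x Xx xg] _] := psP m; exists x => -[p|] //= sp.
      case: pselect => // Ap; have /asboolP [_] := mmin p sp Ap; exact.
    + exists x; last exact: (xP None).
      by move=> p Ap; have := xP (Some p); case: pselect.
  - move=> x y Xx; rewrite NE; split=> [[Xy xy] p Ap|Nxy].
      by have [_ _ <-] := psP p; [split=> //; exact: Xy|exact: Xx].
    have st p : A p -> psX p y /\ tau y = tau x.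
      by move=> Ap; have [_ _ h] := psP p; apply/h; [exact: Xx|exact: Nxy].
    by split; [move=> p Ap; case: (st p Ap)|case: (st p0 Ap0)].
exists (Partial XP) => p Ap; apply/asboolP; split=> /=; last by move=> x; apply.
by rewrite NE => x; apply.
Qed.

(** Cutting X down by an open normal subgroup U: keep the U-cosets in a
  transversal of NU in H, as these meet each coset of N in one coset of
  the intersection of N and U. *)
Lemma partial_refine (p : partial) (U : normalSub H) : open (U : set H) ->
  exists q, partial_le p q /\ psN q `<=` U.
Proof.
move=> oU; case: p => N X [cX sX uX].
pose M := prodN N U; pose r x := repr (cproj M x).
have rE x y : r x = r y <-> nset M (x^-1 * y).
  split=> [rxy|/cprojE]; last by rewrite /r => ->.
  by apply/cprojE; rewrite -(cprojK (cproj M x)) -(cprojK (cproj M y)) -/(r x) rxy.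
pose V := [set x | nset U ((r x)^-1 * x)].
have VU x u : nset U u -> V (x * u) <-> V x.
  move=> Uu; rewrite /V /=; have -> : r (x * u) = r x.
    by apply/rE; rewrite invgM mulgVK; apply: nV; exact: prodNr.
  by rewrite mulgA; exact: nMr.
have cV : closed V.
  rewrite -[V]setCK; apply: open_closedC.
  have -> : ~` V = \bigcup_(x in ~` V) [set y | nset U (x^-1 * y)].
    apply/seteqP; split=> [x nVx|y [x nVx /= Uxy]].
      by exists x => //=; rewrite mulVg; exact: n1.
    by rewrite -(mulVKg x y) /setC /= (VU _ _ Uxy).
  by apply: bigcup_open => x _; apply: (open_preimage _ oU); exact: mulgl_continuous.
have XV : partial_section (capN N U) (X `&` V).
  split; first exact: closedI.
    move=> g; have [x Xx <-] := sX g.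
    have : nset M (x^-1 * r x) by apply/cprojE; rewrite cprojK.
    move=> [n Nn]; rewrite mulgA -invgM => /nV; rewrite [X in nset U X]invgM invgK => Un.
    have [Xn tn] : X (x * n) /\ tau (x * n) = tau x by apply/uX; rewrite ?mulKg.
    exists (x * n) => //; split=> //; rewrite /V /=.
    suff -> : r (x * n) = r x by [].
    by apply/rE; rewrite invgM mulgVK; apply: nV; exact: prodNl.
  move=> x y [Xx Vx]; split=> [[[Xy Vy] xy]|[Nxy Uxy]].
    have Nxy : nset N (x^-1 * y) by apply/uX.
    split=> //; have rxy : r x = r y by apply/rE; exact: prodNl.
    move: Vx Vy; rewrite /V /= rxy => /nV Vx /(nM Vx).
    by rewrite invgM invgK mulgA mulgK.
  have [Xy xy] : X y /\ tau y = tau x by apply/uX.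
  by split=> //; split=> //; rewrite -(mulVKg x y); apply/VU.
exists (Partial XV); split=> [|x []//]; apply/asboolP.
by split=> x [].
Qed.

(** A maximal partial section has N trivial, since N can be shrunk by every open
  normal subgroup; then X is the image of a section, continuous because X is
  compact. *)
Lemma exists_csection : inhabited (csection tau).
Proof.
have [||//|t tmax] := @ZL_preorder partial partial0 partial_le.
- by move=> t; apply/asboolP; split.
- move=> r s t /asboolP[a b] /asboolP[c d]; apply/asboolP.
  by split; [exact: subset_trans a|exact: subset_trans b].
- exact: partial_chain.
have N1 : psN t `<=` [set 1].
  move=> x Nx; apply: contrapT => x1.
  have nU : nbhs 1 [set y | y <> x].
    apply: open_nbhs_nbhs; split; last by move=> /esym.
    by apply: closed_openC; exact: hausdorff_closed1.
  have [U [oU Ux]] := open_normal_basis nU.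
  have [q [tq qU]] := partial_refine t oU.
  have /asboolP [+ _] := tmax q tq.
  by move=> /(_ x Nx) /qU /Ux.
case: t N1 {tmax} => N X [cX sX uX] /= N1.
pose s g := projT1 (cid2 (sX g)).
have sX' g : X (s g) by rewrite /s; case: cid2.
have sK g : tau (s g) = g by rewrite /s; case: cid2.
have sE x : X x -> s (tau x) = x.
  move=> Xx; have /N1 : nset N (x^-1 * s (tau x)) by apply/uX => //; split.
  by move=> /(canRL (mulVKg _)); rewrite mulg1.
have sC : continuous s.
  apply/continuous_closedP => F cF.
  have -> : s @^-1` F = tau @` (X `&` F).
    apply/seteqP; split=> [g Fg|g [x [Xx Fx] <-]]; last by rewrite /= sE.
    by exists (s g).
  by apply: closed_image_compact => //; [exact: epi_cont|exact: closedI].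
by exists; exists s.
Qed.

End ContinuousSection.

(** * Maximal normal subgroups of a kernel *)

Section Maximal.
Variables (H G : profiniteType) (tau : epi H G).

Let cH : compact [set: H] := @profinite_compact H.
Let hH : hausdorff_space H := @profinite_hausdorff H.
Let hG : hausdorff_space G := @profinite_hausdorff G.

Definition abelian_mod (N : normalSub H) :=
  forall x y, ker tau x -> ker tau y -> nset N ((y * x)^-1 * (x * y)).

Lemma cprojMM (N : normalSub H) x y :
  cproj N (x * y) = cproj N x * cproj N y.
Proof. exact: (epiM (cproj_epi N)). Qed.

Lemma abelian_kerP (N : normalSub H) (leN : N `<=` ker tau) :
  abelian_ker (quot_epi leN) <-> abelian_mod N.
Proof.
split=> [ab x y kx ky|ab p q].
  apply/cprojE; rewrite !cprojMM; apply: ab; rewrite /ker /=; exact: etrans (quot_funE leN _) _.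
rewrite -(cprojK p) -(cprojK q) /ker /= => kp kq.
rewrite -!cprojMM; apply/cprojE; apply: ab.
  by rewrite /ker /= -kq; exact: esym (quot_funE leN _).
by rewrite /ker /= -kp; exact: esym (quot_funE leN _).
Qed.

(** The product of M and N is strictly larger than N, so it is Ker tau. *)
Lemma max_mul (N M : normalSub H) x :
  maxnormal (ker tau) N -> M `<=` ker tau -> ~ M `<=` N -> ker tau x ->
  exists2 m, nset M m & nset N (m^-1 * x).
Proof.
move=> [[NK _] Nmax] MK nMN Kx; apply: contrapT => nx; apply: nMN.
apply: subset_trans (prodNl (N := M) N) _; apply: Nmax; last exact: prodNr.
split=> [y [m Mm Ny]|/(_ x Kx)/prodNP//].
by rewrite -(mulVKg m y); apply: kerM; [exact: MK|exact: NK].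
Qed.

(** If neither X nor Y is contained in N then both map onto Ker tau / N, whose
  commutators then come from commutators of X with Y, that is from N. *)
Lemma max_prime (N X Y : normalSub H) :
  maxnormal (ker tau) N -> ~ abelian_mod N ->
  X `<=` ker tau -> Y `<=` ker tau -> X `&` Y `<=` N ->
  X `<=` N \/ Y `<=` N.
Proof.
move=> Nm nab XK YK XYN; apply: contrapT => /not_orP[nX nY]; apply: nab => x y Kx Ky.
have [a Xa /cprojE ax] := max_mul Nm XK nX Kx.
have [b Yb /cprojE bY] := max_mul Nm YK nY Ky.
apply/cprojE; rewrite !cprojMM -ax -bY -!cprojMM; apply/cprojE/XYN.
rewrite invgM mulgA; split.
  by rewrite -!mulgA; apply: nM; [exact: nV|have := nJ b Xa; rewrite /conjg].
by apply: nM => //; have := nJ a (nV Yb); rewrite /conjg mulgA.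
Qed.

Section Family.
Variables (I : eqType) (N : I -> normalSub H).

Definition capL (s : seq I) : normalSub H :=
  foldr (fun i M => capN (N i) M) (kerN tau hG) s.

Lemma capLP s x : nset (capL s) x <-> ker tau x /\ forall i, i \in s -> nset (N i) x.
Proof.
elim: s => [|i s IHs] /=; first by split=> [|[]].
split=> [[Nx /IHs[Kx sx]]|[Kx sx]].
  by split=> // j; rewrite inE => /predU1P[->//|]; exact: sx.
split; first by apply: sx; rewrite inE eqxx.
by apply/IHs; split=> // j js; apply: sx; rewrite inE js orbT.
Qed.

Lemma capL_ker s : capL s `<=` ker tau.
Proof. by move=> x /capLP[]. Qed.

Definition independent := forall i s, i \notin s -> ~ capL s `<=` N i.

Hypothesis Nmax : forall i, maxnormal (ker tau) (N i).

(** Chinese remainder theorem: a solution x for the indices in s is corrected by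
  an element of the intersection over s, which maps onto Ker tau / N i by
  maximality; infinite families follow by compactness. *)
Lemma independent_crt : independent ->
  forall k : I -> H, (forall i, ker tau (k i)) ->
  exists2 x, ker tau x & forall i, nset (N i) (x^-1 * k i).
Proof.
move=> ind k Kk.
have fin (s : seq I) : exists2 x, ker tau x & forall i, i \in s -> nset (N i) (x^-1 * k i).
  elim: s => [|i s [x Kx xP]]; first by exists 1 => //; exact: epi1.
  have [si|nsi] := boolP (i \in s).
    by exists x => // j; rewrite inE => /predU1P[->|]; exact: xP.
  have [m Mm Nm] := max_mul (Nmax i) (@capL_ker s) (ind _ _ nsi)
    (kerM (kerV Kx) (Kk i)).
  have /capLP[Km sm] := Mm.
  exists (x * m); first exact: kerM.
  move=> j; rewrite invgM -mulgA inE => /predU1P[->//|js].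
  by apply: nM; [apply: nV; exact: sm|exact: xP].
have [||x xP] := @compact_fip H (option I) (fun o =>
    if o is Some i then [set x | nset (N i) (x^-1 * k i)] else ker tau) cH.
- case=> [i|]; last exact: ker_closed.
  have cc : continuous (fun x : H => x^-1 * k i).
    by apply: continuous_mulg => ?; [exact: invg_continuous|exact: cst_continuous].
  exact: (closed_preimage cc (@n_closed _ (N i))).
- move=> s; have [x Kx xP] := fin (pmap id s).
  exists x => -[i|] //= si; apply: xP.
  by rewrite mem_pmap; apply/mapP; exists (Some i).
by exists x; [exact: (xP None)|move=> i; exact: (xP (Some i))].
Qed.

Lemma max_prime_seq (M : normalSub H) s :
  maxnormal (ker tau) M -> ~ abelian_mod M -> capL s `<=` M ->
  exists2 i, i \in s & N i = M.
Proof.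
move=> Mm nab; elim: s => [|i s IHs] /= sM.
  by case: Mm => -[_ nKM _]; case: nKM.
have iK : N i `<=` ker tau by case: (Nmax i) => -[].
have [iM|/IHs[j js <-]] := max_prime Mm nab iK (@capL_ker s) sM.
  exists i; first by rewrite inE eqxx.
  apply/normalSub_eq/seteqP; split=> //.
  by case: (Nmax i) => _; apply=> //; case: Mm.
by exists j => //; rewrite inE js orbT.
Qed.

End Family.

(** * Equivariant homomorphisms on a kernel *)

Section Khom.
Variable A : gmodule G.

(** Only the restriction of chi to Ker tau matters; the last condition is
  continuity when A is discrete. *)
Definition khom (chi : H -> A) :=
  [/\ forall k l, ker tau k -> ker tau l -> chi (k * l) = (chi k + chi l)%R,
      forall h k, ker tau k -> chi (h * k * h^-1) = gact (tau h) (chi k) &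
      exists2 U : set H, nbhs 1 U & forall u, U u -> ker tau u -> chi u = 0%R].

Lemma khom1 chi : khom chi -> chi 1 = 0%R.
Proof.
move=> [cD _ _]; apply: (@addrI _ (chi 1)); rewrite addr0 -cD ?mulg1 //; exact: epi1.
Qed.

Lemma khomV chi k : khom chi -> ker tau k -> chi k^-1 = (- chi k)%R.
Proof.
move=> ck Kk; have [cD _ _] := ck; apply: (@addrI _ (chi k)).
by rewrite -cD ?mulgV ?subrr ?(khom1 ck) //; exact: kerV.
Qed.

Lemma khom0 : khom (fun=> 0%R).
Proof. by split=> *; rewrite ?addr0 ?gact0 //; exists setT => //; exact: filterT. Qed.

Lemma khomB chi psi : khom chi -> khom psi -> khom (fun h => chi h - psi h)%R.
Proof.
move=> [cD cG [U U1 U0]] [pD pG [V V1 V0]]; split=> [k l Kk Kl|h k Kk|].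
- by rewrite cD // pD // opprD addrACA.
- by rewrite cG // pG // gactB.
- exists (U `&` V); first exact: filterI.
  by move=> u [Uu Vu] Ku; rewrite U0 // V0 // subrr.
Qed.

Definition khom_ker (chi : H -> A) (ck : khom chi) : normalSub H.
Proof.
refine (@NormalSub H [set x | ker tau x /\ chi x = 0%R] _ _ _ _ _).
- by split; [exact: epi1|exact: khom1].
- by move=> x [Kx x0]; split; [exact: kerV|rewrite khomV // x0 oppr0].
- move=> x y [Kx x0] [Ky y0]; split; first exact: kerM.
  by have [cD _ _] := ck; rewrite cD // x0 y0 addr0.
- move=> x y [Kx x0]; have [_ cG _] := ck.
  rewrite conjg_mulV;   by split; [exact: kerJ|rewrite cG // x0 gact0].
- have [cD _ [U U1 U0]] := ck => x clx.
  have Kx : ker tau x by apply: (ker_closed hG) => V nV; have [y [[? _] ?]] := clx V nV; exists y.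
  split=> //; have [y [[Ky y0] Uy]] := clx _ (nbhs_mulgl x U1).
  have Kxy : ker tau (x^-1 * y) by apply: kerM => //; exact: kerV.
  have := U0 _ Uy Kxy; rewrite cD ?khomV //; last exact: kerV.
  by rewrite y0 addr0 => /eqP; rewrite oppr_eq0 => /eqP.
Defined.

Lemma khom_kerP chi (ck : khom chi) x :
  nset (khom_ker ck) x <-> ker tau x /\ chi x = 0%R.
Proof. by []. Qed.

Lemma khom_ker_div chi (ck : khom chi) x y : ker tau x -> ker tau y ->
  chi x = chi y -> nset (khom_ker ck) (x^-1 * y).
Proof.
move=> Kx Ky xy; apply/khom_kerP; split; first by apply: kerM => //; exact: kerV.
by have [cD _ _] := ck; rewrite cD ?khomV //; [rewrite xy addNr|exact: kerV].
Qed.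

Lemma khom_ker_abelian chi (ck : khom chi) : abelian_mod (khom_ker ck).
Proof.
move=> x y Kx Ky; have [cD _ _] := ck.
by apply: khom_ker_div; [exact: kerM|exact: kerM|rewrite !cD // addrC].
Qed.

(** The image of a normal subgroup is a submodule. *)
Lemma simple_image (M : normalSub H) chi : finite_simple A -> khom chi ->
  M `<=` ker tau ->
  (forall m, nset M m -> chi m = 0%R) \/
  (forall a, exists2 m, nset M m & chi m = a).
Proof.
move=> [_ _ _ _ sA] ck MK; have [cD cG _] := ck.
have [|||S0|ST] := sA [set a | exists2 m, nset M m & chi m = a].
- by exists 1; [exact: n1|exact: khom1].
- move=> _ _ [m Mm <-] [n Nn <-]; exists (m * n^-1); first exact: nMV.
  by rewrite cD ?khomV //; [exact: MK|exact: MK|apply: kerV; exact: MK].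
- move=> g _ [m Mm <-]; have [h <-] := epi_surj tau g.
  by exists (h * m * h^-1); [exact: nJl|rewrite cG //; exact: MK].
- left=> m Mm; have : [set a | exists2 m, nset M m & chi m = a] (chi m) by exists m.
  by rewrite S0.
- right=> a; have : [set: A] a by [].
  by rewrite -ST.
Qed.

Lemma khom_surj chi : finite_simple A -> khom chi ->
  (exists2 k, ker tau k & chi k <> 0%R) ->
  forall a, exists2 k, ker tau k & chi k = a.
Proof.
move=> sA ck [k Kk k0].
by have [/(_ k Kk)|] := simple_image (M := kerN tau hG) sA ck (fun _ => id).
Qed.

Lemma khom_max chi (ck : khom chi) : finite_simple A ->
  (exists2 k, ker tau k & chi k <> 0%R) -> maxnormal (ker tau) (khom_ker ck).
Proof.
move=> sA [k Kk k0]; split.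
  by split=> [x []//|/(_ k Kk)[]].
move=> N' [N'K nKN'] NN'.
have [z|sur] := simple_image (M := N') sA ck N'K.
  by move=> x N'x; split; [exact: N'K|exact: z].
case: nKN' => x Kx; have [m Nm mx] := sur (chi x).
have := NN' _ (khom_ker_div ck (N'K _ Nm) Kx mx).
by move/(nM Nm); rewrite mulVKg.
Qed.

(** Otherwise the kernel of chi is N by maximality, and Ker tau / N embeds in
  A. *)
Lemma khom_nonabelian (N : normalSub H) chi : maxnormal (ker tau) N ->
  ~ abelian_mod N -> khom chi -> (forall x, nset N x -> chi x = 0%R) ->
  forall k, ker tau k -> chi k = 0%R.
Proof.
move=> [[NK _] Nm] nab ck N0 k Kk; apply: contrapT => k0; apply: nab => x y Kx Ky.
apply: (Nm (khom_ker ck)).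
- by split=> [z []//|/(_ k Kk)[]].
- by move=> z Nz; split; [exact: NK|exact: N0].
- exact: khom_ker_abelian.
Qed.

(** A homomorphism killed by a finite intersection of maximal subgroups is a
  sum of homomorphisms killed by the individual ones: if N i does not already
  contain the intersection M of the others then M maps onto Ker tau / N i,
  so phi restricted to M is the restriction of some alpha killed by N i, and
  phi - alpha is killed by M. *)
Lemma khom_decompose (I : eqType) (N : I -> normalSub H) (s : seq I) phi :
  (forall i, maxnormal (ker tau) (N i)) -> uniq s -> khom phi ->
  (forall x, nset (capL N s) x -> phi x = 0%R) ->
  exists eta : I -> H -> A,
    (forall i, i \in s -> khom (eta i) /\ forall x, nset (N i) x -> eta i x = 0%R) /\
    forall x, ker tau x -> phi x = (\sum_(i <- s) eta i x)%R.
Proof.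
move=> Nmax; elim: s phi => [|i s IHs] phi /=.
  move=> _ pk p0; exists (fun=> fun=> 0%R); split=> // x Kx.
  by rewrite big_nil; exact: p0.
move=> /andP[nis us] pk p0.
set M := capL N s; have MK : M `<=` ker tau by exact: capL_ker.
have extend alpha : khom alpha -> (forall x, nset (N i) x -> alpha x = 0%R) ->
    (forall x, nset M x -> alpha x = phi x) ->
  exists eta : I -> H -> A,
    (forall j, j \in i :: s -> khom (eta j) /\ forall x, nset (N j) x -> eta j x = 0%R) /\
    forall x, ker tau x -> phi x = (\sum_(j <- i :: s) eta j x)%R.
  move=> ak aN aM.
  have [x Mx|eta [etaP etaS]] := IHs _ us (khomB pk ak).
    by rewrite aM // subrr.
  exists (fun j => if j == i then alpha else eta j); split.
    by move=> j; rewrite inE; have [->|_] //= := eqVneq; exact: etaP.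
  move=> x Kx; rewrite big_cons eqxx; apply/eqP; rewrite addrC -subr_eq etaS //.
  apply/eqP/eq_big_seq => j js; rewrite ifF //.
  by apply: contraNF nis => /eqP <-.
have [MN|nMN] := pselect (M `<=` N i).
  have [x Mx|eta [etaP etaS]] := IHs phi us pk; first by apply: p0; split=> //; exact: MN.
  apply: (extend (fun=> 0%R) khom0) => // x Mx.
  by apply/esym/p0; split=> //; exact: MN.
have ex (k : H) : exists m, ker tau k -> nset M m /\ nset (N i) (m^-1 * k).
  have [Kk|] := pselect (ker tau k); last by exists 1.
  by have [m] := max_mul (Nmax i) MK nMN Kk; exists m.
pose f k := projT1 (cid (ex k)).
have fP k : ker tau k -> nset M (f k) /\ nset (N i) ((f k)^-1 * k).
  by rewrite /f; case: cid.
have [pD pG [U U1 U0]] := pk.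
have NK : N i `<=` ker tau by case: (Nmax i) => -[].
have wd m m' : nset M m -> nset M m' -> nset (N i) (m^-1 * m') -> phi m = phi m'.
  move=> Mm Mm' Nmm; apply/esym; rewrite -(mulVKg m m') pD; last 2 first.
  - exact: MK.
  - exact: NK.
  by rewrite (p0 (m^-1 * m')) ?addr0 //; split=> //; apply: nM => //; exact: nV.
have fE k m : ker tau k -> nset M m -> nset (N i) (m^-1 * k) -> phi (f k) = phi m.
  move=> Kk Mm Nmk; have [Mf Nf] := fP k Kk; apply: wd => //.
  by have := nMV Nf Nmk; rewrite invgM invgK mulgA mulgK.
apply: (extend (phi \o f)) => [|x Nx|x Mx] /=.
- split=> [k l Kk Kl|h k Kk|].
  + have [Mk Nk] := fP k Kk; have [Ml Nl] := fP l Kl.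
    rewrite /= -pD; [|exact: MK|exact: MK].
    apply: fE; [exact: kerM|exact: nM|].
    apply/cprojE; rewrite !cprojMM.
    by move/cprojE: Nk => ->; move/cprojE: Nl => ->.
  + have [Mk Nk] := fP k Kk; rewrite /= -pG; last exact: MK.
    apply: fE; [exact: kerJ|exact: nJl|].
    have -> : (h * f k * h^-1)^-1 * (h * k * h^-1) = h * ((f k)^-1 * k) * h^-1.
      by rewrite !invgM invgK !mulgA mulgVK.
    exact: nJl.
  + have [V oV VN] := maxnormal_open hG (Nmax i).
    exists (V : set H); first by apply: open_nbhs_nbhs; split=> //; exact: n1.
    move=> u Vu Ku /=; rewrite (@fE u 1) //; [exact: khom1|exact: n1|].
    by rewrite invg1 mul1g; exact: VN.
- rewrite (@fE x 1) //; [exact: khom1|exact: NK|exact: n1|by rewrite invg1 mul1g].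
- by apply: fE => //; [exact: MK|rewrite mulVg; exact: n1].
Qed.

End Khom.

Lemma khom_comp (A B : gmodule G) (alpha : ghom A B) (chi : H -> A) :
  khom chi -> khom (alpha \o chi).
Proof.
have [aD aG _] := homP alpha.
move=> [cD cG [U U1 U0]]; split=> [k l Kk Kl|h k Kk|] /=.
- by rewrite cD // aD.
- by rewrite cG // aG.
- by exists U => // u Uu Ku; rewrite U0 // hom0.
Qed.

Lemma discrete_continuous (T U : topologicalType) (f : T -> U) :
  (forall A : set T, open A) -> continuous f.
Proof. by move=> dT; apply/continuousP => A _; exact: dT. Qed.

(** Schur: chi identifies its target with Ker tau / ker chi. *)
Lemma khom_factor (A B : gmodule G) (chi : H -> A) (eta : H -> B) (ck : khom chi) :
  finite_simple A -> (exists2 k, ker tau k & chi k <> 0%R) -> khom eta ->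
  (forall x, nset (khom_ker ck) x -> eta x = 0%R) ->
  exists alpha : ghom A B, forall k, ker tau k -> eta k = alpha (chi k).
Proof.
move=> sA nz ek e0; have sur := khom_surj sA ck nz.
have [_ dA _ _ _] := sA.
pose l a := projT1 (cid2 (sur a)).
have lK a : ker tau (l a) by rewrite /l; case: cid2.
have lE a : chi (l a) = a by rewrite /l; case: cid2.
have [cD cG _] := ck; have [eD eG _] := ek.
have eE k a : ker tau k -> chi k = a -> eta (l a) = eta k.
  move=> Kk ka; apply/esym; rewrite -(mulVKg (l a) k) eD //; last first.
    by apply: kerM => //; exact: kerV.
  by rewrite (e0 (_ * k)) ?addr0 //; apply: khom_ker_div; rewrite ?lE.
have hom : (eta \o l) \in @hom_pred _ A B.
  rewrite inE; split=> [a b|g a|] /=.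
  - rewrite -eD //; apply: eE; first exact: kerM.
    by rewrite cD // !lE.
  - have [h <-] := epi_surj tau g; rewrite -eG //; apply: eE; first exact: kerJ.
    by rewrite cG // lE.
  - exact: discrete_continuous.
by exists (Defs.Hom hom) => k Kk /=; apply/esym/eE.
Qed.

End Maximal.

Section Schur.
Variables (G : topGroupType) (A B : gmodule G).

Lemma schur (alpha : ghom A B) : finite_simple A -> finite_simple B ->
  (exists a, alpha a <> 0%R) ->
  exists beta : ghom B A, cancel alpha beta /\ cancel beta alpha.
Proof.
move=> [_ _ _ _ sA] [_ dB _ _ sB] [a0 na0]; have [aD aG _] := homP alpha.
have sur b : exists a, alpha a = b.
  have [|||S0|ST] := sB [set b | exists a, alpha a = b].
  - by exists 0%R; exact: hom0.
  - by move=> _ _ [x <-] [y <-]; exists (x - y)%R; rewrite aD homN.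
  - by move=> g _ [x <-]; exists (gact g x).
  - have : [set b | exists a, alpha a = b] (alpha a0) by exists a0.
    by rewrite S0.
  - have : [set: B] b by [].
    by rewrite -ST.
have inj : injective alpha.
  have [|||S0|ST] := sA [set a | alpha a = 0%R].
  - exact: hom0.
  - by move=> x y /= x0 y0; rewrite aD homN x0 y0 subrr.
  - by move=> g x /= x0; rewrite aG x0 gact0.
  - move=> x y xy; apply/eqP; rewrite -subr_eq0; apply/eqP.
    have : [set a | alpha a = 0%R] (x - y)%R by rewrite /= aD homN xy subrr.
    by rewrite S0.
  - have : [set: A] a0 by [].
    by rewrite -ST.
pose l b := projT1 (cid (sur b)).
have lK : cancel l alpha by move=> b; rewrite /l; case: cid.
have hom : l \in @hom_pred _ B A.
  rewrite inE; split=> [x y|g x|]; try apply: inj.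
  - by rewrite aD !lK.
  - by rewrite aG !lK.
  - exact: discrete_continuous.
exists (Defs.Hom hom); split=> [x|x] /=; [apply: inj|]; exact: lK.
Qed.

End Schur.

Local Open Scope ring_scope.

Lemma card_le_inj (T U : Type) (A : set T) (B : set U) (f : T -> U) :
  (forall x, A x -> B (f x)) ->
  (forall x y, A x -> A y -> f x = f y -> x = y) -> A #<= B.
Proof.
move=> AB fi.
pose g (a : A) : B := SigSub (mem_set (AB _ (set_valP a))).
have gi : {in [set: A] &, injective g}.
  move=> a b _ _ /(congr1 val) /= fab; apply: val_inj.
  by apply: fi => //; exact: set_valP.
have [h hE] := @Pinj _ _ _ g gi.
have [k _] := @injPfun _ _ [set: A] [set: B] h (fun _ _ => I).
by apply/card_leP; exists; exact: k.
Qed.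

Lemma card_le_fun (T U : Type) (A : set T) (B : set U) (u0 : U) : A #<= B ->
  exists f : T -> U, (forall x, A x -> B (f x)) /\
    (forall x y, A x -> A y -> f x = f y -> x = y).
Proof.
move=> /card_leP/unsquash f.
pose g x := if pselect (A x) is left Ax then val (f (SigSub (mem_set Ax))) else u0.
exists g; split=> [x Ax|x y Ax Ay].
  by rewrite /g; case: pselect => // a; exact: set_valP.
rewrite /g; case: pselect => // a; case: pselect => // b /val_inj.
by move=> /(inj (f := f)) h; have := congr1 val (h (mem_set I) (mem_set I)).
Qed.

(** * Linear independence over a division ring *)

Section Span.
Variables (R : pzRingType) (V : lmodType R).

(** Generated inductively rather than by explicit sums: closure properties and
  images under semilinear maps then follow by induction. *)
Inductive lspan (X : set V) : V -> Prop :=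
| span0 : lspan X 0
| spanZD a x v : X x -> lspan X v -> lspan X (a *: x + v).

Lemma span_sub X : X `<=` lspan X.
Proof. by move=> x Xx; rewrite -[x]addr0 -[x]scale1r; apply: spanZD => //; exact: span0. Qed.

Lemma spanD X u v : lspan X u -> lspan X v -> lspan X (u + v).
Proof.
by move=> su sv; elim: su => [|a x w Xx _ IH]; rewrite ?add0r // -addrA; exact: spanZD.
Qed.

Lemma spanZ X a v : lspan X v -> lspan X (a *: v).
Proof.
elim=> [|b x w Xx _ IH]; first by rewrite scaler0; exact: span0.
by rewrite scalerDr scalerA; exact: spanZD.
Qed.

Lemma spanB X u v : lspan X u -> lspan X v -> lspan X (u - v).
Proof. by move=> su sv; rewrite -scaleN1r; apply: spanD => //; exact: spanZ. Qed.

Lemma span_trans X Y : X `<=` lspan Y -> lspan X `<=` lspan Y.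
Proof.
move=> XY v; elim=> [|a x w Xx _ IH]; first exact: span0.
by apply: spanD => //; apply: spanZ; exact: XY.
Qed.

Lemma span_mono X Y : X `<=` Y -> lspan X `<=` lspan Y.
Proof. by move=> XY; apply: span_trans => x /XY; exact: span_sub. Qed.

Lemma span_finite (I : eqType) (E : set I) (f : I -> V) v : lspan (f @` E) v ->
  exists2 s : seq I, (forall i, i \in s -> E i) & lspan (f @` [set` s]) v.
Proof.
elim=> [|a _ w [i Ei <-] _ [s sE sw]]; first by exists [::] => //; exact: span0.
exists (i :: s) => [j|]; first by rewrite inE => /predU1P[->|]; [|exact: sE].
apply: spanZD; first by exists i => //=; rewrite inE eqxx.
by apply: span_mono sw; apply: image_subset => j /= js; rewrite inE js orbT.
Qed.

Lemma spanU1 X x y : lspan (X `|` [set x]) y -> exists a, lspan X (y - a *: x).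
Proof.
elim=> [|a z w zX _ [b bw]]; first by exists 0; rewrite scale0r subr0; exact: span0.
case: zX => [Xz|->].
  by exists b; rewrite -addrA; exact: spanZD.
by exists (a + b); rewrite scalerDl opprD addrACA subrr add0r.
Qed.

(** Independence of a family, in which a repeated vector is a dependency; the
  index set is needed to replace vectors one by one. *)
Definition findep (I : Type) (D : set I) (f : I -> V) :=
  forall i, D i -> ~ lspan (f @` (D `\ i)) (f i).

Lemma findep_sub (I : Type) (D E : set I) (f : I -> V) :
  D `<=` E -> findep E f -> findep D f.
Proof.
move=> DE fE i Di /(@span_mono _ (f @` (E `\ i))) si; apply: (fE i (DE _ Di)); apply: si.
by apply: image_subset => j [/DE].
Qed.

Lemma findep_ext (I : Type) (D : set I) (f g : I -> V) :
  (forall i, D i -> f i = g i) -> findep D f -> findep D g.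
Proof.
move=> fg fD i Di si; apply: (fD i Di); rewrite fg //.
apply: span_mono si => _ [j [Dj ji] <-]; exists j => //; exact: fg.
Qed.

Lemma findep_image (I J : Type) (D : set I) (h : I -> J) (f : J -> V) :
  findep D (f \o h) -> findep (h @` D) f.
Proof.
move=> fD _ [i Di <-] si; apply: (fD i Di); apply: span_mono si.
by move=> _ [_ [[j Dj <-] ji] <-]; exists j => //; split=> // jE; apply: ji; rewrite jE.
Qed.

Lemma findep_inj (I : Type) (D : set I) (Z : set V) (j : I -> V) :
  (forall i, D i -> Z (j i)) -> (forall i k, D i -> D k -> j i = j k -> i = k) ->
  findep Z id -> findep D j.
Proof.
move=> DZ ji fZ i Di si; apply: (fZ _ (DZ _ Di)); apply: span_mono si.
move=> _ [k [Dk ki] <-]; exists (j k) => //; split; first exact: DZ.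
by move=> jki; apply: ki; exact: ji.
Qed.

(** A dependency involves finitely many vectors, so it occurs in one member of
  the chain. *)
Lemma findep_bigcup (I : Type) (F : set (set I)) (f : I -> V) :
  total_on F subset -> (forall D, F D -> findep D f) ->
  findep (\bigcup_(D in F) D) f.
Proof.
move=> tF fF i [D0 FD0 D0i] si.
have [s sE ss] := @span_finite {classic I} _ f _ si.
have [D [FD Di Ds]] : exists D, [/\ F D, D i & forall j, j \in s -> D j].
  elim: s sE {ss} => [|j s IHs] sE; first by exists D0.
  have [|D [FD Di Ds]] := IHs; first by move=> k ks; apply: sE; rewrite inE ks orbT.
  have [[E FE Ej] _] := sE j (mem_head _ _).
  have [DE|ED] := tF _ _ FD FE; [exists E|exists D]; split=> //; try exact: DE;
    move=> k; rewrite inE => /predU1P[->//|]; try exact: ED; move=> /Ds //; exact: DE.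
apply: (fF D FD i Di); apply: span_mono ss => _ [j js <-]; exists j => //.
by split; [exact: Ds|case: (sE j js)].
Qed.

Lemma lin_spanP (X : set V) w : lspan X w <->
  exists (s : seq V) (c : V -> R),
    [/\ uniq s, [set` s] `<=` X & w = \sum_(v <- s) c v *: v].
Proof.
split=> [|[s [c [_ sX ->]]]]; last first.
  elim: s sX => [|x s IHs] sX; first by rewrite big_nil; exact: span0.
  rewrite big_cons; apply: spanZD; first by apply: sX; rewrite /= mem_head.
  by apply: IHs => y /= ys; apply: sX; rewrite /= inE ys orbT.
elim=> [|a x v Xx _ [s [c [us sX ->]]]]; first by exists [::], (fun=> 0); rewrite big_nil.
have [xs|xs] := boolP (x \in s).
  exists s, (fun v => if v == x then a + c x else c v); split=> //.
  rewrite (bigD1_seq x) //= [in RHS](bigD1_seq x) //= eqxx scalerDl -addrA.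
  by do 2 congr (_ + _); apply: eq_bigr => y /negPf ->.
exists (x :: s), (fun v => if v == x then a else c v); split.
- by rewrite /= xs.
- by move=> y /=; rewrite inE => /predU1P[->//|]; exact: sX.
- rewrite big_cons eqxx; congr (_ + _); apply: eq_big_seq => y ys.
  by rewrite ifF //; apply: contraNF xs => /eqP <-.
Qed.

Lemma lin_span_span (X : set V) : lin_span X = lspan X.
Proof.
apply/seteqP; split=> w; last by move/lin_spanP => [s [c [_ sX ->]]]; exists s, c.
move=> [s [c [sX ->]]]; elim: s sX => [|x s IHs] sX; first by rewrite big_nil; exact: span0.
rewrite big_cons; apply: spanZD; first by apply: sX; rewrite /= mem_head.
by apply: IHs => y /= ys; apply: sX; rewrite /= inE ys orbT.
Qed.

Hypothesis nzR : (1 : R) <> 0.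
Hypothesis divR : forall a : R, a <> 0 -> exists b, b * a = 1.

Lemma span_exchange X x y : lspan (X `|` [set x]) y -> ~ lspan X y ->
  lspan (X `|` [set y]) x.
Proof.
move=> /spanU1[a ya] ny; have a0 : a <> 0.
  by move=> a0; apply: ny; move: ya; rewrite a0 scale0r subr0.
have [b ba] := divR a0; rewrite -[x]scale1r -ba -scalerA; apply: spanZ.
rewrite -[a *: x](subKr y); apply: spanB; first by apply: span_sub; right.
by apply: span_mono ya => z; left.
Qed.

Lemma findep_add (I : Type) (D : set I) (f : I -> V) i :
  findep D f -> ~ lspan (f @` D) (f i) -> findep (D `|` [set i]) f.
Proof.
move=> fD ni j Dij si; have [ji|nji] := pselect (j = i).
  apply: ni; rewrite -ji; apply: span_mono si; apply: image_subset => k [].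
  by move=> [//|->] nk; case: nk; rewrite /= ji.
have Dj : D j by case: Dij.
apply: ni; have /span_exchange/(_ (fD j Dj)) : lspan (f @` (D `\ j) `|` [set f i]) (f j).
  by apply: span_mono si => _ [k [[Dk|->] kj] <-]; [left; exists k|right].
apply: span_mono => _ [[k [Dk _] <-]|->]; first by exists k.
by exists j.
Qed.

Lemma lin_indepP (X : set V) : lin_indep X <-> findep X id.
Proof.
split=> [iX x Xx|fX s c us sX s0 v vs].
  rewrite image_id => /lin_spanP[s [c [us sX xE]]].
  have xs : x \notin s by apply/negP => /sX[_]; apply.
  have us' : uniq (x :: s) by rewrite /= xs.
  have := iX _ (fun v => if v == x then -1 else c v) us' _ _ x (mem_head _ _).
  rewrite eqxx => h; apply: nzR; apply/eqP; rewrite -oppr_eq0; apply/eqP/h.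
    by move=> y /=; rewrite inE => /predU1P[->//|/sX[]].
  rewrite big_cons eqxx scaleN1r [X in - X]xE.
  apply/eqP; rewrite addrC subr_eq0; apply/eqP/eq_big_seq => y ys.
  by rewrite ifF //; apply: contraNF xs => /eqP <-.
apply: contrapT => cv; have [b bc] := divR cv.
apply: (fX v (sX _ vs)); rewrite image_id.
have vE : v = - b *: \sum_(u <- s | u != v) c u *: u.
  move: s0; rewrite (bigD1_seq v) //= => /eqP; rewrite addr_eq0 => /eqP cvE.
  by rewrite scaleNr -scalerN -cvE scalerA bc scale1r.
rewrite {2}vE; apply: spanZ; rewrite -big_filter; apply/lin_spanP; exists [seq u <- s | u != v], c.
split=> //; first exact: filter_uniq.
by move=> u /=; rewrite mem_filter => /andP[/eqP uv us']; split; [exact: sX|].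
Qed.

Lemma lin_basisP (W : set V) : W 0 -> (forall x y, W x -> W y -> W (x + y)) ->
  (forall a x, W x -> W (a *: x)) ->
  findep (lin_basis W) id /\ lspan (lin_basis W) = W.
Proof.
move=> W0 WD WZ.
have sW X : X `<=` W -> lspan X `<=` W.
  by move=> XW v; elim=> // a x w /XW Wx _ Ww; apply: WD => //; exact: WZ.
suff [X [fX XW]] : exists X, findep X id /\ lspan X = W.
  have : is_lin_basis W (lin_basis W).
    by apply: (@xgetPex _ set0); exists X; split; rewrite ?lin_span_span //; apply/lin_indepP.
  by move=> [/lin_indepP ?]; rewrite lin_span_span.
have [F FP tF|X [[XW fX] mX]] := @Zorn_bigcup V [set X | X `<=` W /\ findep X id].
  split; first by apply: bigcup_sub => X /FP[].
  by apply: findep_bigcup => // D /FP[].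
exists X; split=> //; apply/seteqP; split; first exact: sW.
move=> w Ww; apply: contrapT => nw.
apply: (mX (X `|` [set w])); last first.
  by split; [rewrite subUset; split=> // _ ->|apply: findep_add => //; rewrite image_id].
split; first by left.
by move=> /(_ w (or_intror erefl)) Xw; apply: nw; exact: span_sub.
Qed.

(** Steinitz exchange without finiteness: a maximal partial replacement of
  the vectors f i by distinct elements of Z preserving independence is total,
  since otherwise Z would lie in the span of the other vectors. *)
Section Steinitz.
Variables (I : Type) (D : set I) (f : I -> V) (Z : set V).
Hypotheses (fD : findep D f) (fZ : f @` D `<=` lspan Z).

Record exchange := Exchange {
  exC : set I; exg : I -> V;
  exP : [/\ exC `<=` D, forall i, exC i -> Z (exg i),
            forall i, ~ exC i -> exg i = f i & findep D exg] }.

Definition exchange_le (p q : exchange) : bool :=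
  `[< exC p `<=` exC q /\ forall i, exC p i -> exg p i = exg q i >].

Lemma exchange_chain (A : set exchange) : total_on A exchange_le ->
  exists t, forall s, A s -> exchange_le s t.
Proof.
move=> tA; have [[p0 Ap0]|A0] := pselect (exists p, A p); last first.
  have P0 : [/\ set0 `<=` D, forall i, set0 i -> Z (f i),
      forall i, ~ set0 i -> f i = f i & findep D f].
    by split; [exact: sub0set|move=> i []| |exact: fD].
  by exists (Exchange P0) => s As; case: A0; exists s.
pose C := \bigcup_(p in A) exC p.
pose g i := if pselect (exists2 p, A p & exC p i) is left e
  then exg (projT1 (cid2 e)) i else f i.
have gE p i : A p -> exC p i -> g i = exg p i.
  move=> Ap pi; rewrite /g; case: pselect => [e|[]]; last by exists p.
  case: cid2 => q /= Aq qi.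
  by have [/asboolP[_ ->]|/asboolP[_ ->]] := tA _ _ Ap Aq.
have gN i : ~ C i -> g i = f i.
  by move=> nC; rewrite /g; case: pselect => // e; case: nC; case: e => p ? ?; exists p.
have chain (s : seq {classic I}) : exists2 p, A p & forall i, i \in s -> g i = exg p i.
  suff [p Ap ps] : exists2 p, A p & forall i, i \in s -> C i -> exC p i.
    exists p => // i si; have [Ci|nCi] := pselect (C i); first exact/gE/ps.
    have [_ _ pf _] := exP p; rewrite gN // pf // => pi; apply: nCi; by exists p.
  elim: s => [|i s [p Ap ps]]; first by exists p0.
  have [[q Aq qi]|nCi] := pselect (C i); last first.
    by exists p => // j; rewrite inE => /predU1P[->|]; [|exact: ps].
  have [/asboolP[pq _]|/asboolP[qp _]] := tA _ _ Ap Aq; [exists q|exists p] => // j;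
    rewrite inE => /predU1P[->|js Cj] //; [by apply/pq/ps|by move=> _; apply: qp|exact: ps].
have P : [/\ C `<=` D, forall i, C i -> Z (g i),
    forall i, ~ C i -> g i = f i & findep D g].
  split=> //.
  - by apply: bigcup_sub => p _; case: (exP p).
  - by move=> i [p Ap pi]; rewrite (gE p) //; case: (exP p) => _ h _ _; exact: h.
  - move=> i Di /(@span_finite {classic I})[s sD ss].
    have [p Ap ps] := chain (i :: s).
    have [_ _ _ /(_ i Di)] := exP p; apply.
    rewrite -ps ?mem_head //; apply: span_mono ss => _ [j js <-].
    exists j; first exact: sD.
    by rewrite -ps // inE js orbT.
exists (Exchange P) => p Ap; apply/asboolP; split=> /= i pi; first by exists p.
by rewrite (gE p).
Qed.

Lemma steinitz : D #<= Z.
Proof.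
have P0 : [/\ set0 `<=` D, forall i, set0 i -> Z (f i),
    forall i, ~ set0 i -> f i = f i & findep D f].
    by split; [exact: sub0set|move=> i []| |exact: fD].
have [|||[C g [CD CZ Cf gD]] tmax] :=
  @ZL_preorder exchange (Exchange P0) exchange_le.
- by move=> p; apply/asboolP; split.
- move=> q p r /asboolP[qp1 qp2] /asboolP[pr1 pr2]; apply/asboolP; split.
    exact: subset_trans pr1.
  by move=> i qi; rewrite qp2 // pr2 //; exact: qp1.
- exact: exchange_chain.
have DC : D `<=` C.
  move=> i Di; apply: contrapT => nCi.
  have [z Zz nz] : exists2 z, Z z & ~ lspan (g @` (D `\ i)) z.
    apply: contrapT => nz; apply: (gD i Di); rewrite Cf //.
    have : lspan Z (f i) by apply: fZ; exists i.
    by apply: span_trans => z Zz; apply: contrapT => ?; apply: nz; exists z.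
  pose g' j := if pselect (j = i) then z else g j.
  have g'i : g' i = z by rewrite /g'; case: pselect.
  have g'j j : j <> i -> g' j = g j by rewrite /g'; case: pselect.
  have P : [/\ C `|` [set i] `<=` D, forall j, (C `|` [set i]) j -> Z (g' j),
      forall j, ~ (C `|` [set i]) j -> g' j = f j & findep D g'].
    split.
    - by rewrite subUset; split=> // _ ->.
    - move=> j; rewrite /g'; case: pselect => // nji [/CZ//|//].
    - by move=> j /not_orP[nCj nji]; rewrite g'j // Cf.
    - have fDi : findep (D `\ i) g'.
        apply: (@findep_ext _ _ g); first by move=> j [_ ji]; rewrite g'j.
        by apply: (@findep_sub _ _ D); [move=> j []|exact: (gD)].
      apply: findep_sub (findep_add (i := i) fDi _).
        by move=> j Dj; have [->|ji] := pselect (j = i); [right|left].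
      rewrite g'i => sz; apply: nz; apply: span_mono sz.
      by move=> _ [j [Dj ji] <-]; exists j => //; rewrite g'j.
  have /tmax/asboolP[/= + _] : exchange_le (Exchange (And4 CD CZ Cf gD)) (Exchange P).
    apply/asboolP; split=> /= [j|j Cj]; first by left.
    by rewrite g'j // => ji; apply: nCi; rewrite -ji.
  by move=> /(_ i (or_intror erefl)).
apply: (@card_le_inj _ _ _ _ g) => [i /DC/CZ//|i j Di Dj gij].
apply: contrapT => nij; apply: (gD i Di); rewrite gij; apply: span_sub.
by exists j => //; split=> // /esym.
Qed.

End Steinitz.

End Span.

(** * Semilinear maps and dimensions *)

Definition sigma_linear (R' R : pzRingType) (sigma : R' -> R)
    (V' : lmodType R') (V : lmodType R) (T : V' -> V) :=
  forall a x y, T (a *: x + y) = sigma a *: T x + T y.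

Section Semilinear.
Variables (R' R : pzRingType) (sigma : R' -> R).
Variables (V' : lmodType R') (V : lmodType R) (T : V' -> V).
Hypotheses (sigma1 : sigma 1 = 1) (TL : sigma_linear sigma T).

Lemma sigma_linear0 : T 0 = 0.
Proof.
have := TL 1 0 0; rewrite sigma1 !scale1r addr0 => /esym/eqP.
by rewrite -subr_eq0 addrK => /eqP.
Qed.
Let T0 := sigma_linear0.

Lemma sigma_linearD x y : T (x + y) = T x + T y.
Proof. by rewrite -[x]scale1r TL sigma1 !scale1r. Qed.

Lemma sigma_linearZ a x : T (a *: x) = sigma a *: T x.
Proof. by rewrite -[a *: x]addr0 TL T0 addr0. Qed.

Lemma span_map X v : lspan X v -> lspan (T @` X) (T v).
Proof.
elim=> [|a x w Xx _ IH]; first by rewrite T0; exact: span0.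
by rewrite TL; apply: spanZD => //; exists x.
Qed.

Lemma span_lift (I : Type) (D : set I) (f : I -> V') v :
  (forall b, exists a, sigma a = b) -> lspan ((T \o f) @` D) v ->
  exists2 u, lspan (f @` D) u & T u = v.
Proof.
move=> sS; elim=> [|b _ w [i Di <-] _ [u su uw]]; first by exists 0; [exact: span0|].
have [a <-] := sS b; exists (a *: f i + u); last by rewrite TL uw.
by apply: spanZD => //; exists i.
Qed.

Lemma findep_map (I : Type) (D : set I) (f : I -> V') :
  (forall b, exists a, sigma a = b) -> injective T -> findep D f -> findep D (T \o f).
Proof.
by move=> sS iT fD i Di /(span_lift sS)[u su /iT uE]; apply: (fD i Di); rewrite -uE.
Qed.

Hypothesis divR' : forall a : R', a <> 0 -> exists b, b * a = 1.

(** In a relation expressing a vector of the first family, exchange isolates a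
  vector of the second family; applying T leaves a dependency between the
  images of the second family. *)
Lemma findep_ker_image (I : Type) (D1 D2 : set I) (f : I -> V') :
  findep D1 f -> (forall i, D1 i -> T (f i) = 0) -> findep D2 (T \o f) ->
  findep (D1 `|` D2) f.
Proof.
move=> f1 T1 f2.
have span_T (E : set I) v : lspan (f @` (D1 `|` E)) v -> lspan ((T \o f) @` E) (T v).
  move/span_map; apply: span_trans => _ [_ [i [D1i|Ei] <-] <-].
    by rewrite T1 //; exact: span0.
  by apply: span_sub; exists i.
move=> i [D1i|D2i]; last first.
  move=> si; apply: (f2 i D2i); rewrite /=; apply: span_T; apply: span_mono si.
  by apply: image_subset => j [[]]; [left|right].
move=> /(@span_finite _ _ {classic I})[s sD].
suff main (t : seq {classic I}) : (forall j, j \in t -> D2 j) -> uniq t ->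
    ~ lspan (f @` ((D1 `\ i) `|` [set` t])) (f i).
  move=> ss; apply: (main [seq j <- undup s | `[< D2 j >]]).
  - by move=> j; rewrite mem_filter => /andP[/asboolP].
  - exact/filter_uniq/undup_uniq.
  - apply: span_mono ss; apply: image_subset => j /= js.
    have [[D1j|D2j] ji] := sD j js; [by left|right].
    by rewrite /= mem_filter mem_undup js andbT; apply/asboolP.
elim: t => [|j t IHt] tD.
  move=> _ si; apply: (f1 i D1i); apply: span_mono si; apply: image_subset.
  by move=> k [].
move=> /= /andP[jt ut] si.
have nt : ~ lspan (f @` ((D1 `\ i) `|` [set` t])) (f i).
  by apply: IHt => // k kt; apply: tD; rewrite inE kt orbT.
have /(span_exchange divR')/(_ nt) : lspan (f @` ((D1 `\ i) `|` [set` t]) `|` [set f j]) (f i).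
  apply: span_mono si => _ [k kP <-]; case: kP => [k1|]; first by left; exists k => //; left.
  by rewrite /= inE => /predU1P[->|kt]; [right|left; exists k => //; right].
move=> sj; apply: (f2 j); first by apply: tD; exact: mem_head.
apply: (@span_mono _ _ ((T \o f) @` [set` t])).
  apply: image_subset => k /= kt; split; first by apply: tD; rewrite inE kt orbT.
  by move=> kj; move: jt; rewrite -kj kt.
apply: span_T; apply: span_mono sj => _ [[k kk <-]|->]; last by exists i => //; left.
by exists k => //; case: kk => [[]|]; [left|right].
Qed.

End Semilinear.

Section Dimension.
Variables (R' R : pzRingType) (sigma : R' -> R).
Hypotheses (nzR' : (1 : R') <> 0) (nzR : (1 : R) <> 0).
Hypotheses (divR' : forall a : R', a <> 0 -> exists b, b * a = 1).
Hypotheses (divR : forall a : R, a <> 0 -> exists b, b * a = 1).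
Hypothesis sigmaS : forall b, exists a, sigma a = b.
Variables (V' W' : lmodType R') (V W : lmodType R).
Variables (S' : V' -> W') (S : V -> W) (J : W' -> W).
Hypotheses (S'L : sigma_linear id S') (SL : sigma_linear id S).
Hypotheses (sigma1 : sigma 1 = 1) (JL : sigma_linear sigma J).

Let S'0 : S' 0 = 0 := sigma_linear0 erefl S'L.
Let S0 : S 0 = 0 := sigma_linear0 erefl SL.
Let J0 : J 0 = 0 := sigma_linear0 sigma1 JL.
Let S'D x y : S' (x + y) = S' x + S' y := sigma_linearD erefl S'L x y.
Let S'Z a x : S' (a *: x) = a *: S' x := sigma_linearZ erefl S'L a x.
Let SD x y : S (x + y) = S x + S y := sigma_linearD erefl SL x y.
Let SZ a x : S (a *: x) = a *: S x := sigma_linearZ erefl SL a x.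
Let JD x y : J (x + y) = J x + J y := sigma_linearD sigma1 JL x y.
Let JZ a x : J (a *: x) = sigma a *: J x := sigma_linearZ sigma1 JL a x.

Let X := lin_basis [set phi | S' phi = 0].
Let Y := lin_basis [set x | range S' x /\ J x = 0].
Let Z := lin_basis [set psi | S psi = 0].

Lemma basisX : findep X id /\ lspan X = [set phi | S' phi = 0].
Proof.
apply: lin_basisP => //= [x y x0 y0|a x x0]; first by rewrite S'D x0 y0 addr0.
by rewrite S'Z x0 scaler0.
Qed.

Lemma basisZ : findep Z id /\ lspan Z = [set psi | S psi = 0].
Proof.
apply: lin_basisP => //= [x y x0 y0|a x x0]; first by rewrite SD x0 y0 addr0.
by rewrite SZ x0 scaler0.
Qed.

Lemma basisY : findep Y id /\ lspan Y = [set x | range S' x /\ J x = 0].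
Proof.
apply: lin_basisP => //=.
- by split=> //; exists 0.
- move=> _ _ [[x _ <-] x0] [[y _ <-] y0].
  by rewrite JD x0 y0 addr0; split=> //; exists (x + y).
- move=> a _ [[x _ <-] x0]; rewrite JZ x0 scaler0; split=> //.
  by exists (a *: x).
Qed.

(** A basis of the kernel of J after S': a basis of the kernel of S' together
  with lifts of a basis of the part of the image of S' killed by J. *)
Let lift (y : W') : V' := xget 0 [set phi | S' phi = y].
Let f (i : W' + V') : V' := match i with inl y => lift y | inr x => x end.
Let D := card_add Y X.

Let liftE y : Y y -> S' (lift y) = y /\ J y = 0.
Proof.
move=> Yy; have : lspan Y y by exact: span_sub.
have [_ ->] := basisY; move=> [[phi _ phiy] Jy]; split=> //.
by apply: (@xgetPex _ 0 [set phi | S' phi = y]); exists phi.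
Qed.

Let fX_ker x : X x -> S' x = 0.
Proof. move=> Xx; have : lspan X x by exact: span_sub.
by have [_ ->] := basisX.
Qed.

Let f_indep : findep D f.
Proof.
rewrite /D /card_add setUC; apply: (@findep_ker_image _ _ id _ _ S' erefl) => //.
- by apply: findep_image; case: basisX.
- by move=> _ [x Xx <-] /=; exact: fX_ker.
- apply: findep_image; apply: (@findep_ext _ _ _ _ id); last by case: basisY.
  by move=> y Yy /=; case: (liftE Yy).
Qed.

Let f_span phi : J (S' phi) = 0 -> lspan (f @` D) phi.
Proof.
move=> J0phi; have [_ YE] := basisY.
have : lspan Y (S' phi) by rewrite YE; split=> //; exists phi.
have YL : Y `<=` (S' \o lift) @` Y by move=> y Yy; exists y => //=; case: (liftE Yy).
move=> /(span_mono YL)/(@span_lift _ _ id _ _ S' erefl S'L _ _ _ _ (fun b => ex_intro _ b erefl)).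
move=> [u su uE]; rewrite -(subrK u phi); apply: spanD; last first.
  by apply: span_mono su => _ [y Yy <-]; exists (inl y) => //; left; exists y.
have [_ XE] := basisX.
have : lspan X (phi - u).
  by rewrite XE /= -scaleN1r S'D S'Z uE scaleN1r subrr.
by apply: span_mono => x Xx; exists (inr x) => //; right; exists x.
Qed.

(** L carries the family f to independent elements of the kernel of S, which Z
  spans. *)
Lemma dimension_le (L : V' -> V) : sigma_linear sigma L -> injective L ->
  (forall phi, S (L phi) = J (S' phi)) -> card_add Y X #<= Z.
Proof.
move=> LL Li LS; apply: (@steinitz _ _ divR _ _ (L \o f)).
  exact: (findep_map sigma1 LL).
have [_ ->] := basisZ; move=> _ [i Di <-] /=; rewrite LS.
case: Di => -[z Zz <-] /=; first by have [-> ->] := liftE Zz.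
by rewrite fX_ker.
Qed.

(** A maximal set of pairs (phi, psi) with S psi = J (S' phi), extending a
  basis of the kernel of J after S' matched with independent elements of the
  kernel of S, and independent on both sides. *)
Lemma dimension_ge : (forall phi, exists psi, S psi = J (S' phi)) ->
  card_add Y X #<= Z ->
  exists L : set (V' * V), [/\ findep L fst, findep L snd,
    forall p, L p -> S p.2 = J (S' p.1) & forall phi, lspan (fst @` L) phi].
Proof.
move=> ex /(card_le_fun 0)[j [jZ ji]].
pose h i := (f i, j i); pose L0 := h @` D.
have L01 : findep L0 fst by exact: findep_image.
have L02 : findep L0 snd.
  by apply: findep_image; apply: (@findep_inj _ _ _ _ Z) => //; case: basisZ.
have L0S p : L0 p -> S p.2 = J (S' p.1).
  move=> [i Di <-] /=; have : lspan Z (j i) by apply: span_sub; exact: jZ.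
  have [_ ->] := basisZ => ->.
  case: Di => -[z Zz <-] /=; first by have [-> ->] := liftE Zz.
  by rewrite fX_ker.
have L0sp phi : J (S' phi) = 0 -> lspan (fst @` L0) phi.
  move/f_span; apply: span_mono => _ [i Di <-]; by exists (h i) => //; exists i.
pose P := [set M : set (V' * V) | [/\ findep (L0 `|` M) fst,
  findep (L0 `|` M) snd & forall p, M p -> S p.2 = J (S' p.1)]].
have [F FP tF|M [[M1 M2 MS] Mmax]] := @Zorn_bigcup _ P.
  pose F' := [set L0 `|` M | M in F `|` [set set0]].
  have FE : L0 `|` \bigcup_(M in F) M = \bigcup_(M in F') M.
    apply/seteqP; split=> [p [L0p|[M FM Mp]]|p [_ [M [FM|->] <-]]].
    - by exists (L0 `|` set0); [exists set0 => //; right|left].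
    - by exists (L0 `|` M); [exists M => //; left|right].
    - by case=> [|Mp]; [left|right; exists M].
    - by case=> [|//]; left.
  have tF' : total_on F' subset.
    move=> _ _ [M FM <-] [N FN <-].
    case: FM FN => [FM|->] [FN|->]; rewrite ?setU0.
    - by have [MN|NM] := tF _ _ FM FN; [left|right]; exact: setUS.
    - by right=> p; left.
    - by left=> p; left.
    - by left.
  split; rewrite ?FE.
  - apply: findep_bigcup => // _ [M [FM|->] <-]; last by rewrite setU0.
    by case: (FP _ FM).
  - apply: findep_bigcup => // _ [M [FM|->] <-]; last by rewrite setU0.
    by case: (FP _ FM).
  - by move=> p [M /FP[_ _ MS] /MS].
have LS p : (L0 `|` M) p -> S p.2 = J (S' p.1) by case; [exact: L0S|exact: MS].
exists (L0 `|` M); split=> // phi; apply: contrapT => nphi.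
have [psi psiE] := ex phi.
have npsi : ~ lspan (snd @` (L0 `|` M)) psi.
  move=> spsi; apply: nphi.
  have [u su uE] : exists2 u, lspan (fst @` (L0 `|` M)) u & J (S' u) = S psi.
    elim: spsi => [|b _ w [p Lp <-] _ [u su uE]]; first by exists 0; [exact: span0|rewrite S'0 J0].
    have [a <-] := sigmaS b; exists (a *: p.1 + u).
      by apply: spanZD => //; exists p.
    by rewrite S'L JL SL uE LS.
  rewrite -(subrK u phi); apply: spanD => //.
  apply: (@span_mono _ _ (fst @` L0)); first by apply: image_subset => p; left.
  apply: L0sp; apply: (@addIr _ (J (S' u))).
  by rewrite -JD -S'D subrK add0r uE psiE.
apply: (Mmax (M `|` [set (phi, psi)])); last first.
  rewrite /P /= setUA; split; [exact: findep_add|exact: findep_add|].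
  by move=> p [/MS//|-> /=].
split; first by left.
move=> /(_ (phi, psi) (or_intror erefl)) Mp; apply: nphi; apply: span_sub.
by exists (phi, psi) => //; right.
Qed.

End Dimension.

Local Close Scope ring_scope.

(** * Kernels of quotients as modules *)

Lemma cprojVV (H : topGroupType) (N : normalSub H) x :
  cproj N x^-1 = (cproj N x)^-1.
Proof. exact: (epiV (cproj_epi N)). Qed.

(** The complement of the image of U is the image of the complement of the
  saturation U Ker tau, which is compact. *)
Lemma epi_open (H G : profiniteType) (tau : epi H G) (U : set H) :
  open U -> open (tau @` U).
Proof.
move=> oU; rewrite -[X in open X]setCK; apply: closed_openC.
have -> : ~` (tau @` U) = tau @` (~` \bigcup_(k in ker tau) [set x | U (x * k)]).
  apply/seteqP; split=> [g nUg|_ [x nx <-] [y Uy yx]].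
    have [h hg] := epi_surj tau g; exists h => // -[k Kk /= Uhk]; apply: nUg.
    by exists (h * k) => //; rewrite kerMr.
  by apply: nx; exists (x^-1 * y); [exact: ker_divl|rewrite /= mulVKg].
apply: closed_image_compact.
- exact: profinite_compact.
- exact: profinite_hausdorff.
- exact: epi_cont.
- apply: open_closedC; apply: bigcup_open => k _.
  by apply: (open_preimage _ oU); exact: mulgr_continuous.
Qed.

Lemma compact_discrete_finite (T : topologicalType) :
  compact [set: T] -> (forall A : set T, open A) -> finite_set [set: T].
Proof.
move=> cT dT; suff [s sP] : exists s : seq {classic T}, forall x, x \in s.
  by apply: (@sub_finite_set _ _ [set` s]) => // x _ /=; exact: sP.
apply: contrapT => ns.
have [i|s|x xP] := @compact_fip T {classic T} (fun x => ~` [set x]) cT.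
- exact: open_closedC.
- apply: contrapT => nx; apply: ns; exists s => x; apply: contrapT => /negP xs.
  by apply: nx; exists x => i si; move: xs => /[swap] ->; rewrite si.
- exact: (xP x).
Qed.

Section KerQuot.
Variables (H G : profiniteType) (tau : epi H G) (N : normalSub H).
Variables (leN : N `<=` ker tau) (ab : abelian_ker (quot_epi leN)).

Fact kmk_proof k : ker tau k -> cproj N k \in ker (quot_epi leN).
Proof. by move=> Kk; rewrite inE /ker /=; rewrite quot_funE. Qed.

(** Extended by zero outside Ker tau, so that homomorphisms on Ker tau are plain
  functions on H. *)
Definition kproj (h : H) : kermod ab :=
  if pselect (ker tau h) is left Kh then
    exist (fun q => q \in ker (quot_epi leN)) _ (kmk_proof Kh) else 0%R.

Lemma val_kproj k : ker tau k -> val (kproj k) = cproj N k.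
Proof. by rewrite /kproj; case: pselect. Qed.

Lemma kprojM k l : ker tau k -> ker tau l -> kproj (k * l) = (kproj k + kproj l)%R.
Proof.
move=> Kk Kl; apply: val_inj; rewrite val_kproj; last exact: kerM.
by rewrite cprojMM -!val_kproj.
Qed.

Lemma kprojJ h k : ker tau k -> kproj (h * k * h^-1) = gact (tau h) (kproj k).
Proof.
move=> Kk; apply: val_inj; rewrite val_kproj; last exact: kerJ.
transitivity (cproj N h * val (kproj k) * (cproj N h)^-1); last first.
  by rewrite -(quot_funE leN h); exact/esym/(@ker_actE _ _ _ ab).
by rewrite val_kproj // !cprojMM cprojVV.
Qed.

Lemma kproj_surj x : exists2 k, ker tau k & kproj k = x.
Proof.
have kx : ker tau (repr (val x)) by exact: (kerP x).
by exists (repr (val x)) => //; apply: val_inj; rewrite val_kproj // cprojK.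
Qed.

Lemma kproj_lift z (x : kermod ab) : cproj N z = val x -> ker tau z /\ x = kproj z.
Proof.
move=> zx; have Kz : ker tau z.
  by have := kerP x; rewrite -zx /ker /= quot_funE.
by split=> //; apply: val_inj; rewrite val_kproj.
Qed.

Lemma kproj_eq k l : ker tau k -> ker tau l -> kproj k = kproj l <-> nset N (k^-1 * l).
Proof.
move=> Kk Kl; rewrite -cprojE -!val_kproj //; split=> [->//|]; exact: val_inj.
Qed.

Lemma kproj0 k : ker tau k -> kproj k = 0%R <-> nset N k.
Proof.
move=> Kk; have -> : (0%R : kermod ab) = kproj 1.
  by apply: val_inj; rewrite val_kproj //; exact: epi1.
rewrite kproj_eq //; last exact: epi1.
by rewrite mulg1; split=> [/nV|/nV]; rewrite ?invgK.
Qed.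

Lemma khom_descend (A : gmodule G) (chi : H -> A) : khom tau chi ->
  (forall x, nset N x -> chi x = 0%R) ->
  exists phi : ghom (kermod ab) A, forall k, ker tau k -> phi (kproj k) = chi k.
Proof.
move=> ck cN; have [cD cG [U U1 U0]] := ck.
pose f (x : kermod ab) := chi (repr (val x)).
have fE k : ker tau k -> f (kproj k) = chi k.
  move=> Kk; rewrite /f val_kproj //; have [n Nn ->] := repr_cproj N k.
  by rewrite cD ?(cN n) ?addr0 //; exact: leN.
have hom : f \in @hom_pred _ (kermod ab) A.
  rewrite inE; split=> [x y|g x|x].
  - have [k Kk <-] := kproj_surj x; have [l Kl <-] := kproj_surj y.
    by rewrite -kprojM // !fE ?cD //; exact: kerM.
  - have [k Kk <-] := kproj_surj x; have [h <-] := epi_surj tau g.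
    by rewrite -kprojJ // !fE ?cG //; exact: kerJ.
  - have [k Kk <-] := kproj_surj x => V; rewrite fE // => /nbhs_singleton Vk.
    have nb := cproj_nbhs N (nbhs_mulgl k U1).
    rewrite -(val_kproj Kk) in nb.
    have {}nb : nbhs (kproj k) (val @^-1` (cproj N @` [set x | U (k^-1 * x)])).
      exact: (@ker_val_continuous _ _ _ ab (kproj k) _ nb).
    suff : nbhs (kproj k) (f @^-1` V) by [].
    apply: filterS nb => y [z Uz zy] /=.
    have [Kz ->] := kproj_lift zy.
    have -> : f (kproj z) = chi k; last by [].
    rewrite fE // -(mulVKg k z) cD ?(U0 (_ * z)) ?addr0 //; exact: kerM (kerV Kk) Kz.
by exists (Defs.Hom hom) => k Kk /=; exact: fE.
Qed.

Section MaxQuot.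
Hypothesis Nmax : maxnormal (ker tau) N.

Lemma khom_kproj : khom tau kproj.
Proof.
split; [exact: kprojM|exact: kprojJ|].
have [U oU UN] := maxnormal_open (@profinite_hausdorff G) Nmax.
exists (U : set H); first by apply: open_nbhs_nbhs; split=> //; exact: n1.
by move=> u Uu Ku; apply/kproj0 => //; exact: UN.
Qed.

Lemma kermod_discrete (S : set (kermod ab)) : open S.
Proof.
have [U oU UN] := maxnormal_open (@profinite_hausdorff G) Nmax.
have -> : S = \bigcup_(x in S) [set x] by apply/seteqP; split=> [x Sx|x [y Sy ->]] //; exists x.
apply: bigcup_open => x _; have [k Kk <-] := kproj_surj x.
exists (cproj N @` [set y | nset U (k^-1 * y)]).
  by apply: cproj_open; apply: (open_preimage _ oU); exact: mulgl_continuous.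
apply/seteqP; split=> [y [z Uz zy]|_ ->] /=.
  have [Kz ->] := kproj_lift zy.
  apply/esym/kproj_eq => //; apply: UN; split=> //; exact: kerM (kerV Kk) Kz.
by exists k; [rewrite /= mulVg; exact: n1|exact/esym/val_kproj].
Qed.

(** Some open normal U meets Ker tau inside N; this gives finiteness,
  discreteness and, since U is normal, continuity of the action. The preimage
  in Ker tau of a submodule is a normal subgroup of H containing N, so
  simplicity is the maximality of N. *)
Lemma kermod_simple : finite_simple (kermod ab).
Proof.
have [U oU UN] := maxnormal_open (@profinite_hausdorff G) Nmax.
have [[NK nKN] Nm] := Nmax.
split.
- apply: (@card_le_finite _ _ _ [set: quot U]).
    apply: (@card_le_inj _ _ _ _ (fun x => cproj U (repr (val x)))) => // x y _ _.
    have Kx : ker tau (repr (val x)) by exact: (kerP x).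
    have Ky : ker tau (repr (val y)) by exact: (kerP y).
    move=> /cprojE Uxy; apply: val_inj; rewrite -(cprojK (val x)) -(cprojK (val y)).
    by apply/cprojE/UN; split=> //; exact: kerM (kerV Kx) Ky.
  apply: compact_discrete_finite; first exact: quot_compact.
  move=> S; change (open (cproj U @^-1` S)).
  have -> : cproj U @^-1` S = \bigcup_(x in cproj U @^-1` S) [set y | nset U (x^-1 * y)].
    apply/seteqP; split=> [x Sx|y [x Sx /cprojE xy]]; last by rewrite /= -xy.
    by exists x => //=; rewrite mulVg; exact: n1.
  by apply: bigcup_open => x _; apply: (open_preimage _ oU); exact: mulgl_continuous.
- exact: kermod_discrete.
- move=> [g x]; have [k Kk <-] := kproj_surj x; have [h <-] := epi_surj tau g.
  move=> V /nbhs_singleton; rewrite -[gact _ _]kprojJ // => Vgx.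
  exists (tau @` [set y | nset U (h^-1 * y)], [set kproj k]) => /=.
    split; apply: open_nbhs_nbhs; split=> //.
    + apply: epi_open; apply: (open_preimage _ oU); exact: mulgl_continuous.
    + by exists h => //=; rewrite mulVg; exact: n1.
    + exact: kermod_discrete.
  move=> [_ _] /= [[y Uy <-] ->]; change (V (gact (tau y) (kproj k))).
  rewrite -kprojJ //; have -> : kproj (y * k * y^-1) = kproj (h * k * h^-1); last by [].
  apply/kproj_eq; [exact: kerJ|exact: kerJ|].
  apply: UN; split; last by apply: kerM; [apply: kerV|]; exact: kerJ.
  set w := h^-1 * y in Uy; have -> : y = h * w by rewrite /w mulVKg.
  have -> : (h * w * k * (h * w)^-1)^-1 * (h * k * h^-1) =
      h * (w * (k^-1 * w^-1 * k^-1^-1)) * h^-1.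
    by rewrite !invgM !invgK !mulgA !mulgVK.
  by apply: nJl; apply: nM => //; apply: nJl; apply: nV.
- apply: contrapT => nx; apply: nKN => k Kk; apply/kproj0 => //.
  by apply: contrapT => k0; apply: nx; exists (kproj k).
- move=> S S0 SB SG.
  have ck := khom_kproj.
  pose M := [set k | ker tau k /\ S (kproj k)].
  have SN x : S x -> S (- x)%R by move=> Sx; rewrite -sub0r; exact: SB.
  have M1 : M 1 by split; [exact: epi1|rewrite (khom1 ck)].
  have MV x : M x -> M x^-1.
    by move=> [Kx Sx]; split; [exact: kerV|rewrite (khomV ck) //; exact: SN].
  have MM x y : M x -> M y -> M (x * y).
    move=> [Kx Sx] [Ky Sy]; split; first exact: kerM.
    by rewrite kprojM // -[kproj y]opprK; apply: SB => //; exact: SN.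
  have MJ x y : M x -> M (x ^ y).
    move=> [Kx Sx]; rewrite conjg_mulV.
    by split; [exact: kerJ|rewrite kprojJ //; exact: SG].
  have Mc : closed M.
    move=> x clx.
    have Kx : ker tau x.
      apply: (ker_closed (@profinite_hausdorff G)) => V nV.
      by have [y [[? _] ?]] := clx V nV; exists y.
    have U1 : nbhs 1 (U : set H) by apply: open_nbhs_nbhs; split=> //; exact: n1.
    have [y [[Ky Sy] /= Uxy]] := clx _ (nbhs_mulgl x U1).
    split=> //; have -> // : kproj x = kproj y.
    by apply/kproj_eq => //; apply: UN; split=> //; exact: kerM (kerV Kx) Ky.
  have [MN|nMN] := pselect (M `<=` N).
    left; apply/seteqP; split=> [x Sx|_ -> //]; have [k Kk kx] := kproj_surj x.
    by rewrite /= -kx; apply/kproj0 => //; apply: MN; split=> //; rewrite kx.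
  right; apply/seteqP; split=> // x _; have [k Kk <-] := kproj_surj x.
  have [//|nMk] := pselect (S (kproj k)); exfalso; apply: nMN.
  apply: (Nm (NormalSub M1 MV MM MJ Mc)).
    by split=> [y []//|/(_ k Kk) []].
  by move=> y Ny; split; [exact: NK|rewrite (iffRL (kproj0 (NK _ Ny)))].
Qed.

End MaxQuot.

End KerQuot.

(** * Homomorphisms on the A-part of a kernel *)

Section Hat.
Variables (H G : profiniteType) (tau : epi H G) (A : gmodule G).
Local Notation B := (B_ab tau A).

(** The elements of the dual as functions on H: these can be composed with
  homomorphisms of groups without mentioning the quotients by N_A. *)
Definition hat (phi : ghom B A) (h : H) : A :=
  phi (@kproj _ _ tau (N_ab tau A) (@N_ab_le _ _ tau A) (@tau_ab_abelian _ _ tau A) h).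

Local Notation kp := (@kproj _ _ tau (N_ab tau A) (@N_ab_le _ _ tau A) (@tau_ab_abelian _ _ tau A)).

Lemma hat_khom phi : (forall S : set A, open S) -> khom tau (hat phi).
Proof.
move=> dA; have [pD pG pC] := homP phi; split=> [k l Kk Kl|h k Kk|].
- by rewrite /hat kprojM.
- by rewrite /hat kprojJ.
- have [O oO OE] : open (phi @^-1` [set 0%R]) by apply: (open_preimage pC).
  have OP k : ker tau k -> O (cproj _ k) <-> phi (kp k) = 0%R.
    move=> Kk; rewrite -(val_kproj (@tau_ab_abelian _ _ tau A) Kk).
    by change ((set_val @^-1` O) (kp k) <-> phi (kp k) = 0%R); rewrite OE.
  exists (cproj (N_ab tau A) @^-1` O).
    apply: open_nbhs_nbhs; split.
      by apply: (open_preimage _ oO); exact: cproj_continuous.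
    apply/OP; first exact: epi1.
    by rewrite (iffRL (kproj0 _ _)) ?hom0 //; [exact: epi1|exact: n1].
  by move=> u Ou Ku; apply/OP.
Qed.

Lemma hat_inj phi psi : (forall k, ker tau k -> hat phi k = hat psi k) -> phi = psi.
Proof.
move=> e; apply: val_inj; apply: funext => x.
have [k Kk <-] := @kproj_surj _ _ tau _ (@N_ab_le _ _ tau A) (@tau_ab_abelian _ _ tau A) x.
exact: e.
Qed.

Lemma hat_N phi k : nset (N_ab tau A) k -> hat phi k = 0%R.
Proof. by move=> Nk; rewrite /hat (iffRL (kproj0 _ _)) ?hom0 //; exact: (@N_ab_le _ _ tau A). Qed.

(** A nonzero chi identifies Ker tau / ker chi with A, so its kernel is one of
  the subgroups whose intersection is N_A, and chi factors through
  Ker tau / N_A. *)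
Lemma hat_exists (chi : H -> A) : finite_simple A -> khom tau chi ->
  exists phi : ghom B A, forall k, ker tau k -> hat phi k = chi k.
Proof.
move=> sA ck; apply: khom_descend => // x [Kx Nx].
have [//|nx] := pselect (chi x = 0%R); have nz : exists2 k, ker tau k & chi k <> 0%R by exists x.
suff CN : C_ab tau A (khom_ker ck) by have [_] := Nx _ CN.
have leN : khom_ker ck `<=` ker tau by move=> y [].
have ab : abelian_ker (quot_epi leN) by apply/abelian_kerP; exact: khom_ker_abelian.
exists leN, ab.
have [|f fE] := @khom_descend _ _ tau _ leN ab A chi ck; first by move=> y [].
have [g [fg gf]] : exists g : ghom A (kermod ab), cancel f g /\ cancel g f.
  apply: schur => //; last by exists (kproj ab x); rewrite fE.
  by apply: kermod_simple; exact: khom_max.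
by exists f, g.
Qed.

Lemma hatD phi psi k : hat (phi + psi)%R k = (hat phi k + hat psi k)%R.
Proof. by []. Qed.

Lemma hatZ (a : EndG A) phi k : hat (a *: phi)%R k = a (hat phi k).
Proof. by []. Qed.

(** * Transgression *)

(** The class of e is the pushforward along chi of the class of the extension
  exactly when chi extends to a twisted cochain u on H whose defect is the
  inflation of e. *)
Definition transgresses (chi : H -> A) (e : G * G -> A) :=
  exists u : H -> A, [/\ continuous u,
    forall k h, ker tau k -> u (k * h) = (chi k + u h)%R &
    forall h1 h2, u (h1 * h2) = (u h1 + gact (tau h1) (u h2) + e (tau h1, tau h2))%R].

(** Given a section s of H_A ->> G and a cochain c comparing the pushed forward
  factor set with e, put u h = phi (h (s (tau h))^-1) + c (tau h). Conversely u
  factors through H_A, and c is its composite with s. *)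
Lemma S_abP (phi : ghom B A) (e : Z2 A) :
  S_ab phi = class2 e <-> transgresses (hat phi) e.
Proof.
have [s fE] : exists s : csection (tau_ab tau A),
    f_ab tau A = class2 (factor_set (@tau_ab_abelian _ _ tau A) s).
  have [s0] := exists_csection (tau_ab tau A).
  have : range (fun s => class2 (factor_set (@tau_ab_abelian _ _ tau A) s)) (f_ab tau A).
    by apply: xgetPex; exists (class2 (factor_set (@tau_ab_abelian _ _ tau A) s0)), s0.
  by move=> [s _ <-]; exists s.
have [pD pG pC] := homP phi.
rewrite /S_ab fE H2mapE class2E inE; set F := factor_set _ s.
have tE h : tau_ab tau A (cproj _ h) = tau h by exact: (quot_funE (@N_ab_le _ _ tau A) h).
split=> [[c [cC cE]]|[u [uC uk uM]]].
- have bP h : cproj (N_ab tau A) h * (s (tau h))^-1 \in ker (tau_ab tau A).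
    rewrite inE; change (tau_ab tau A (cproj _ h * (s (tau h))^-1) = 1).
    by rewrite epiM epiV csecK tE mulgV.
  pose b h : B := exist (fun q => q \in ker (tau_ab tau A)) _ (bP h).
  have bC : continuous b.
    apply: continuous_to_sub; apply: continuous_mulg; first exact: cproj_continuous.
    by apply: continuous_invg; apply: continuous_fun_comp (@csec_cont _ _ _ s); exact: epi_cont.
  exists (fun h => phi (b h) + c (tau h))%R; split.
  + apply: (continuous_fun_comp (f := fun h => (phi (b h), c (tau h))) _ (@add_continuous A)).
    apply: continuous_pair; first exact: continuous_fun_comp bC pC.
    exact: continuous_fun_comp (@epi_cont _ _ tau) cC.
  + move=> k h Kk; rewrite addrA kerMl //; congr (_ + _)%R; rewrite -pD; congr (phi _).
    apply: val_inj => /=; rewrite val_kproj // kerMl // cprojMM.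
    by rewrite mulgA.
  + move=> h1 h2.
    have -> : b (h1 * h2) = (b h1 + gact (tau h1) (b h2) + F (tau h1, tau h2))%R.
      have aE : val (gact (tau h1) (b h2)) =
          s (tau h1) * val (b h2) * (s (tau h1))^-1.
        by rewrite -{1}(csecK s (tau h1)); exact: ker_actE.
      apply: val_inj.
      transitivity (val (b h1) * val (gact (tau h1) (b h2)) * val (F (tau h1, tau h2))) => //.
      by rewrite aE /= cprojMM epiM !mulgA !mulgVK.
    rewrite !pD pG epiM gactD.
    have /eqP : (phi (F (tau h1, tau h2)) - e (tau h1, tau h2) = d1 c (tau h1, tau h2))%R.
      by move/(congr1 (fun f => f (tau h1, tau h2))): cE.
    rewrite subr_eq => /eqP ->; rewrite /d1 /=.
    rewrite -!addrA; congr (_ + _)%R; rewrite [RHS]addrCA; congr (_ + _)%R.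
    by rewrite [RHS]addrCA; congr (_ + _)%R; rewrite addrC addrA addrK.
- pose ub (q : quot (N_ab tau A)) := u (repr q).
  have ubE h : ub (cproj _ h) = u h.
    rewrite /ub; have [n Nn ->] := repr_cproj (N_ab tau A) h.
    have -> : h * n = h * n * h^-1 * h by rewrite mulgVK.
    have Nn' := nJl h Nn.
    by rewrite uk ?hat_N ?add0r //; exact: (@N_ab_le _ _ tau A).
  have ubC : continuous ub.
    by apply/quotient_continuous; rewrite (_ : _ \o _ = u) //; apply/funext => h; exact: ubE.
  exists (ub \o s); split; first exact: continuous_fun_comp (@csec_cont _ _ _ s) ubC.
  apply/funext => -[g1 g2]; rewrite /d1 /=.
  set x1 := repr (s g1); set x2 := repr (s g2); set x3 := repr (s (g1 * g2)).
  have sE g : tau (repr (s g)) = g by rewrite -tE cprojK csecK.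
  have Kk : ker tau (x1 * x2 * x3^-1) by apply: ker_div; rewrite epiM !sE.
  have := uM x1 x2; rewrite -{1}(mulgVK x3 (x1 * x2)) uk // !sE.
  have -> : hat phi (x1 * x2 * x3^-1) = phi (F (g1, g2)).
    congr (phi _); apply: val_inj; rewrite val_kproj //.
    by rewrite cprojMM cprojVV cprojMM !cprojK.
  rewrite /ub -/x1 -/x2 -/x3 => uE.
  rewrite /= !fctE /=.
  have -> : phi (F (g1, g2)) = (u x1 + gact g1 (u x2) + e (g1, g2) - u x3)%R.
    by rewrite -uE addrK.
  by rewrite [LHS]addrAC addrK [X in (X - _)%R]addrC addrAC.
Qed.

End Hat.

(** * Inflation of modules *)

Section GmodIso.
Variables (G : topGroupType) (A B C : gmodule G).

Lemma gmod_iso_refl : gmod_iso A A.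
Proof. by exists (hom_id A), (hom_id A). Qed.

Lemma gmod_iso_sym : gmod_iso A B -> gmod_iso B A.
Proof. by move=> [f [g [fg gf]]]; exists g, f. Qed.

Lemma gmod_iso_trans : gmod_iso A B -> gmod_iso B C -> gmod_iso A C.
Proof.
move=> [f [g [fg gf]]] [f' [g' [fg' gf']]].
exists (hom_comp f' f), (hom_comp g g').
by split=> x /=; rewrite ?fg' ?fg ?gf ?gf'.
Qed.

End GmodIso.

Section EndDivision.
Variables (G : topGroupType) (A : gmodule G).
Hypothesis sA : finite_simple A.

Lemma EndG_nontrivial : (1 : EndG A)%R <> 0%R.
Proof.
have [_ _ _ [x nx] _] := sA.
by move=> /(congr1 (fun f : EndG A => f x)).
Qed.

Lemma EndG_division (a : EndG A) : a <> 0%R -> exists b : EndG A, (b * a = 1)%R.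
Proof.
move=> a0; have [|b [ab _]] := schur (alpha := a) sA sA.
  apply: contrapT => nx; apply: a0; apply: val_inj; apply: funext => x /=.
  by apply: contrapT => ax; apply: nx; exists x.
by exists b; apply: val_inj; apply: funext => x /=; exact: ab.
Qed.

End EndDivision.

Section Inflate.
Variables (G G' : topGroupType) (pi : epi G G').

Section InflateHom.
Variables (A' B' : gmodule G').

Fact inflate_hom_proof (a : ghom A' B') :
  (a : A' -> B') \in @hom_pred G (inf_mod pi A') (inf_mod pi B').
Proof.
by rewrite inE; have [aD aG aC] := homP a; split=> // g x; exact: aG.
Qed.

Definition inflate_hom (a : ghom A' B') : ghom (inf_mod pi A') (inf_mod pi B') :=
  Defs.Hom (inflate_hom_proof a).

(** Equivariance under G' can be tested on G since pi is onto. *)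
Lemma inflate_hom_surj (b : ghom (inf_mod pi A') (inf_mod pi B')) :
  exists a, inflate_hom a = b.
Proof.
have hom : (b : A' -> B') \in @hom_pred G' A' B'.
  rewrite inE; have [bD bG bC] := homP b; split=> // g' x.
  by have [g <-] := epi_surj pi g'; exact: (bG g).
by exists (Defs.Hom hom); exact: val_inj.
Qed.

Lemma inflate_iso : gmod_iso (inf_mod pi A') (inf_mod pi B') -> gmod_iso A' B'.
Proof.
move=> [f [g [fg gf]]].
have hf : (f : A' -> B') \in @hom_pred G' A' B'.
  rewrite inE; have [bD bG bC] := homP f; split=> // g' x.
  by have [h <-] := epi_surj pi g'; exact: (bG h).
have hg : (g : B' -> A') \in @hom_pred G' B' A'.
  rewrite inE; have [bD bG bC] := homP g; split=> // g' x.
  by have [h <-] := epi_surj pi g'; exact: (bG h).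
by exists (Defs.Hom hf), (Defs.Hom hg).
Qed.

End InflateHom.

Lemma inf_simple (A' : gmodule G') : finite_simple A' -> finite_simple (inf_mod pi A').
Proof.
move=> [fA dA cA nA sA]; split=> //.
- apply: (@continuous_fun_comp _ _ _ (fun p : G * A' => (pi p.1, p.2))
    (fun p : G' * A' => gact p.1 p.2)) => //.
  apply: continuous_pair; last exact: snd_continuous.
  by apply: continuous_fun_comp (@epi_cont _ _ pi); exact: fst_continuous.
- move=> S S0 SB SG; apply: sA => // g' x Sx.
  by have [g <-] := epi_surj pi g'; exact: (SG g).
Qed.

Variable A' : gmodule G'.
Local Notation A := (inf_mod pi A').
Local Notation sigma := (@inflate_hom A' A' : EndG A' -> EndG A).

Lemma H2inf_semilinear : sigma_linear sigma (H2inf pi A').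
Proof.
move=> a x y; rewrite -(class2K x) -(class2K y).
change (H2inf pi A' (H2map a (class2 (repr x)) + class2 (repr y)) =
  H2map (sigma a) (H2inf pi A' (class2 (repr x))) + H2inf pi A' (class2 (repr y)))%R.
rewrite H2mapE -class2D !H2infE H2mapE -class2D; congr class2.
exact: val_inj.
Qed.

End Inflate.

Lemma S_ab_linear (H G : profiniteType) (tau : epi H G) (A : gmodule G) :
  sigma_linear id (@S_ab H G tau A).
Proof.
move=> a x y; rewrite /S_ab -(class2K (f_ab tau A)).
set f := repr _.
change (H2map (a *: x + y) (class2 f) =
  H2map a (H2map x (class2 f)) + H2map y (class2 f))%R.
by rewrite !H2mapE -class2D; congr class2; exact: val_inj.
Qed.

(** * Consequences of a semi-cartesian square *)

Section Forward.
Variables (H G H' G' : profiniteType).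
Variables (tau : epi H G) (tau' : epi H' G') (pi : epi G G') (theta : epi H H').
Hypothesis theta_sq : tau' \o theta =1 pi \o tau.
Hypothesis theta_ker : theta @` ker tau = ker tau'.

Let thetaE h : tau' (theta h) = pi (tau h).
Proof. exact: theta_sq. Qed.

Let theta_kerP k : ker tau k -> ker tau' (theta k).
Proof. by move=> Kk; rewrite /ker /= thetaE Kk epi1. Qed.

Let theta_surj k' : ker tau' k' -> exists2 k, ker tau k & theta k = k'.
Proof. by rewrite -theta_ker => -[k Kk <-]; exists k. Qed.

(** Pulling a quotient of H' back along theta gives the fibre product: H maps
  onto it since theta maps Ker tau onto Ker tau'. *)
Lemma forward_na (E' : profiniteType) (zeta' : epi E' G') :
  mult_na tau' zeta' #<= mult_na tau (inf_epi pi zeta').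
Proof.
have hG := @profinite_hausdorff G.
pose P N' := [set x | ker tau x /\ nset N' (theta x)].
have ex (N' : normalSub H') : exists N : normalSub H, (N : set H) = P N'.
  have Pc : closed (P N').
    apply: closedI; first exact: ker_closed.
    by apply: (closed_preimage (@epi_cont _ _ theta)); exact: n_closed.
  unshelve eexists (@NormalSub H (P N') _ _ _ _ Pc) => //.
  - by split; [exact: epi1|rewrite epi1; exact: n1].
  - by move=> x [Kx Nx]; split; [exact: kerV|rewrite epiV; exact: nV].
  - by move=> x y [Kx Nx] [Ky Ny]; split; [exact: kerM|rewrite epiM; exact: nM].
  - move=> x y [Kx Nx]; rewrite conjg_mulV.
    split; first exact: kerJ.
    have -> : theta (y^-1 * x * y^-1^-1) = theta y^-1 * theta x * (theta y^-1)^-1.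
      by rewrite !epiM !epiV.
    exact: nJl.
pose F N' := projT1 (cid (ex N')).
have FE N' : (F N' : set H) = P N' by rewrite /F; case: cid.
apply: (@card_le_inj _ _ _ _ F); last first.
  move=> N1 N2 [le1 _] [le2 _] FF; apply/normalSub_eq.
  have sub (M1 M2 : normalSub H') : M1 `<=` ker tau' -> F M1 = F M2 -> M1 `<=` M2.
    move=> le FM x Mx; have [k Kk kx] := theta_surj (le _ Mx).
    have : P M2 k by rewrite -FE -FM FE; split=> //; rewrite kx.
    by rewrite -kx => -[].
  by apply/seteqP; split; apply: sub.
move=> N' [leN' [psi [psiI psiE]]].
have leN : F N' `<=` ker tau by rewrite FE => x [].
pose b : epi H' E' := comp_epi psi (cproj_epi N').
have bE h' : zeta' (b h') = tau' h'.
  by rewrite /= -[RHS](quot_funE leN'); exact/esym/psiE.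
have bN h' : b h' = 1 <-> nset N' h'.
  rewrite -ker_cproj /ker /=; split=> [/=|->]; last exact: (epi1 psi).
  by rewrite -(epi1 psi) => /(isom_inj psiI).
have qP h : (tau h, b (theta h)) \in fprod_set pi zeta'.
  by rewrite inE /fprod_set /= -thetaE; exact/esym/bE.
pose q h : Defs.fprod pi zeta' := exist (fun p => p \in fprod_set pi zeta') _ (qP h).
have qM : {morph q : x y / x * y}.
  move=> x y; apply: val_inj.
  change ((tau (x * y), b (theta (x * y))) = (tau x * tau y, b (theta x) * b (theta y))).
  by rewrite !epiM.
have qC : continuous q.
  apply: continuous_to_sub; apply: continuous_pair; first exact: epi_cont.
  exact: (continuous_fun_comp (@epi_cont _ _ theta) (@epi_cont _ _ b)).
have qS p : exists h, q h = p.
  have [/= ge] : exists ge, p = exist (fun p => p \in fprod_set pi zeta') (val p) ge.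
    by case: p => p pP; exists pP.
  case: (val p) ge => g e /= ge ->.
  have ge' : pi g = zeta' e by move: ge; rewrite inE.
  have [h hg] := epi_surj tau g; have [h' he] := epi_surj b e.
  have K1 : ker tau' ((theta h)^-1 * h').
    by apply: ker_divl; rewrite thetaE hg ge' -he bE.
  have [k Kk kE] := theta_surj K1.
  exists (h * k); apply: val_inj => /=; congr (_, _); first by rewrite kerMr.
  by rewrite epiM kE mulVKg.
pose Q := Epi qM qC qS.
have kQ h : Q h = 1 <-> nset (F N') h.
  rewrite FE; split=> [/(congr1 val) /= [t1 /bN]//|[Kh /bN Nh]].
  by apply: val_inj; congr (_, _).
have [c cE] : exists c : epi (quot (F N')) (Defs.fprod pi zeta'),
    forall x, c (cproj_epi (F N') x) = Q x.
  apply: epi_factor; [exact: profinite_compact|exact: profinite_hausdorff|].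
  by move=> x /ker_cproj /kQ.
exists leN, c; split; last first.
  have cE' x : c (cproj (F N') x) = q x by exact: cE.
  move=> x; rewrite -(cprojK x) [LHS](quot_funE leN (repr x)).
  change (tau (repr x) = inf_fun (c (cproj (F N') (repr x)))).
  by rewrite cE'.
apply: inj_isom; first exact: profinite_compact.
  apply: (@hausdorff_inj _ _ (val : Defs.fprod pi zeta' -> G * E')).
  - by apply: hausdorff_prod; exact: profinite_hausdorff.
  - exact: fprod_val_continuous.
  - exact: val_inj.
apply/ker_inj => x; rewrite -(cprojK x) => cx.
have : Q (repr x) = 1 by rewrite -cE.
by move/kQ/ker_cproj.
Qed.

Section Module.
Variable A' : gmodule G'.
Hypothesis sA' : finite_simple A'.
Local Notation A := (inf_mod pi A').

Let dA' (S : set A') : open S. Proof. by case: sA'. Qed.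

Lemma pull_khom (chi : H' -> A') : khom tau' chi -> khom (A := A) tau (chi \o theta).
Proof.
move=> [cD cG [U U1 U0]]; split=> [k l Kk Kl|h k Kk|] /=.
- by rewrite epiM cD //; exact: theta_kerP.
- by rewrite !epiM epiV cG ?thetaE //; exact: theta_kerP.
- exists (theta @^-1` U); last by move=> u Uu Ku; apply: U0 => //; exact: theta_kerP.
  by apply: (@epi_cont _ _ theta); rewrite epi1.
Qed.

Let ex (phi : ghom (B_ab tau' A') A') : exists psi : ghom (B_ab tau A) A,
  forall k, ker tau k -> hat psi k = hat phi (theta k).
Proof. by apply: hat_exists; [exact: inf_simple|apply: pull_khom; exact: hat_khom]. Qed.

Definition pull (phi : ghom (B_ab tau' A') A') : ghom (B_ab tau A) A :=
  projT1 (cid (ex phi)).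

Lemma pullE phi k : ker tau k -> hat (pull phi) k = hat phi (theta k).
Proof. by rewrite /pull; case: cid => /= psi; apply. Qed.

(** A twisted cochain on H' composed with theta is one on H. *)
Lemma S_ab_pull phi : S_ab (pull phi) = H2inf pi A' (S_ab phi).
Proof.
apply/S_abP.
have /S_abP[u [uC uk uM]] : S_ab phi = class2 (repr (S_ab phi)) by rewrite class2K.
exists (u \o theta); split.
- exact: (continuous_fun_comp (@epi_cont _ _ theta) uC).
- by move=> k h Kk /=; rewrite epiM uk ?pullE //; exact: theta_kerP.
- by move=> h1 h2 /=; rewrite epiM uM !thetaE.
Qed.

Lemma pull_semilinear : sigma_linear (@inflate_hom _ _ pi A' A' : EndG A' -> EndG A) pull.
Proof.
move=> a x y; apply: hat_inj => k Kk.
by rewrite hatD hatZ !pullE // hatD hatZ.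
Qed.

Lemma pull_inj : injective pull.
Proof.
move=> x y xy; apply: hat_inj => k' /theta_surj[k Kk <-].
by rewrite -!pullE // xy.
Qed.

Lemma forward_supp : H2inf pi A' @` supp_ab tau' A' `<=` supp_ab tau A.
Proof. by move=> _ [_ [phi _ <-] <-]; exists (pull phi) => //; exact: S_ab_pull. Qed.

Lemma forward_mult : card_add (nullity pi tau' A') (mult_ab tau' A') #<= mult_ab tau A.
Proof.
have sA : finite_simple A by exact: inf_simple.
have s1 : (@inflate_hom _ _ pi A' A' : EndG A' -> EndG A) 1%R = 1%R by exact: val_inj.
apply: (dimension_le (EndG_nontrivial sA') (EndG_nontrivial sA)
  (EndG_division sA') (EndG_division sA) (@inflate_hom_surj _ _ pi A' A')
  (@S_ab_linear _ _ tau' A') (@S_ab_linear _ _ tau A) s1 (@H2inf_semilinear _ _ pi A')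
  pull_semilinear pull_inj S_ab_pull).
Qed.

End Module.
End Forward.

(** * Assembling an epimorphism from links *)

Lemma nset_divC (H : topGroupType) (N : normalSub H) x y :
  nset N (x^-1 * y) -> nset N (x * y^-1).
Proof.
move=> /nV /(nJl x); rewrite invgM invgK mulgA => Nxy.
by rewrite -(mulgK x (x * y^-1)).
Qed.

Section Link.
Variables (H G H' G' : profiniteType).
Variables (tau : epi H G) (tau' : epi H' G') (pi : epi G G').

(** The graph modulo N and N' of a homomorphism from H to H'/N' over pi that
  maps Ker tau onto Ker tau' / N', with kernel N on Ker tau. *)
Record link (R : set (H * H')) (N : normalSub H) (N' : normalSub H') : Prop := Link {
  linkC : closed R;
  linkM : forall h h' l l', R (h, h') -> R (l, l') -> R (h * l, h' * l');
  linkV : forall h h', R (h, h') -> R (h^-1, h'^-1);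
  link_sq : forall h h', R (h, h') -> pi (tau h) = tau' h';
  link_ex : forall h h', pi (tau h) = tau' h' ->
    exists2 k', ker tau' k' & R (h, k' * h');
  linkN' : forall k', ker tau' k' -> R (1, k') <-> nset N' k';
  linkN : forall k, ker tau k -> R (k, 1) <-> nset N k;
  link_ker : forall k', ker tau' k' -> exists2 k, ker tau k & R (k, k') }.

Section Assemble.
Variables (I : eqType) (R : I -> set (H * H')).
Variables (N : I -> normalSub H) (N' : I -> normalSub H').
Hypothesis lk : forall i, link (R i) (N i) (N' i).
Hypothesis crt : forall k : I -> H, (forall i, ker tau (k i)) ->
  exists2 x, ker tau x & forall i, nset (N i) (x^-1 * k i).
Hypothesis crt' : forall k : I -> H', (forall i, ker tau' (k i)) ->
  exists2 x, ker tau' x & forall i, nset (N' i) (x^-1 * k i).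
Hypothesis triv' : forall k', ker tau' k' -> (forall i, nset (N' i) k') -> k' = 1.

Let Gam (h : H) (h' : H') := pi (tau h) = tau' h' /\ forall i, R i (h, h').

Let Gam_ex h : exists h', Gam h h'.
Proof.
have [h' h'E] := epi_surj tau' (pi (tau h)).
pose k i := projT1 (cid2 (link_ex (lk i) (esym h'E))).
have kK i : ker tau' (k i) by rewrite /k; case: cid2.
have kR i : R i (h, k i * h') by rewrite /k; case: cid2.
have [x Kx xP] := crt' kK; exists (x * h'); split; first by rewrite kerMl.
move=> i; rewrite -(mulgVK (k i) x) -mulgA -[h]mul1g; apply: linkM => //.
  apply/(linkN' (lk i)); first by apply: kerM => //; exact: kerV.
  exact: nset_divC.
Qed.

Let Gam_uniq h h1 h2 : Gam h h1 -> Gam h h2 -> h1 = h2.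
Proof.
move=> [s1 R1] [s2 R2]; have K12 : ker tau' (h1 * h2^-1).
  by apply: ker_div; rewrite -s1.
suff /(canRL (mulgVK _)) : h1 * h2^-1 = 1 by rewrite mul1g.
apply: triv' => // i; apply/(linkN' (lk i)) => //.
by rewrite -(mulgV h); apply: linkM => //; exact: linkV.
Qed.

(** Values of theta exist by the Chinese remainder theorem in Ker tau' and are
  unique since the N' i have trivial intersection; Ker tau' is reached by the
  Chinese remainder theorem in Ker tau. The graph is an intersection of closed
  sets, so theta is continuous. *)
Lemma assemble : exists theta : epi H H', semi_cartesian tau tau' pi theta.
Proof.
pose th h := projT1 (cid (Gam_ex h)).
have thP h : Gam h (th h) by rewrite /th; case: cid.
have thE h h' : Gam h h' -> th h = h' by move=> Gh; exact: Gam_uniq (thP h) Gh.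
have thM : {morph th : x y / x * y}.
  move=> x y; apply: thE; have [sx Rx] := thP x; have [sy Ry] := thP y.
  by split; [rewrite !epiM sx sy|move=> i; apply: linkM].
have thC : continuous th.
  apply: closed_graph_continuous.
  - exact: profinite_compact.
  - exact: profinite_hausdorff.
  - exact: profinite_compact.
  have -> : [set p : H * H' | p.2 = th p.1] =
      [set p | pi (tau p.1) = tau' p.2] `&` \bigcap_i R i.
    apply/seteqP; split=> [[h h'] /= ->|[h h'] /= [s Rh]]; last first.
      by apply/esym/thE; split=> // i; exact: Rh.
    by have [s Rh] := thP h; split=> // i _; exact: Rh.
  apply: closedI; last by apply: closed_bigI => i _; exact: linkC.
  apply: closed_eq; first exact: profinite_hausdorff.
    have c := continuous_fun_comp (@epi_cont _ _ tau) (@epi_cont _ _ pi).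
    exact: (continuous_fun_comp (@fst_continuous H H') c).
  exact: (continuous_fun_comp (@snd_continuous H H') (@epi_cont _ _ tau')).
have thK k' : ker tau' k' -> exists2 k, ker tau k & th k = k'.
  move=> Kk'; pose k i := projT1 (cid2 (link_ker (lk i) Kk')).
  have kK i : ker tau (k i) by rewrite /k; case: cid2.
  have kR i : R i (k i, k') by rewrite /k; case: cid2.
  have [x Kx xP] := crt kK; exists x => //; apply: thE.
  split=> [|i]; first by rewrite Kx Kk' epi1.
  rewrite -(mulgVK (k i) x) -[k']mul1g; apply: linkM => //.
  apply/(linkN (lk i)); first by apply: kerM => //; exact: kerV.
  exact: nset_divC.
have thS h' : exists h, th h = h'.
  have [g gE] := epi_surj pi (tau' h'); have [h hE] := epi_surj tau g.
  have [s _] := thP h.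
  have [k Kk kE] : exists2 k, ker tau k & th k = (th h)^-1 * h'.
    by apply: thK; apply: ker_divl; rewrite -s hE.
  by exists (h * k); rewrite thM kE mulVKg.
exists (Epi thM thC thS); split=> [h|]; first by have [/= <-] := thP h.
apply/seteqP; split=> [_ [k Kk <-]|k' /thK[k Kk <-]]; last by exists k.
by have [/= s _] := thP k; rewrite /ker /= -s Kk epi1.
Qed.

End Assemble.

(** * Maximality and commutativity along a link *)

Section LinkMax.
Variables (R : set (H * H')) (N : normalSub H) (N' : normalSub H').
Hypothesis lk : link R N N'.
Hypothesis leN : N `<=` ker tau.

Let link_fst k : ker tau k -> exists2 k', ker tau' k' & R (k, k').
Proof.
move=> Kk; have [|k' Kk' Rk] := link_ex lk (h := k) (h' := 1).
  by rewrite Kk !epi1.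
by exists k' => //; rewrite mulg1 in Rk.
Qed.

Let link_N k k' : ker tau k -> ker tau' k' -> R (k, k') -> nset N k <-> nset N' k'.
Proof.
move=> Kk Kk' Rk; rewrite -(linkN lk Kk) -(linkN' lk Kk'); split=> [Rk1|R1k].
  by have := linkM lk (linkV lk Rk1) Rk; rewrite mulVg invg1 mul1g.
by have := linkM lk Rk (linkV lk R1k); rewrite invg1 mulg1 mulgV.
Qed.

Lemma link_abelian : abelian_mod tau N -> abelian_mod tau' N'.
Proof.
move=> ab x' y' Kx' Ky'; have [x Kx Rx] := link_ker lk Kx'; have [y Ky Ry] := link_ker lk Ky'.
have KM := kerM (kerV (kerM Ky Kx)) (kerM Kx Ky).
have KM' := kerM (kerV (kerM Ky' Kx')) (kerM Kx' Ky').
apply/(link_N KM KM'); last exact: ab.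
by apply: (linkM lk); [apply: (linkV lk)|]; apply: (linkM lk).
Qed.

(** The image along the link of a normal subgroup M of H with N < M < Ker tau is
  a normal subgroup of H' strictly between N' and Ker tau'; it is closed, being
  a projection of a compact set. *)
Lemma link_max : maxnormal (ker tau') N' -> maxnormal (ker tau) N.
Proof.
move=> [[NK' nKN'] Nm']; split.
  split=> // KN; apply: nKN' => k' Kk'; have [k Kk Rk] := link_ker lk Kk'.
  by apply/(link_N Kk Kk' Rk)/KN.
move=> M [MK nKM] NM k Mk; apply: contrapT => nNk; apply: nKM.
pose P := [set k' | exists2 m, nset M m & R (m, k')].
have PK k' : P k' -> ker tau' k'.
  by move=> [m /MK Km /(link_sq lk)]; rewrite Km epi1.
have Pc : closed P.
  have -> : P = snd @` (R `&` fst @^-1` M).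
    apply/seteqP; split=> [k' [m Mm Rm]|_ [[m k'] /= [Rm Mm] <-]]; last by exists m.
    by exists (m, k').
  apply: closed_image_compact.
  - by apply: compactTT; exact: profinite_compact.
  - exact: profinite_hausdorff.
  - exact: snd_continuous.
  - apply: closedI; first exact: (linkC lk).
    by apply: (closed_preimage (@fst_continuous H H')); exact: n_closed.
have P1 : P 1.
  by exists 1; [exact: n1|apply/(linkN' lk); [exact: epi1|exact: n1]].
have PV x : P x -> P x^-1.
  by move=> [m Mm Rm]; exists m^-1; [exact: nV|exact: (linkV lk)].
have PM x y : P x -> P y -> P (x * y).
  by move=> [m Mm Rm] [n Mn Rn]; exists (m * n); [exact: nM|exact: (linkM lk)].
have PJ x y : P x -> P (x ^ y).
  move=> [m Mm Rm]; have [g gE] := epi_surj pi (tau' y); have [h hE] := epi_surj tau g.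
  have [|l' Kl' Rl'] := link_ex lk (h := h) (h' := y); first by rewrite hE.
  have [l Kl Rl] := link_ker lk Kl'.
  have Rhy : R (l^-1 * h, y).
    by have := linkM lk (linkV lk Rl) Rl'; rewrite mulKg.
  exists (m ^ (l^-1 * h)); first exact: nJ.
  by rewrite /conjg; apply: (linkM lk); [exact: (linkV lk)|exact: (linkM lk)].
have [PT|nPT] := pselect (ker tau' `<=` P).
  move=> x Kx; have [x' Kx' Rx] := link_fst Kx; have [m Mm Rm] := PT _ Kx'.
  have : nset N (x * m^-1).
    apply/(linkN lk); first by apply: kerM => //; apply: kerV; exact: MK.
    by have := linkM lk Rx (linkV lk Rm); rewrite mulgV.
  by move=> /NM /nM /(_ Mm); rewrite mulgVK.
case: nNk; have [k' Kk' Rk] := link_fst (MK _ Mk).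
apply/(link_N (MK _ Mk) Kk' Rk); apply: (Nm' (NormalSub P1 PV PM PJ Pc)).
- by split.
- move=> n' Nn'; exists 1; first exact: n1.
  by apply/(linkN' lk) => //; exact: NK'.
- by exists k.
Qed.

End LinkMax.

(** * Links between non-abelian chief factors *)

Section NaLink.
Variables (E' : profiniteType) (zeta' : epi E' G').
Variables (a : epi H E') (b : epi H' E') (N : normalSub H) (N' : normalSub H').
Hypothesis aE : forall h, zeta' (a h) = pi (tau h).
Hypothesis bE : forall h', zeta' (b h') = tau' h'.
Hypothesis aN : forall k, ker tau k -> a k = 1 <-> nset N k.
Hypothesis bN : forall h', b h' = 1 <-> nset N' h'.
Hypothesis aK : forall e, ker zeta' e -> exists2 k, ker tau k & a k = e.

Let bK e : ker zeta' e -> exists2 k', ker tau' k' & b k' = e.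
Proof. by move=> Ke; have [k' kE] := epi_surj b e; exists k' => //; rewrite /ker /= -bE kE. Qed.

Lemma na_link : link [set p | a p.1 = b p.2] N N'.
Proof.
split=> /=.
- apply: closed_eq; first exact: profinite_hausdorff.
    exact: (continuous_fun_comp (@fst_continuous H H') (@epi_cont _ _ a)).
  exact: (continuous_fun_comp (@snd_continuous H H') (@epi_cont _ _ b)).
- by move=> h h' l l' hE lE; rewrite !epiM hE lE.
- by move=> h h' hE; rewrite !epiV hE.
- by move=> h h' hE; rewrite -aE hE bE.
- move=> h h' hE; have [|k' Kk' kE] := @bK (a h * (b h')^-1).
    by apply: ker_div; rewrite aE bE.
  by exists k' => //; rewrite epiM kE mulgVK.
- by move=> k' _; rewrite epi1 -bN; split.
- by move=> k Kk; rewrite epi1 aN.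
- move=> k' Kk'; have [|k Kk kE] := @aK (b k'); last by exists k.
  by rewrite /ker /= bE.
Qed.

(** As Ker tau' / N' is a non-abelian chief factor, its centre is trivial, so
  the kernel of a is the centralizer in Ker (pi tau) of Ker tau modulo N. *)
Lemma na_link_kernel : maxnormal (ker tau') N' -> ~ abelian_mod tau' N' ->
  forall h, ker a h <-> pi (tau h) = 1 /\
    forall k, ker tau k -> nset N (h * k * h^-1 * k^-1).
Proof.
move=> [[NK' nKN'] Nm'] nab h; split=> [ah|[th cen]].
  split; first by rewrite -aE ah epi1.
  move=> k Kk; apply/aN; first by apply: kerM; [exact: kerJ|exact: kerV].
  by rewrite !epiM !epiV ah mul1g invg1 mulg1 mulgV.
have Ka : ker zeta' (a h) by rewrite /ker /= aE.
have [k' Kk' kE] := bK Ka; rewrite /ker /= -kE; apply/bN.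
(* the centre of Ker tau' modulo N' *)
pose Z := [set z | ker tau' z /\ forall l, ker tau' l -> nset N' (z * l * z^-1 * l^-1)].
have Zc : closed Z.
  have -> : Z = ker tau' `&` \bigcap_(l in ker tau') [set z | nset N' (z * l * z^-1 * l^-1)].
    by apply/seteqP; split=> z [Kz Nz].
  apply: closedI; first by apply: ker_closed; exact: profinite_hausdorff.
  apply: closed_bigI => l _.
  have cc : continuous (fun z : H' => z * l * z^-1 * l^-1).
    apply: continuous_mulg => [|?]; last exact: cst_continuous.
    apply: continuous_mulg; last exact: invg_continuous.
    exact: mulgr_continuous.
  exact: (closed_preimage cc (@n_closed _ N')).
have ZE z : Z z <-> ker tau' z /\ forall l, ker tau' l -> b (z * l) = b (l * z).
  split=> -[Kz Nz]; split=> // l /Nz.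
    by move=> /bN; rewrite !epiM !epiV => /(canRL (mulgVK _)); rewrite mul1g => /(canRL (mulgVK _)).
  by move=> zl; apply/bN; rewrite 2!epiM zl !epiM !epiV mulgK mulgV.
have Z1 : Z 1 by apply/ZE; split=> [|l _]; [exact: epi1|rewrite mul1g mulg1].
have ZV x : Z x -> Z x^-1.
  move=> /ZE[Kx xl]; apply/ZE; split=> [|l Kl]; first exact: kerV.
  apply: (mulgI (b x)); apply: (mulIg (b x)); rewrite !epiM !epiV.
  by rewrite mulVKg (mulgA (b x)) mulgVK -!epiM; exact/esym/xl.
have ZM x y : Z x -> Z y -> Z (x * y).
  move=> /ZE[Kx xl] /ZE[Ky yl]; apply/ZE; split=> [|l Kl]; first exact: kerM.
  have := xl l Kl; have := yl l Kl; rewrite !epiM => ylE xlE.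
  by rewrite -mulgA ylE mulgA xlE mulgA.
have ZJ x y : Z x -> Z (x ^ y).
  move=> [Kx Nx]; split; first by rewrite conjg_mulV; exact: kerJ.
  move=> l Kl; have := nJ y (Nx _ (kerJ y Kl)).
  set w := y * l * y^-1; have wE : w ^ y = l by rewrite /conjg /w !mulgA mulVg mul1g mulgVK.
  by rewrite 3!conjMg 2!conjVg wE.
have ZN : Z `<=` N'.
  apply: (Nm' (NormalSub Z1 ZV ZM ZJ Zc)).
    split=> [z []//|KZ]; apply: nab => x y Kx Ky.
    have /ZE[_ /(_ y Ky) xy] := KZ _ Kx.
    by apply/bN; rewrite epiM epiV xy mulVg.
  move=> z Nz; split=> [|l Kl]; first exact: NK'.
  have -> : z * l * z^-1 * l^-1 = z * (l * z^-1 * l^-1) by rewrite !mulgA.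
  by apply: nM => //; apply: nJl; exact: nV.
apply: ZN; apply/ZE; split=> // l' Kl'.
have [|l Kl lE] := @aK (b l'); first by rewrite /ker /= bE.
have := cen l Kl; move=> /(aN (kerM (kerJ h Kl) (kerV Kl))).
rewrite !epiM !epiV => /(canRL (mulgVK _)); rewrite mul1g => /(canRL (mulgVK _)).
by rewrite lE kE.
Qed.

End NaLink.

(** E1 and E2 are both the quotient of H by the common kernel. *)
Lemma na_link_iso (E1 E2 : profiniteType) (z1 : epi E1 G') (z2 : epi E2 G')
    (a1 : epi H E1) (a2 : epi H E2) :
  (forall h, z1 (a1 h) = pi (tau h)) -> (forall h, z2 (a2 h) = pi (tau h)) ->
  (forall h, ker a1 h <-> ker a2 h) -> epi_iso z1 z2.
Proof.
move=> a1E a2E kE.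
have [c cE] : exists c : epi E1 E2, forall h, c (a1 h) = a2 h.
  apply: epi_factor; [exact: profinite_compact|exact: profinite_hausdorff|].
  by move=> h /kE.
exists c; split; last first.
  by move=> e; have [h <-] := epi_surj a1 e; rewrite a1E /= cE a2E.
apply: inj_isom; [exact: profinite_compact|exact: profinite_hausdorff|].
apply/ker_inj => e; have [h <-] := epi_surj a1 e.
by rewrite /ker /= cE => /kE.
Qed.

(** * Links between abelian chief factors *)

Section AbLink.
Variables (A' : gmodule G') (sA' : finite_simple A').
Local Notation A := (inf_mod pi A').
Variables (phi : ghom (B_ab tau' A') A') (psi : ghom (B_ab tau A) A).
Hypothesis phi_nz : exists2 k, ker tau' k & hat phi k <> 0%R.
Hypothesis psi_nz : exists2 k, ker tau k & hat psi k <> 0%R.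
Hypothesis S_eq : S_ab psi = H2inf pi A' (S_ab phi).
Variables (ck : khom tau (hat psi)) (ck' : khom tau' (hat phi)).

(** The class S phi is represented by a cocycle e on G', and its inflation by
  that of e. So there are twisted cochains u' on H' and u on H with the same
  defect e. The link consists of the compatible pairs on which u and u'
  agree, which form a subgroup because the defects are equal. *)
Lemma ab_link : exists R, link R (khom_ker ck) (khom_ker ck').
Proof.
have sA : finite_simple A by exact: inf_simple.
have hA : hausdorff_space A.
  apply: zero_dimensional_hausdorff => x y xy; exists [set x].
  have [_ dA _ _ _] := sA; split=> //; last by apply/eqP; rewrite eq_sym.
  by split=> //; rewrite -[[set x]]setCK; apply: open_closedC.
have /S_abP[u' [uC' uk' uM']] : S_ab phi = class2 (repr (S_ab phi)) by rewrite class2K.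
have /S_abP[u [uC uk uM]] := S_eq.
set e := repr (S_ab phi) in uM' uM.
have {}uM h1 h2 : u (h1 * h2) = (u h1 + gact (pi (tau h1)) (u h2) +
    e (pi (tau h1), pi (tau h2)) :> A')%R := uM h1 h2.
have surj := khom_surj sA ck psi_nz.
have surj' := khom_surj sA' ck' phi_nz.
exists [set p | pi (tau p.1) = tau' p.2 /\ u p.1 = u' p.2 :> A'].
(* the value at 1 is determined by the defect at (1, 1) *)
have u11 : u 1 = u' 1 :> A'.
  have := uM 1 1; have := uM' 1 1; rewrite !mulg1 !epi1 !gact1 => e' e0.
  have aux (x : A') : (x = x + x + e (1%g, 1%g) -> x = - e (1%g, 1%g))%R.
    move=> /eqP; rewrite -addrA addrC -subr_eq subrr eq_sym addr_eq0 => /eqP //.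
  by rewrite (aux _ e0) (aux _ e').
split=> /=.
- apply: closedI; apply: closed_eq => //.
  + exact: profinite_hausdorff.
  + have c := continuous_fun_comp (@epi_cont _ _ tau) (@epi_cont _ _ pi).
    exact: (continuous_fun_comp (@fst_continuous H H') c).
  + exact: (continuous_fun_comp (@snd_continuous H H') (@epi_cont _ _ tau')).
  + exact: (continuous_fun_comp (@fst_continuous H H') uC).
  + exact: (continuous_fun_comp (@snd_continuous H H') uC').
- move=> h h' l l' [hs hu] [ls lu]; split; first by rewrite !epiM hs ls.
  by rewrite uM uM' hs ls hu lu.
- move=> h h' [hs hu]; split; first by rewrite !epiV hs.
  have := uM h h^-1; have := uM' h' h'^-1; rewrite !mulgV u11 !epiV hs hu => -> /addIr /addrI.
  by move=> /(congr1 (gact (tau' h')^-1)); rewrite -!gactM mulVg !gact1.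
- by move=> h h' [].
- move=> h h' hs; have [k' Kk' kE] := surj' (u h - u' h')%R.
  by exists k' => //; split; [rewrite kerMl|rewrite uk' // kE subrK].
- move=> k' Kk'; rewrite -[u' k'](congr1 u' (mulg1 k')) uk' // u11 !epi1 Kk'.
  split=> [[_ /eqP]|[_ k0]]; last by rewrite k0 add0r.
  by rewrite -subr_eq0 opprD addrCA subrr addr0 oppr_eq0 => /eqP.
- move=> k Kk; have -> : u k = (hat psi k + u 1%g)%R by rewrite -uk // mulg1.
  rewrite Kk !epi1 u11; split=> [[_ /eqP]|[_ k0]]; last by rewrite k0; split=> //; exact: add0r.
  rewrite -subr_eq0 addrK => /eqP k0; by split.
- move=> k' Kk'; have [k Kk kE] := surj (hat phi k'); exists k => //.
  rewrite Kk Kk' epi1; split=> //.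
  have -> : u k = (hat psi k + u 1%g)%R by rewrite -uk // mulg1.
  have -> : u' k' = (hat phi k' + u' 1%g)%R by rewrite -uk' // mulg1.
  by rewrite kE u11.
Qed.

End AbLink.

End Link.

(** * Independence of chief factors *)

Section AbIndependent.
Variables (H G : profiniteType) (tau : epi H G) (A : gmodule G).
Hypothesis sA : finite_simple A.
Variables (I : eqType) (N : I -> normalSub H) (phi : ghom (B_ab tau A) A).
Variables (X : set (ghom (B_ab tau A) A)) (s : seq I).
Hypothesis Nmax : forall i, maxnormal (ker tau) (N i).

(** Write hat phi as a sum of homomorphisms eta j killed by N j. By Schur's lemma
  a nonzero eta j identifies Ker tau / N j with A, and is then a multiple of
  the member of X with kernel N j. *)
Lemma ab_independent :
  (forall j, j \in s -> ~ abelian_mod tau (N j) \/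
    exists (Aj : gmodule G) (chi : H -> Aj) (ck : khom tau chi),
    [/\ finite_simple Aj, exists2 k, ker tau k & chi k <> 0%R,
        khom_ker ck = N j &
        gmod_iso Aj A -> exists2 phij, X phij &
          forall k, ker tau k -> hat phij k = 0%R <-> nset (N j) k]) ->
  (forall x, nset (capL tau N s) x -> hat phi x = 0%R) -> lspan X phi.
Proof.
move=> types s0; have [_ dA _ _ _] := sA.
have s0' x : nset (capL tau N (undup s)) x -> hat phi x = 0%R.
  move=> /capLP[Kx sx]; apply: s0; apply/capLP; split=> // i si.
  by apply: sx; rewrite mem_undup.
have [eta [etaP etaS]] := khom_decompose Nmax (undup_uniq s) (hat_khom phi dA) s0'.
have ex j : exists chi, j \in s -> lspan X chi /\
    forall k, ker tau k -> hat chi k = eta j k.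
  have [sj|] := boolP (j \in s); last by exists 0%R.
  have [ek eN] : khom tau (eta j) /\ forall x, nset (N j) x -> eta j x = 0%R.
    by apply: etaP; rewrite mem_undup.
  have [z|nz] := pselect (forall k, ker tau k -> eta j k = 0%R).
    by exists 0%R => _; split; [exact: span0|move=> k Kk; rewrite z].
  have [nab|[Aj [chi [ck [sAj cnz kE iso]]]]] := types j sj.
    by case: nz => k Kk; exact: khom_nonabelian nab ek eN k Kk.
  have [alpha alphaE] : exists alpha : ghom Aj A, forall k, ker tau k -> eta j k = alpha (chi k).
    by apply: (khom_factor (ck := ck)) => // x; rewrite kE; exact: eN.
  have [|phij Xphij phijN] := iso.
    have [|beta bE] := schur (alpha := alpha) sAj sA; last by exists alpha, beta.
    apply: contrapT => nx; apply: nz => k Kk; rewrite alphaE //.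
    by apply: contrapT => ak; apply: nx; exists (chi k).
  have pk := hat_khom phij dA.
  have [beta betaE] : exists beta : ghom A A, forall k, ker tau k -> eta j k = beta (hat phij k).
    apply: (khom_factor (ck := pk)) => //.
      apply: contrapT => nx; apply: nz => k Kk; apply: eN; apply/phijN => //.
      by apply: contrapT => ak; apply: nx; exists k.
    by move=> x /khom_kerP[Kx /(phijN _ Kx)]; exact: eN.
  exists ((beta : EndG A) *: phij)%R => _; split; last by move=> k Kk; rewrite hatZ betaE.
  by apply: spanZ; exact: span_sub.
pose chi j := projT1 (cid (ex j)).
have chiP j : j \in s -> lspan X (chi j) /\ forall k, ker tau k -> hat (chi j) k = eta j k.
  by rewrite /chi; case: cid.
have -> : phi = (\sum_(j <- undup s) chi j)%R.
  apply: hat_inj => k Kk; rewrite etaS // (_ : hat _ k = \sum_(j <- undup s) hat (chi j) k)%R.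
    by apply: eq_big_seq => j; rewrite mem_undup => sj; have [_ ->] := chiP j sj.
  by elim/big_rec2: _ => [|j x y _ <-]; rewrite ?hatD.
rewrite big_seq; elim/big_ind: _ => [|x y|j]; [exact: span0|exact: spanD|].
by rewrite mem_undup => sj; have [] := chiP j sj.
Qed.

End AbIndependent.

(** * Representatives of isomorphism classes *)

(** Equivalent elements x have the same set of z with rel z x, hence the same
  chosen element of it. *)
Section Representative.
Variables (T : Type) (rel : T -> T -> Prop).
Hypotheses (rr : forall x, rel x x) (rs : forall x y, rel x y -> rel y x).
Hypothesis rt : forall x y z, rel x y -> rel y z -> rel x z.

Let rep_ex x : exists y, rel y x. Proof. by exists x. Qed.

Definition representative x : T := projT1 (cid (rep_ex x)).

Lemma representativeP x : rel (representative x) x.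
Proof. by rewrite /representative; case: cid. Qed.

Lemma representative_eq x y : rel x y -> representative x = representative y.
Proof.
move=> xy; rewrite /representative.
have E : (fun z => rel z x) = (fun z => rel z y).
  apply: funext => z; apply: propext; split=> [zx|zy]; first exact: rt zx xy.
  exact: rt zy (rs xy).
move: (rep_ex x) (rep_ex y); rewrite -E => e1 e2.
by rewrite (Prop_irrelevance e1 e2).
Qed.

End Representative.

(** The kernel of the first factor of a decomposition lies between N and
  Ker tau. *)
Lemma quot_indecomposable (H G : profiniteType) (tau : epi H G) (N : normalSub H)
    (leN : N `<=` ker tau) :
  maxnormal (ker tau) N -> indecomposable (quot_epi leN).
Proof.
move=> [[_ nKN] Nm]; split=> [/isom_inj qi|E eta1 eta2 etaE].
  apply: nKN => k Kk; apply/ker_cproj; rewrite /ker /=; apply: qi.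
  by rewrite [LHS](quot_funE leN k) Kk; exact/esym/(epi1 (quot_epi leN)).
have tE h : eta2 (eta1 (cproj N h)) = tau h.
  by rewrite -[RHS](quot_funE leN); exact/esym/etaE.
pose M := kerN (comp_epi eta1 (cproj_epi N)) (@profinite_hausdorff E).
have ME h : nset M h <-> eta1 (cproj N h) = 1 by [].
have MK : M `<=` ker tau by move=> h /ME h1; rewrite /ker /= -tE h1 epi1.
have NM : N `<=` M.
  move=> h /ker_cproj; rewrite /ker /= => h1; apply/ME.
  by rewrite h1; exact: (epi1 eta1).
have [KM|nKM] := pselect (ker tau `<=` M); [right|left]; apply: inj_isom;
  (try exact: profinite_compact); (try exact: profinite_hausdorff); apply/ker_inj.
- move=> e; have [q <-] := epi_surj eta1 e; rewrite -(cprojK q) /ker /= tE.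
  by move=> /KM/ME.
- move=> q; rewrite -(cprojK q) => /ME/(Nm M (conj MK nKM) NM)/ker_cproj.
  by [].
Qed.

Section Backward.
Variables (H G H' G' : profiniteType).
Variables (tau : epi H G) (tau' : epi H' G') (pi : epi G G').
Hypothesis fund' : fundamental tau'.
Hypothesis hyp_na : forall (E' : profiniteType) (zeta' : epi E' G'),
  indecomposable zeta' -> ~ abelian_ker zeta' ->
  mult_na tau' zeta' #<= mult_na tau (inf_epi pi zeta').
Hypothesis hyp_supp : forall A' : gmodule G', finite_simple A' ->
  H2inf pi A' @` supp_ab tau' A' `<=` supp_ab tau (inf_mod pi A').
Hypothesis hyp_mult : forall A' : gmodule G', finite_simple A' ->
  card_add (nullity pi tau' A') (mult_ab tau' A') #<= mult_ab tau (inf_mod pi A').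

(** * Non-abelian chief factors of the target *)

Record na_index := NaIndex {
  na_sub :> normalSub H';
  na_max : maxnormal (ker tau') na_sub;
  na_nab : ~ abelian_mod tau' na_sub }.

Lemma na_index_eq (i j : na_index) : na_sub i = na_sub j -> i = j.
Proof. by case: i j => [N m a] [M n b] /= E; subst M; congr NaIndex; exact: Prop_irrelevance. Qed.

Lemma na_le (i : na_index) : na_sub i `<=` ker tau'.
Proof. by case: i => N [[]]. Qed.

Definition na_epi (i : na_index) := quot_epi (@na_le i).

Definition na_rel (i j : na_index) := epi_iso (na_epi i) (na_epi j).

Definition na_rep : na_index -> na_index :=
  representative (rel := na_rel) (fun i => epi_iso_refl (na_epi i)).

Lemma na_repP i : epi_iso (na_epi i) (na_epi (na_rep i)).
Proof. exact/epi_iso_sym/(representativeP (rel := na_rel)). Qed.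

Lemma na_rep_eq i j : na_rel i j -> na_rep i = na_rep j.
Proof.
apply: representative_eq => [x y|x y z]; first exact: epi_iso_sym.
exact: epi_iso_trans.
Qed.

Lemma na_rep_idem i : na_rep (na_rep i) = na_rep i.
Proof. exact/na_rep_eq/epi_iso_sym/na_repP. Qed.

Let na_ex (r : na_index) : exists f : normalSub H' -> normalSub H,
  (forall N, mult_na tau' (na_epi r) N -> mult_na tau (inf_epi pi (na_epi r)) (f N)) /\
  (forall N M, mult_na tau' (na_epi r) N -> mult_na tau' (na_epi r) M -> f N = f M -> N = M).
Proof.
apply: (card_le_fun (kerN tau (@profinite_hausdorff G))).
apply: (hyp_na (E' := quot (na_sub r))).
  by apply: quot_indecomposable; exact: na_max.
by move=> /abelian_kerP; exact: na_nab.
Qed.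

(** The injection between multiplicity sets is chosen once for each isomorphism
  class, through the representative. *)
Definition na_match (i : na_index) : normalSub H := projT1 (cid (na_ex (na_rep i))) i.

Lemma na_mult (i : na_index) : mult_na tau' (na_epi (na_rep i)) i.
Proof. by exists (@na_le i); exact: na_repP. Qed.

Lemma na_matchP i : mult_na tau (inf_epi pi (na_epi (na_rep i))) (na_match i).
Proof. by rewrite /na_match; case: cid => f [/= fP _]; apply: fP; exact: na_mult. Qed.

Lemma na_match_le i : na_match i `<=` ker tau.
Proof. by case: (na_matchP i). Qed.

(** Let E' be the quotient of H' by the representative of the class of i. The
  quotient of H by na_match i is the fibre product of G and E', and a is the
  second projection; the kernel of E' ->> G' is reached by the kernel of the
  first projection. *)
Lemma na_maps (i : na_index) : exists (a : epi H (quot (na_sub (na_rep i))))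
    (b : epi H' (quot (na_sub (na_rep i)))),
  [/\ forall h, na_epi (na_rep i) (a h) = pi (tau h),
      forall h', na_epi (na_rep i) (b h') = tau' h',
      forall k, ker tau k -> a k = 1 <-> nset (na_match i) k,
      forall h', b h' = 1 <-> nset i h' &
      forall e, ker (na_epi (na_rep i)) e -> exists2 k, ker tau k & a k = e].
Proof.
have [leN [psi [psiI psiE]]] := na_matchP i.
have [phi [phiI phiE]] := na_repP i.
set z := na_epi (na_rep i) in psi psiI psiE phi phiI phiE *.
pose c := comp_epi psi (cproj_epi (na_match i)).
have cE h : (val (c h)).1 = tau h.
  by rewrite -[RHS](quot_funE leN h); exact/esym/psiE.
have vE (p : Defs.fprod pi z) : pi (val p).1 = z (val p).2.
  by have := set_valP p.
have aM : {morph (fun h => (val (c h)).2) : x y / x * y} by move=> x y; rewrite epiM.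
have aC : continuous (fun h => (val (c h)).2).
  apply: (continuous_fun_comp (f := fun h => val (c h))); last exact: snd_continuous.
  exact: (continuous_fun_comp (@epi_cont _ _ c) (@fprod_val_continuous _ _ _ _ _)).
have aS e : exists h, (val (c h)).2 = e.
  have [g gE] := epi_surj pi (z e).
  have pP : (g, e) \in fprod_set pi z by rewrite inE.
  have [h hE] := epi_surj c (exist _ (g, e) pP); by exists h; rewrite hE.
exists (Epi aM aC aS), (comp_epi phi (cproj_epi i)).
split=> /=.
- by move=> h; rewrite -[LHS]vE cE.
- by move=> h'; rewrite -[RHS](quot_funE (@na_le i)); exact/esym/phiE.
- move=> k Kk; split=> [ak|/ker_cproj].
    apply/ker_cproj; rewrite /ker /=; apply: (isom_inj psiI).
    rewrite (epi1 psi); apply: val_inj; rewrite [LHS]surjective_pairing [X in (X, _)]cE Kk.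
    by rewrite [X in (_, X)]ak.
  by rewrite /ker /= => k1; rewrite k1 (epi1 psi).
- move=> h'; split=> [h1|/ker_cproj].
    by apply/ker_cproj/(isom_inj phiI); rewrite (epi1 phi).
  by rewrite /ker /= => ->; rewrite (epi1 phi).
- move=> e Ke; have pP : (1, e) \in fprod_set pi z.
    by rewrite inE /fprod_set /= epi1; exact/esym.
  have [h hE] := epi_surj c (exist _ (1, e) pP).
  exists h; last exact: (congr1 (fun p => (val p).2) hE).
  by rewrite /ker /= -cE hE.
Qed.

Lemma na_link_ex (i : na_index) : exists R, link tau tau' pi R (na_match i) i.
Proof.
have [a [b [aE bE aN bN aK]]] := na_maps i.
by eexists; apply: na_link aE bE aN bN aK.
Qed.

(** The subgroup na_match i determines the kernel of the map from H to E', by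
  na_link_kernel, and with it the isomorphism class of i; inside one class the
  matching is injective. *)
Lemma na_match_inj (i j : na_index) : na_match i = na_match j -> i = j.
Proof.
move=> ij; have [a1 [b1 [a1E b1E a1N b1N a1K]]] := na_maps i.
have [a2 [b2 [a2E b2E a2N b2N a2K]]] := na_maps j.
have k1 := na_link_kernel a1E b1E a1N b1N a1K (na_max i) (@na_nab i).
have k2 := na_link_kernel a2E b2E a2N b2N a2K (na_max j) (@na_nab j).
have rij : na_rep i = na_rep j.
  rewrite -[LHS]na_rep_idem -[RHS]na_rep_idem.
  apply: na_rep_eq; apply: na_link_iso a1E a2E _ => h.
  by rewrite k1 k2 ij.
apply: na_index_eq; move: ij; rewrite /na_match; have := na_mult j; rewrite -rij => mj.
by case: cid => f [/= _ fi]; apply: fi => //; exact: na_mult.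
Qed.

(** * Abelian chief factors of the target *)

Record ab_index := AbIndex {
  ab_sub :> normalSub H';
  ab_max : maxnormal (ker tau') ab_sub;
  ab_abl : abelian_mod tau' ab_sub }.

Lemma ab_le (r : ab_index) : ab_sub r `<=` ker tau'.
Proof. by case: r => N [[]]. Qed.

Lemma ab_ker (r : ab_index) : abelian_ker (quot_epi (@ab_le r)).
Proof. by apply/abelian_kerP; exact: ab_abl. Qed.

Definition ab_mod (r : ab_index) : gmodule G' := kermod (@ab_ker r).

Lemma ab_simple r : finite_simple (ab_mod r).
Proof. by apply: kermod_simple; exact: ab_max. Qed.

Definition ab_rel (r s : ab_index) := gmod_iso (ab_mod r) (ab_mod s).

Definition ab_rep : ab_index -> ab_index :=
  representative (rel := ab_rel) (fun r => gmod_iso_refl (ab_mod r)).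

Lemma ab_repP r : gmod_iso (ab_mod (ab_rep r)) (ab_mod r).
Proof. exact: (representativeP (rel := ab_rel)). Qed.

Lemma ab_rep_eq r s : ab_rel r s -> ab_rep r = ab_rep s.
Proof.
apply: representative_eq => [x y|x y z]; first exact: gmod_iso_sym.
exact: gmod_iso_trans.
Qed.

Lemma ab_rep_idem r : ab_rep (ab_rep r) = ab_rep r.
Proof. exact/ab_rep_eq/ab_repP. Qed.

Section Pairs.
Variable r : ab_index.
Local Notation A' := (ab_mod r).
Local Notation A := (inf_mod pi A').
Local Notation B' := (ghom (B_ab tau' A') A').
Local Notation B := (ghom (B_ab tau A) A).

(** The hypotheses on supports and on abelian multiplicities, for the module
  of r, are those of dimension_ge. *)
Let pairs_ex : exists L : set (B' * B), [/\ findep L fst, findep L snd,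
  forall p, L p -> S_ab p.2 = H2inf pi A' (S_ab p.1) &
  forall phi, lspan (fst @` L) phi].
Proof.
have sA' := ab_simple r; have sA : finite_simple A by exact: inf_simple.
have s1 : (@inflate_hom _ _ pi A' A' : EndG A' -> EndG A) 1%R = 1%R by exact: val_inj.
apply: (dimension_ge (EndG_nontrivial sA') (EndG_nontrivial sA)
  (EndG_division sA') (EndG_division sA) (@inflate_hom_surj _ _ pi A' A')
  (@S_ab_linear _ _ tau' A') (@S_ab_linear _ _ tau A) s1 (@H2inf_semilinear _ _ pi A')).
  move=> phi; have [|psi _ psiE] := @hyp_supp _ sA' (H2inf pi A' (S_ab phi)).
    by exists (S_ab phi) => //; exists phi.
  by exists psi.
exact: hyp_mult.
Qed.

Definition pairs : set (B' * B) := projT1 (cid pairs_ex).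

Lemma pairsP : [/\ findep pairs fst, findep pairs snd,
  forall p, pairs p -> S_ab p.2 = H2inf pi A' (S_ab p.1) &
  forall phi, lspan (fst @` pairs) phi].
Proof. by rewrite /pairs; case: cid. Qed.

Lemma pairs_nz1 p : pairs p -> exists2 k, ker tau' k & hat p.1 k <> 0%R.
Proof.
move=> Lp; apply: contrapT => nx; have [/(_ p Lp) np _ _ _] := pairsP; apply: np.
have -> : p.1 = 0%R; last exact: span0.
apply: hat_inj => k Kk; apply: contrapT => pk; apply: nx; by exists k.
Qed.

Lemma pairs_nz2 p : pairs p -> exists2 k, ker tau k & hat p.2 k <> 0%R.
Proof.
move=> Lp; apply: contrapT => nx; have [_ /(_ p Lp) np _ _] := pairsP; apply: np.
have -> : p.2 = 0%R; last exact: span0.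
apply: hat_inj => k Kk; apply: contrapT => pk; apply: nx; by exists k.
Qed.

Let dA' (S : set A') : open S. Proof. by case: (ab_simple r). Qed.

Definition pair_ker1 (p : B' * B) : normalSub H' := khom_ker (hat_khom p.1 dA').
Definition pair_ker2 (p : B' * B) : normalSub H := khom_ker (A := A) (hat_khom p.2 dA').

Lemma pair_link p : pairs p -> exists R, link tau tau' pi R (pair_ker2 p) (pair_ker1 p).
Proof.
move=> Lp; apply: ab_link; [exact: ab_simple|exact: pairs_nz1|exact: pairs_nz2|].
by have [_ _ h _] := pairsP; exact: h.
Qed.

End Pairs.

(** One representative r for each isomorphism class of modules, with the pairs
  of homomorphisms chosen for it. *)
Record pair_index := PairIndex {
  pi_rep : ab_index;
  pi_pair : ghom (B_ab tau' (ab_mod pi_rep)) (ab_mod pi_rep) *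
    ghom (B_ab tau (inf_mod pi (ab_mod pi_rep))) (inf_mod pi (ab_mod pi_rep));
  pi_repP : ab_rep pi_rep = pi_rep;
  pi_pairP : pairs pi_pair }.

(** * The family of links *)

Definition link_index : eqType := {classic (na_index + pair_index)%type}.

Definition indexN' (i : link_index) : normalSub H' :=
  match i with inl n => na_sub n | inr p => pair_ker1 (pi_pair p) end.

Definition indexN (i : link_index) : normalSub H :=
  match i with inl n => na_match n | inr p => pair_ker2 (pi_pair p) end.

Lemma index_link i : exists R, link tau tau' pi R (indexN i) (indexN' i).
Proof. by case: i => [n|p]; [exact: na_link_ex|apply: pair_link; exact: pi_pairP]. Qed.

Lemma indexN'_max i : maxnormal (ker tau') (indexN' i).
Proof.
case: i => [n|p]; first exact: na_max.
by apply: khom_max; [exact: ab_simple|apply: pairs_nz1; exact: pi_pairP].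
Qed.

Lemma indexN_max i : maxnormal (ker tau) (indexN i).
Proof.
have [R lk] := index_link i; apply: (link_max lk); last exact: indexN'_max.
by case: i {lk} => [n|p]; [exact: na_match_le|move=> x []].
Qed.

(** Non-abelian members contain no intersection of other members by primeness.
  For a pair, only the pairs over the same representative can contribute, and
  these are linearly independent. *)
Lemma index_independent' : independent tau' indexN'.
Proof.
move=> i s nis; case: i nis => [n|[r p rP Lp]] nis sN.
  have [[m|q] ms mE] := max_prime_seq indexN'_max (na_max n) (@na_nab n) sN.
    by move: nis; rewrite -(na_index_eq mE) ms.
  by apply: (@na_nab n); rewrite -mE; exact: khom_ker_abelian.
have [ind _ _ _] := pairsP r; apply: (ind p Lp).
apply: (ab_independent (ab_simple r) (s := s) indexN'_max); last first.
  by move=> x /sN[].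
move=> [m|[q p' qP Lp']] js; first by left; exact: na_nab.
right; exists (ab_mod q), (hat p'.1), (hat_khom p'.1 (let: And5 _ d _ _ _ := ab_simple q in d)).
split.
- exact: ab_simple.
- exact: pairs_nz1.
- exact: normalSub_eq.
- move=> /ab_rep_eq; rewrite rP qP => qr; subst q; exists p'.1.
    exists p' => //; split=> // p'p; move: Lp' js; rewrite p'p => Lp' js.
    move: nis; rewrite (_ : PairIndex rP Lp = PairIndex qP Lp') ?js //.
    congr PairIndex; exact: Prop_irrelevance.
  by move=> k Kk; split=> [k0|[]].
Qed.

Lemma index_independent : independent tau indexN.
Proof.
move=> i s nis; case: i nis => [n|[r p rP Lp]] nis sN.
  have nab : ~ abelian_mod tau (na_match n).
    have [R lk] := na_link_ex n.
    by move=> /(link_abelian lk); exact: na_nab.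
  have [[m|q] ms mE] := max_prime_seq indexN_max (indexN_max (inl n)) nab sN.
    by move: nis; rewrite -(na_match_inj mE) ms.
  by apply: nab; rewrite -[na_match n]mE; exact: khom_ker_abelian.
have [_ ind _ _] := pairsP r; apply: (ind p Lp).
apply: (ab_independent (inf_simple pi (ab_simple r)) (s := s) indexN_max); last first.
  by move=> x /sN[].
move=> [m|[q p' qP Lp']] js.
  left; have [R lk] := na_link_ex m.
  by move=> /(link_abelian lk); exact: na_nab.
right; exists (inf_mod pi (ab_mod q)), (hat p'.2),
  (hat_khom p'.2 (let: And5 _ d _ _ _ := ab_simple q in d)).
split.
- exact/inf_simple/ab_simple.
- exact: pairs_nz2.
- exact: normalSub_eq.
- move=> /inflate_iso/ab_rep_eq; rewrite rP qP => qr; subst q; exists p'.2.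
    exists p' => //; split=> // p'p; move: Lp' js; rewrite p'p => Lp' js.
    move: nis; rewrite (_ : PairIndex rP Lp = PairIndex qP Lp') ?js //.
    congr PairIndex; exact: Prop_irrelevance.
  by move=> k Kk; split=> [k0|[]].
Qed.

(** As tau' is fundamental it suffices that every maximal N contains the
  intersection of the family. A non-abelian N belongs to the family; for an
  abelian one the projection onto Ker tau' / N is, up to isomorphism, a
  combination of first components of pairs. *)
Lemma index_trivial k : ker tau' k -> (forall i, nset (indexN' i) k) -> k = 1.
Proof.
move=> Kk kN; have := fund'; rewrite /fundamental /fundament_ker.
case: pselect => [K1|_] /= M1; first by move: Kk; rewrite K1.
suff : (\bigcap_(N in maxnormal (ker tau')) (N : set H')) k by rewrite M1.
move=> N Nm; have [abl|nab] := pselect (abelian_mod tau' N); last first.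
  exact: (kN (inl (NaIndex Nm nab))).
pose r0 := AbIndex Nm abl; pose r := ab_rep r0.
have [f [g [fg gf]]] : gmod_iso (ab_mod r0) (ab_mod r) by exact/gmod_iso_sym/ab_repP.
have [phi phiE] : exists phi : ghom (B_ab tau' (ab_mod r)) (ab_mod r),
    forall k, ker tau' k -> hat phi k = f (kproj (@ab_ker r0) k).
  apply: (hat_exists (chi := fun k => f (kproj (@ab_ker r0) k))); first exact: ab_simple.
  by apply: khom_comp; apply: khom_kproj.
have : hat phi k = 0%R.
  have [_ _ _ /(_ phi)] := pairsP r; elim=> [|a x w [p Lp <-] _ wk]; first by [].
  rewrite hatD wk addr0 hatZ.
  have [_ ->] := kN (inr (PairIndex (ab_rep_idem r0) Lp)).
  exact: hom0.
rewrite phiE // -(hom0 f) => /(can_inj fg); exact: (iffLR (kproj0 _ Kk)).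
Qed.

Lemma theta_exists : exists theta : epi H H', semi_cartesian tau tau' pi theta.
Proof.
pose R i := projT1 (cid (index_link i)).
have lk i : link tau tau' pi (R i) (indexN i) (indexN' i) by rewrite /R; case: cid.
apply: (assemble lk); last exact: index_trivial.
- exact: independent_crt indexN_max index_independent.
- exact: independent_crt indexN'_max index_independent'.
Qed.

End Backward.

Unset Implicit Arguments.
Set Strict Implicit.

Theorem corollary8p9 (H G H' G' : profiniteType)
    (tau : epi H G) (tau' : epi H' G') (pi : epi G G') :
  fundamental tau -> fundamental tau' ->
  (exists theta : epi H H', semi_cartesian tau tau' pi theta) <->
  [/\ forall (E' : profiniteType) (zeta' : epi E' G'),
        indecomposable zeta' -> ~ abelian_ker zeta' ->
        mult_na tau' zeta' #<= mult_na tau (inf_epi pi zeta'),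
      forall A' : gmodule G', finite_simple A' ->
        H2inf pi A' @` supp_ab tau' A' `<=` supp_ab tau (inf_mod pi A') &
      forall A' : gmodule G', finite_simple A' ->
        card_add (nullity pi tau' A') (mult_ab tau' A')
          #<= mult_ab tau (inf_mod pi A')].
Proof.
move=> _ fund'; split=> [[theta [sq Kt]]|[hna hsupp hmult]]; last exact: theta_exists.
split=> [E' zeta' _ _|A' sA'|A' sA'].
- exact: forward_na sq Kt _ _.
- exact: forward_supp.
- exact: forward_mult.
Qed.
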